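(* Let $(X,\mathscr A,\mu)$ be a $\sigma$-finite measure space, $w\colon X\to\mathbb C$ an $\mathscr A$-measurable function and $\phi\colon X\to X$ an $\mathscr A$-measurable transformation such that $\mu_w\circ\phi^{-1}\ll\mu$. Suppose $C_{\phi,w}$ is densely defined. Let $p\in(0,\infty)$. Then the following four assertions are equivalent: (i) $C_{\phi,w}$ is $p$-hyponormal; (ii) for every $f\in L^2(\mu)$, $$\int_X(\mathsf h_{\phi,w}^p\circ\phi)\cdot|\mathsf E_{\phi,w}(f_w)|^2\,\mathrm d\mu_w\leqslant\int_X\mathsf h_{\phi,w}^p\cdot|f|^2\,\mathrm d\mu;$$ (iii) for every $\mathscr A$-measurable $f\colon X\to[0,\infty]$, $$\int_X(\mathsf h_{\phi,w}^p\circ\phi)\cdot\big(\mathsf E_{\phi,w}(f)\big)^2\,\mathrm d\mu_w\leqslant\int_X\mathsf h_{\phi,w}^p\cdot f^2\,\mathrm d\mu_w;$$ (iv) $\mathsf h_{\phi,w}>0$ a.e. $[\mu_w]$ and $\mathsf E_{\phi,w}\Big(\frac{\mathsf h_{\phi,w}^p\circ\phi}{\mathsf h_{\phi,w}^p}\Big)\leqslant1$ a.e. $[\mu_w]$.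
   Context: $\overline{\mathbb R}_+=[0,\infty]$, with the convention $0\cdot\infty=0$. A transformation $\phi\colon X\to X$ is $\mathscr A$-measurable if $\phi^{-1}(\Delta)\in\mathscr A$ for all $\Delta\in\mathscr A$. $\mu_w(\Delta)=\int_\Delta|w|^2\,\mathrm d\mu$ and $\mu_w\circ\phi^{-1}(\Delta)=\mu_w(\phi^{-1}(\Delta))$ for $\Delta\in\mathscr A$. If $\mu_w\circ\phi^{-1}\ll\mu$, then $\mathsf h_{\phi,w}\colon X\to\overline{\mathbb R}_+$ is the ($\mu$-a.e. unique) Radon–Nikodym derivative: $\mu_w\circ\phi^{-1}(\Delta)=\int_\Delta\mathsf h_{\phi,w}\,\mathrm d\mu$, $\Delta\in\mathscr A$, and the weighted composition operator $C_{\phi,w}$ in $L^2(\mu)$ is defined by $\mathcal D(C_{\phi,w})=\{f\in L^2(\mu)\colon w\cdot(f\circ\phi)\in L^2(\mu)\}$, $C_{\phi,w}f=w\cdot(f\circ\phi)$; it is a closed operator and it is densely defined iff $\mathsf h_{\phi,w}<\infty$ a.e. $[\mu]$. Assuming $\mathsf h_{\phi,w}<\infty$ a.e. $[\mu]$, $\mu_w|_{\phi^{-1}(\mathscr A)}$ is $\sigma$-finite, and $\mathsf E_{\phi,w}(f)$ denotes the conditional expectation of $f$ with respect to the $\sigma$-algebra $\phi^{-1}(\mathscr A)=\{\phi^{-1}(\Delta)\colon\Delta\in\mathscr A\}$ and the measure $\mu_w$, for $\mathscr A$-measurable $f\colon X\to\overline{\mathbb R}_+$ or $f\in L^q(\mu_w)$,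 $q\in[1,\infty]$. For $f\in L^2(\mu)$, $f_w=\chi_{\{w\neq0\}}\frac fw\in L^2(\mu_w)$. A closed densely defined operator $A$ in a complex Hilbert space is $p$-hyponormal ($p\in(0,\infty)$) if $\mathcal D(|A|^p)\subseteq\mathcal D(|A^*|^p)$ and $\||A^*|^pf\|\leqslant\||A|^pf\|$ for every $f\in\mathcal D(|A|^p)$. *)

(* Defs.v *)
From HB Require Import structures.
From mathcomp Require Import all_boot all_order all_algebra.
From mathcomp Require Import sesquilinear ring_quotient generic_quotient.
From mathcomp Require Import complex.
From mathcomp Require Import all_classical all_reals all_analysis.
From mathcomp Require Import measurable_realfun.
From mathcomp Require Import ring lra.

Set Implicit Arguments.
Unset Strict Implicit.
Unset Printing Implicit Defensive.

Import Order.TTheory GRing.Theory Num.Theory.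
Import numFieldNormedType.Exports.
Import ComplexField.Normc.

Local Open Scope classical_set_scope.
Local Open Scope ring_scope.

Section complex_functions.
Context d (X : measurableType d) (R : realType).
Implicit Types (mu : set X -> \bar R) (f g : X -> R[i]).

Definition cmeasurable f :=
  measurable_fun setT (fun x => complex.Re (f x)) /\
  measurable_fun setT (fun x => complex.Im (f x)).

(* Meaningful for f with integrable real and imaginary parts. *)
Definition cintegral mu (D : set X) f : R[i] :=
  Complex (fine (\int[mu]_(x in D) (complex.Re (f x))%:E)%E)
          (fine (\int[mu]_(x in D) (complex.Im (f x))%:E)%E).

Definition square_integrable mu f :=
  cmeasurable f /\ (\int[mu]_x (normc (f x) ^+ 2)%:E < +oo)%E.

End complex_functions.

Section square_integrable_theory.
Context d (X : measurableType d) (R : realType).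
Variable mu : {measure set X -> \bar R}.
Implicit Types f g : X -> R[i].
Implicit Types a b : X -> R.

Lemma sqr_normc (z : R[i]) :
  normc z ^+ 2 = complex.Re z ^+ 2 + complex.Im z ^+ 2.
Proof. by case: z => a b /=; rewrite sqr_sqrtr// addr_ge0// sqr_ge0. Qed.

Lemma measurable_sqr_normc f : cmeasurable f ->
  measurable_fun setT (fun x => normc (f x) ^+ 2).
Proof.
move=> [mr mi]; under eq_fun do rewrite sqr_normc.
by apply: measurable_funD; exact: measurable_funX.
Qed.

Lemma integrable_le_sqr_normc f g a (c : R) :
  square_integrable mu f -> square_integrable mu g ->
  measurable_fun setT a ->
  (forall x, `|a x| <= c * (normc (f x) ^+ 2 + normc (g x) ^+ 2)) -> 0 <= c ->
  mu.-integrable setT (EFin \o a).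
Proof.
move=> [mf If] [mg Ig] ma ale c0.
have J h : cmeasurable h -> (\int[mu]_x (normc (h x) ^+ 2)%:E < +oo)%E ->
    mu.-integrable setT (EFin \o (fun x => normc (h x) ^+ 2)).
  move=> mh Ih; apply/integrableP; split.
    exact/measurable_EFinP/measurable_sqr_normc.
  under eq_integral do rewrite /= ger0_norm ?sqr_ge0//.
  exact: Ih.
have := integrableZl measurableT c
  (integrableD measurableT (J _ mf If) (J _ mg Ig)).
apply: le_integrable => //; first exact/measurable_EFinP.
move=> x _ /=; rewrite lee_fin (le_trans (ale x))//.
by rewrite ler_norm.
Qed.

Lemma square_integrable0 : square_integrable mu (0 : X -> R[i]).
Proof.
split; first by split; exact: measurable_cst.
under eq_integral do rewrite [normc _]normc0 expr0n/=.
by rewrite integral0 ltry.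
Qed.

Lemma square_integrableZD (c : R[i]) f g :
  square_integrable mu f -> square_integrable mu g ->
  square_integrable mu (c *: f + g).
Proof.
move=> Lf Lg; have [[fr fi] _] := Lf; have [[gr gi] _] := Lg.
have m : cmeasurable (c *: f + g).
  case: c => cr ci; split.
  - rewrite (_ : (fun x => _) = (fun x =>
      cr * complex.Re (f x) - ci * complex.Im (f x) + complex.Re (g x))).
      apply: measurable_funD => //.
      by apply: measurable_funB; apply: measurable_funM.
    by apply/funext => x /=; rewrite /GRing.scale/= /GRing.add/=; case: (f x) (g x) => ? ? [].
  - rewrite (_ : (fun x => _) = (fun x =>
      cr * complex.Im (f x) + ci * complex.Re (f x) + complex.Im (g x))).
      apply: measurable_funD => //.
      by apply: measurable_funD; apply: measurable_funM.
    by apply/funext => x /=; rewrite /GRing.scale/= /GRing.add/=; case: (f x) (g x) => ? ? [].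
split=> //.
pose k := 2 * (normc c ^+ 2 + 1).
have k0 : 0 <= k by rewrite mulr_ge0// addr_ge0// sqr_ge0.
have : mu.-integrable setT (EFin \o (fun x => normc ((c *: f + g) x) ^+ 2)).
  apply: (integrable_le_sqr_normc (c := k) Lf Lg) => //.
    exact: measurable_sqr_normc.
  move=> x; rewrite ger0_norm ?sqr_ge0//.
  have -> : (c *: f + g) x = c * f x + g x by [].
  rewrite /k !sqr_normc {Lf Lg fr fi gr gi m k k0}.
  move: c (f x) (g x) => [cr ci] [fr fi] [gr gi] /=.
  set A := cr * fr - ci * fi; set B := cr * fi + ci * fr.
  have E : A ^+ 2 + B ^+ 2 = (cr ^+ 2 + ci ^+ 2) * (fr ^+ 2 + fi ^+ 2).
    by rewrite /A /B; ring.
  have h1 : (A + gr) ^+ 2 <= 2 * (A ^+ 2 + gr ^+ 2).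
    by have := sqr_ge0 (A - gr); nra.
  have h2 : (B + gi) ^+ 2 <= 2 * (B ^+ 2 + gi ^+ 2).
    by have := sqr_ge0 (B - gi); nra.
  have h3 := mulr_ge0 (addr_ge0 (sqr_ge0 cr) (sqr_ge0 ci))
                      (addr_ge0 (sqr_ge0 gr) (sqr_ge0 gi)).
  have h4 := addr_ge0 (sqr_ge0 fr) (sqr_ge0 fi).
  apply: (le_trans (lerD h1 h2)).
  move: (sqr_ge0 gr) (sqr_ge0 gi) => *.
  rewrite [leLHS](_ : _ = 2 * ((A ^+ 2 + B ^+ 2) + (gr ^+ 2 + gi ^+ 2))); last by ring.
  rewrite E; lra.
move=> /integrableP[_].
by under eq_integral do rewrite /= ger0_norm ?sqr_ge0//.
Qed.

Definition cintegrable f :=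
  mu.-integrable setT (fun x => (complex.Re (f x))%:E) /\
  mu.-integrable setT (fun x => (complex.Im (f x))%:E).

Lemma cintegrable_mul_conjc f g :
  square_integrable mu f -> square_integrable mu g ->
  cintegrable (fun x => f x * conjc (g x)).
Proof.
move=> Lf Lg; have [[fr fi] _] := Lf; have [[gr gi] _] := Lg.
split; apply: (integrable_le_sqr_normc (c := 1) Lf Lg) => //.
- rewrite (_ : (fun x => _) = (fun x =>
    complex.Re (f x) * complex.Re (g x) + complex.Im (f x) * complex.Im (g x))).
    by apply: measurable_funD; apply: measurable_funM.
  by apply/funext => x; case: (f x) (g x) => ? ? [? ?] /=; rewrite mulrN opprK.
- move=> x; rewrite mul1r !sqr_normc.
  case: (f x) (g x) => a b [c e] /=; rewrite ler_norml.
  have := (sqr_ge0 (a - c), sqr_ge0 (b - e), sqr_ge0 (a + c), sqr_ge0 (b + e)).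
  by case=> [[[? ?] ?] ?]; apply/andP; split; nra.
- rewrite (_ : (fun x => _) = (fun x =>
    complex.Im (f x) * complex.Re (g x) - complex.Re (f x) * complex.Im (g x))).
    by apply: measurable_funB; apply: measurable_funM.
  by apply/funext => x; case: (f x) (g x) => ? ? [? ?] /=; rewrite mulrN addrC.
- move=> x; rewrite mul1r !sqr_normc.
  case: (f x) (g x) => a b [c e] /=; rewrite ler_norml.
  have := (sqr_ge0 (b - c), sqr_ge0 (a - e), sqr_ge0 (b + c), sqr_ge0 (a + e)).
  by case=> [[[? ?] ?] ?]; apply/andP; split; nra.
Qed.

Lemma cintegralZD (c : R[i]) f g : cintegrable f -> cintegrable g ->
  cintegral mu setT (fun x => c * f x + g x) =
  c * cintegral mu setT f + cintegral mu setT g.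
Proof.
move=> [fr fi] [gr gi]; rewrite /cintegral; case: c => cr ci.
have H a b e k l : mu.-integrable setT (EFin \o a) ->
    mu.-integrable setT (EFin \o b) -> mu.-integrable setT (EFin \o e) ->
    Rintegral mu setT (fun x => k * a x + l * b x + e x) =
    k * Rintegral mu setT a + l * Rintegral mu setT b + Rintegral mu setT e.
  move=> ia ib ie.
  have ika : mu.-integrable setT (EFin \o (fun x => k * a x)).
    exact: (integrableZl measurableT k ia).
  have ilb : mu.-integrable setT (EFin \o (fun x => l * b x)).
    exact: (integrableZl measurableT l ib).
  rewrite RintegralD//; last exact: (integrableD measurableT ika ilb).
  rewrite RintegralD//.
  by rewrite !RintegralZl.
have Hr := H _ _ _ cr (- ci) fr fi gr.
have Hi := H _ _ _ ci cr fr fi gi.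
apply/eqP; rewrite eq_complex; apply/andP; split => /=; apply/eqP.
- rewrite -mulNr -[LHS]/(Rintegral _ _ (fun x => _)) -{}Hr; congr Rintegral.
  by apply/funext => x; case: (f x) (g x) => ? ? [? ?] /=; rewrite mulNr.
- rewrite [X in X + _]addrC -[LHS]/(Rintegral _ _ (fun x => _)) -{}Hi.
  congr Rintegral.
  apply/funext => x; case: (f x) (g x) => ? ? [? ?] /=.
  by rewrite [X in X + _ = _]addrC.
Qed.

End square_integrable_theory.

Section L2_space.
Context d (X : measurableType d) (R : realType).
Variable mu : {measure set X -> \bar R}.

Definition L2pred : {pred X -> R[i]} := [pred f | `[< square_integrable mu f >]].

Lemma L2pred_submod : GRing.submod_closed L2pred.
Proof.
split; first exact/asboolP/square_integrable0.
by move=> c f g /asboolP Lf /asboolP Lg; exact/asboolP/square_integrableZD.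
Qed.

HB.instance Definition _ :=
  GRing.isSubmodClosed.Build R[i] (X -> R[i]) L2pred L2pred_submod.

Record L2fun := MkL2fun { L2val :> X -> R[i]; _ : L2val \in L2pred }.
HB.instance Definition _ := [isSub for L2val].
HB.instance Definition _ := [Choice of L2fun by <:].
HB.instance Definition _ := [SubChoice_isSubLmodule of L2fun by <:].

Lemma L2funP (f : L2fun) : square_integrable mu f.
Proof. by case: f => f /= /asboolP. Qed.

Definition null_pred : {pred L2fun} :=
  [pred f | `[< {ae mu, forall x, (f : L2fun) x = 0} >]].

Lemma null_pred_zmod : zmod_closed null_pred.
Proof.
split; first by apply/asboolP; exact: aeW.
move=> f g /asboolP f0 /asboolP g0; apply/asboolP.
apply: filterS2 f0 g0 => x fx gx; rewrite [LHS]/(f x - g x) fx gx; exact: (subrr (0 : R[i])).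
Qed.
HB.instance Definition _ :=
  GRing.isZmodClosed.Build L2fun null_pred null_pred_zmod.

Definition L2space := Quotient.quot null_pred.
HB.instance Definition _ := GRing.Zmodule.on L2space.
HB.instance Definition _ := EqQuotient.on L2space.

Local Open Scope quotient_scope.

Definition L2class (f : L2fun) : L2space := \pi f.

Lemma L2classP (f g : L2fun) :
  L2class f = L2class g <-> {ae mu, forall x, f x = g x}.
Proof.
have -> : L2class f = L2class g <-> f - g \in null_pred.
  by rewrite Quotient.idealrBE; split => /eqP.
split=> [/asboolP|h]; last (apply/asboolP; move: h);
  apply: filterS => x; rewrite [(f - g : L2fun) x]/(f x - g x).
  by move/eqP; rewrite subr_eq0 => /eqP.
by move=> ->; exact: (subrr (g x)).
Qed.

Lemma L2class_repr (u : L2space) : L2class (repr u) = u.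
Proof. exact: reprK. Qed.

Definition L2scale (c : R[i]) (u : L2space) : L2space := L2class (c *: repr u).

Lemma L2classZ c f : L2scale c (L2class f) = L2class (c *: f).
Proof.
apply/L2classP; have /L2classP := L2class_repr (L2class f).
by apply: filterS => x; exact: (congr1 ( *%R c)).
Qed.

Lemma L2classD f g : L2class f + L2class g = L2class (f + g).
Proof. by rewrite /L2class [RHS]raddfD. Qed.

Lemma L2scaleA a b u : L2scale a (L2scale b u) = L2scale (a * b) u.
Proof. by rewrite -(L2class_repr u) !L2classZ scalerA. Qed.
Lemma L2scale1 : left_id 1 L2scale.
Proof. by move=> u; rewrite -(L2class_repr u) L2classZ scale1r. Qed.
Lemma L2scaleDr : right_distributive L2scale +%R.
Proof.
move=> c u v; rewrite -(L2class_repr u) -(L2class_repr v).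
by rewrite L2classD !L2classZ L2classD scalerDr.
Qed.
Lemma L2scaleDl u : {morph L2scale^~ u : a b / a + b}.
Proof.
by move=> a b; rewrite -(L2class_repr u) !L2classZ L2classD scalerDl.
Qed.
HB.instance Definition _ := GRing.Zmodule_isLmodule.Build R[i] L2space
  L2scaleA L2scale1 L2scaleDr L2scaleDl.

Definition L2dot (u v : L2space) : R[i] :=
  cintegral mu setT (fun x => repr u x * conjc (repr v x)).

Lemma L2dotE (f g : L2fun) :
  L2dot (L2class f) (L2class g) = cintegral mu setT (fun x => f x * conjc (g x)).
Proof.
have /L2classP ef := L2class_repr (L2class f).
have /L2classP eg := L2class_repr (L2class g).
have [ar ai] := cintegrable_mul_conjc (L2funP (repr (L2class f)))
                                      (L2funP (repr (L2class g))).
have [br bi] := cintegrable_mul_conjc (L2funP f) (L2funP g).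
rewrite /L2dot /cintegral; congr Complex; congr fine; apply: ae_eq_integral => //.
- exact: measurable_int ar.
- exact: measurable_int br.
- by apply: filterS2 ef eg => x -> ->.
- exact: measurable_int ai.
- exact: measurable_int bi.
- by apply: filterS2 ef eg => x -> ->.
Qed.

Lemma L2dot_linearl v : GRing.linear_for *%R (L2dot^~ v).
Proof.
move=> c u w; rewrite -(L2class_repr u) -(L2class_repr v) -(L2class_repr w).
rewrite [c *: _]L2classZ L2classD !L2dotE -cintegralZD.
- by congr cintegral; apply/funext => x; rewrite mulrA -mulrDl.
- by apply: cintegrable_mul_conjc; exact: L2funP.
- by apply: cintegrable_mul_conjc; exact: L2funP.
Qed.

Lemma L2dotC u v : L2dot u v = (-1) ^+ false * Num.conj (L2dot v u).
Proof.
rewrite expr0 mul1r; apply/eqP; rewrite eq_complex; apply/andP; split; apply/eqP.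
- rewrite /L2dot /=; congr fine; apply: eq_integral => x _; congr EFin.
  by case: (repr u x) (repr v x) => ? ? [? ?] /=; ring.
- rewrite /L2dot /= -[RHS]mulN1r.
  have [_ i] := cintegrable_mul_conjc (L2funP (repr v)) (L2funP (repr u)).
  rewrite -[RHS]RintegralZl//; congr Rintegral.
  apply/funext => x.
  by case: (repr u x) (repr v x) => ? ? [? ?] /=; ring.
Qed.

Lemma L2dot_linearr u : GRing.linear_for (Num.conj \; *%R) (L2dot u).
Proof.
move=> c v w; rewrite !(L2dotC u) !expr0 !mul1r L2dot_linearl.
by rewrite rmorphD rmorphM.
Qed.

HB.instance Definition _ := bilinear_isBilinear.Build R[i] L2space L2space R[i]
  *%R (Num.conj \; *%R) L2dot (L2dot_linearl, L2dot_linearr).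
HB.instance Definition _ :=
  isHermitianSesquilinear.Build R[i] L2space false Num.conj L2dot L2dotC.

Lemma L2dot_gt0 u : u != 0 -> 0 < L2dot u u.
Proof.
move=> u0.
have mn := measurable_sqr_normc (L2funP (repr u)).1.
have -> : L2dot u u = (fine (\int[mu]_x (normc (repr u x) ^+ 2)%:E)%E)%:C%C.
  rewrite /L2dot /cintegral; congr Complex.
    congr fine; apply: eq_integral => x _; congr EFin; rewrite sqr_normc.
    by case: (repr u x) => a b /=; ring.
  rewrite (_ : (fun x => _) = cst 0%E) ?integral0//.
  by apply/funext => x; case: (repr u x) => a b /=; congr EFin; ring.
rewrite ltcR fine_gt0// (L2funP (repr u)).2 andbT lt_neqAle.
rewrite integral_ge0 ?andbT; last by move=> x _; rewrite lee_fin sqr_ge0.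
apply: contra u0; rewrite eq_sym => /eqP I0.
have -> : 0 = L2class 0 :> L2space by rewrite /L2class raddf0.
apply/eqP; rewrite -(L2class_repr u); apply/L2classP.
have : ae_eq mu setT (fun x => (normc (repr u x) ^+ 2)%:E) (cst 0%E).
  apply/ae_eq_integral_abs => //; first exact/measurable_EFinP.
  by under eq_integral do rewrite gee0_abs ?lee_fin ?sqr_ge0//.
apply: filterS => x /(_ I) [] /eqP; rewrite sqrf_eq0 => /eqP.
by move=> /eq0_normc ->.
Qed.

HB.instance Definition _ := isDotProduct.Build R[i] L2space L2dot L2dot_gt0.
End L2_space.

(* Unbounded operators in an inner product space V are given by their graphs,
   as subsets of V * V; ip is linear in its first argument. *)
Section unbounded_operators.
Context (R : realType) (V : lmodType R[i]) (ip : {dot V for Num.conj}).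
Implicit Types (A B T : set (V * V)) (x y z : V).

Definition hnorm x : R := Num.sqrt (complex.Re (ip x x)).

Definition opdom A : set V := [set x | exists y, A (x, y)].

Definition linear_operator A :=
  [/\ A (0, 0),
      forall (c : R[i]) x y x' y', A (x, y) -> A (x', y') ->
        A (c *: x + x', c *: y + y')
    & forall y, A (0, y) -> y = 0].

Definition densely_defined A :=
  forall x (e : R), 0 < e -> exists2 y, opdom A y & hnorm (x - y) < e.

Definition closed_operator A :=
  forall (u v : nat -> V) x y, (forall n, A (u n, v n)) ->
    hnorm (u n - x) @[n --> \oo] --> (0 : R) ->
    hnorm (v n - y) @[n --> \oo] --> (0 : R) ->
    A (x, y).

(* The graph of a linear operator when A is densely defined. *)
Definition adjoint A : set (V * V) :=
  [set xy | forall u v, A (u, v) -> ip v xy.1 = ip u xy.2].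

Definition opcomp A B : set (V * V) :=
  [set xz | exists2 y, B (xz.1, y) & A (y, xz.2)].

Record spectral_measure (E : set R -> V -> V) : Prop := SpectralMeasure {
  spectral_linear : forall D, measurable D ->
    forall (c : R[i]) x y, E D (c *: x + y) = c *: E D x + E D y;
  spectral_idem : forall D, measurable D -> forall x, E D (E D x) = E D x;
  spectral_selfadj : forall D, measurable D ->
    forall x y, ip (E D x) y = ip x (E D y);
  spectralT : forall x, E setT x = x;
  spectral_sigma_additive : forall F : (set R)^nat,
    (forall n, measurable (F n)) -> trivIset setT F -> forall x,
    hnorm (E (\bigcup_n F n) x - \sum_(i < n) E (F i) x) @[n --> \oo]
      --> (0 : R) }.

Definition spectral_form (E : set R -> V -> V) x (D : set R) : \bar R :=
  (complex.Re (ip (E D x) x))%:E.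

Definition spectral_dom E (f : R -> R) : set V :=
  [set x | (\int[spectral_form E x]_t (f t ^+ 2)%:E < +oo)%E].

(* The operator \int f dE, for real f: the bounded complex measure <E(.)x, z>
   is a combination of positive ones by polarization. *)
Definition spectral_integral E (f : R -> R) : set (V * V) :=
  let q x := (Complex (fine (\int[spectral_form E x]_t (f t)%:E)%E) 0 : R[i]) in
  let i := (Complex 0 1 : R[i]) in
  [set xy | spectral_dom E f xy.1 /\
    forall z, spectral_dom E f z ->
      ip xy.2 z = 4^-1 * \sum_(k < 4) i ^+ k * q (xy.1 + i ^+ k *: z)].

(* Only meaningful for selfadjoint T, whose spectral measure is unique. *)
Definition spectral_measure_of T : set R -> V -> V :=
  xget (fun _ _ => 0) [set E | spectral_measure E /\ spectral_integral E id = T].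

(* T^s for a positive selfadjoint operator T and s > 0; the values of the power
   function on negative numbers are irrelevant. *)
Definition oppow T (s : R) : set (V * V) :=
  spectral_integral (spectral_measure_of T) (fun t => t `^ s).

Definition opabs A : set (V * V) := oppow (opcomp (adjoint A) A) 2^-1.

Definition p_hyponormal (p : R) A :=
  [/\ linear_operator A, closed_operator A, densely_defined A,
      opdom (oppow (opabs A) p) `<=` opdom (oppow (opabs (adjoint A)) p)
    & forall f g g', oppow (opabs A) p (f, g) ->
        oppow (opabs (adjoint A)) p (f, g') -> hnorm g' <= hnorm g].

End unbounded_operators.

Section weighted_composition.
Context d (X : measurableType d) (R : realType).
Variables (mu : {measure set X -> \bar R}) (phi : X -> X) (w : X -> R[i]).

Definition weighted_measure (D : set X) : \bar R :=
  (\int[mu]_(x in D) (normc (w x) ^+ 2)%:E)%E.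

Definition weighted_pushforward (D : set X) : \bar R :=
  weighted_measure (phi @^-1` D).

(* The graph of C_{phi,w} f = w * (f o phi); it is single-valued on classes when
   weighted_pushforward `<< mu. *)
Definition wcomp : set (L2space mu * L2space mu) :=
  [set uv | exists f g : L2fun mu,
    [/\ uv.1 = L2class f, uv.2 = L2class g
      & forall x, g x = w x * f (phi x)]].

(* A version of h_{phi,w}, the Radon-Nikodym derivative of weighted_pushforward
   with respect to mu. *)
Definition is_wcomp_deriv (h : X -> \bar R) :=
  [/\ measurable_fun setT h, forall x, (0 <= h x)%E
    & forall D, measurable D ->
        weighted_pushforward D = (\int[mu]_(x in D) h x)%E].

Definition wcomp_deriv : X -> \bar R := xget (cst 0%E) is_wcomp_deriv.

Definition preimage_measurable d' (Y : measurableType d') (g : X -> Y) :=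
  forall B, measurable B -> preimage_set_system setT phi measurable (g @^-1` B).

(* Conditional expectation with respect to the sigma-algebra phi^{-1}(A) and the
   measure weighted_measure, for [0, +oo]-valued measurable functions. *)
Definition is_condexp (f g : X -> \bar R) :=
  [/\ preimage_measurable g, forall x, (0 <= g x)%E
    & forall D, measurable D ->
        (\int[weighted_measure]_(x in phi @^-1` D) g x =
         \int[weighted_measure]_(x in phi @^-1` D) f x)%E].

Definition condexp (f : X -> \bar R) : X -> \bar R :=
  xget (cst 0%E) [set g | is_condexp f g].

(* The same for f in L^2(weighted_measure). *)
Definition is_condexpC (f g : X -> R[i]) :=
  [/\ preimage_measurable (fun x => complex.Re (g x)),
      preimage_measurable (fun x => complex.Im (g x)),
      square_integrable weighted_measure g
    & forall D, measurable D -> (weighted_measure (phi @^-1` D) < +oo)%E ->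
        cintegral weighted_measure (phi @^-1` D) g =
        cintegral weighted_measure (phi @^-1` D) f].

Definition condexpC (f : X -> R[i]) : X -> R[i] :=
  xget (cst 0) [set g | is_condexpC f g].

(* f_w, the function written chi_{w <> 0} f / w. *)
Definition divw (f : X -> R[i]) (x : X) : R[i] :=
  if w x == 0 then 0 else f x / w x.

End weighted_composition.

Arguments L2dot {d X R} mu u v.
Arguments wcomp {d X R} mu phi w.

(* Main.v *)
(**
  Write [h] for the Radon-Nikodym derivative and [b] for its finite version.
  All four assertions are compared with a fifth one: [b > 0] almost everywhere
  for [mu_w], and for every measurable [k >= 0],
    [\int k(phi) b(phi)^p / b^p dmu_w <= \int k b dmu],
  which says [E (h^p o phi / h^p) <= 1] in integrated form.

  Let [C] be the operator.  [C^*C] is multiplication by [b].  Every [u] in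
  [L^2(mu)] splits as [w (k o phi) + v] with [k o phi = E_(phi,w) (u_w)] and [v]
  orthogonal to the range of [C]; if [P] is the projection [u |-> w (k o phi)],
  then [C^*u = b k], [C^** = C] and [C C^* u = (b o phi) P u].  The operators
  [C^*C] and [C C^*] thus both have the shape [u |-> a P u], with [P] a
  projection commuting with the functions of [a]; their spectral measures are
  explicit, and [p]-hyponormality becomes
    [\int b^p |k|^2 b dmu <= \int b^p |u|^2 dmu].

  Spectral measures of an operator need not be unique a priori, so the powers
  are only known to be computed by some spectral measure [F].  If [G] is the
  explicit one and [G] of the open interval of radius [r'] around [c] kills [x],
  applying the resolvent at [c] again and again gives
  [|F(I) x| <= (r / r')^n |x|] for the closed interval [I] of radius [r < r'],
  so [F(I) x = 0]; hence [F = G] on intervals.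

  The fifth assertion implies the quadratic inequalities by duality, truncating
  [e = E f] and using [2 x y <= x^2 / s + s y^2].  Conversely the quadratic
  inequality is tested on [f = 1_Y b^-p] times functions of the form
  [1_D o phi]: it gives [b^p e^2 b <= e b], that is [b^p e b <= b], and [Y]
  increases to the whole space.
*)
Require Import Defs.
From HB Require Import structures.
From mathcomp Require Import all_boot all_order all_algebra.
From mathcomp Require Import sesquilinear ring_quotient generic_quotient.
From mathcomp Require Import complex.
From mathcomp Require Import all_classical all_reals all_analysis.
From mathcomp Require Import measurable_realfun.
From mathcomp Require Import ring lra.

Set Implicit Arguments.
Unset Strict Implicit.
Unset Printing Implicit Defensive.

Import Order.TTheory GRing.Theory Num.Theory.
Import numFieldNormedType.Exports.
Import ComplexField.Normc.

Local Open Scope classical_set_scope.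
Local Open Scope ring_scope.

(** * Densities and preimages *)

(** Nothing is integrated over the sigma-algebra [phi^-1(A)]: a conditional expectation is stored as
    a function [e] with [E f = e o phi], and its equation is moved to [mu], where the image of
    [mu_w] has density [b]. Such an [e] is determined only where [b > 0], hence the factor [b] in
    most almost-everywhere statements; it is removed after composition with [phi], since
    [b o phi > 0] almost everywhere for [mu_w]. The power [b^p] appears because [|C|^p] and
    [|C^*|^p] multiply by [b^(p/2)] and [(b o phi)^(p/2)], the latter after [P], and norms are
    squared. The test function [f = 1_Y b^-p] solves [b^p f^2 = f] on [Y]. The quadratic right side
    thus becomes [\int f dmu_w], linear in [f], and a conditional expectation preserves such
    integrals. In the resolvent argument the factor [r] comes from [F], which sees [T - c] with norm
    at most [r] on the closed interval, and [1 / r'] from [G], which inverts [T - c] off the open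
    interval with that bound. *)

Section density.
Local Open Scope ereal_scope.

Import HBNNSimple.

(** Multiplication is discontinuous at [0 * +oo], and densities here may be infinite. A limit [0] is
    therefore allowed only for the zero sequence. *)
Lemma cvge_nneg_mulr (R : realType) (k : nat -> \bar R) (l c : \bar R) :
  (forall n, 0 <= k n) -> k n @[n --> \oo] --> l -> 0 <= c ->
  (l = 0 -> forall n, k n = 0) ->
  k n * c @[n --> \oo] --> l * c.
Proof.
move=> k0 kl c0 l0; have [lE|lN0] := eqVneq l 0.
  rewrite (_ : (fun n => _) = cst (l * c)); first exact: cvg_cst.
  by apply/funext => n; rewrite l0 // lE.
have [cf|] := boolP (c \is a fin_num); first exact: cvgeZr.
rewrite ge0_fin_numE// -leNgt leye_eq => /eqP ->.
have l_gt0 : 0 < l.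
  rewrite lt0e lN0 -(cvg_lim _ kl)//; apply: lime_ge; last exact: nearW.
  by apply/cvg_ex; exists l.
rewrite gt0_muley//.
apply: cvg_near_cst.
have : \forall n \near \oo, 0 < k n.
  apply: (kl [set y | 0 < y]); apply: open_nbhs_nbhs; split => //.
  exact: open_ereal_gt_ereal.
by apply: filterS => n kn; rewrite gt0_muley.
Qed.

(* [weighted_measure] is a bare set function, not packed as a measure. *)
Lemma eq_raw_integral d (X : measurableType d) (R : realType)
    (m1 m2 : set X -> \bar R) (D : set X) (f : X -> \bar R) :
  (forall A, measurable A -> m1 A = m2 A) ->
  \int[m1]_(x in D) f x = \int[m2]_(x in D) f x.
Proof.
move=> m12; have E (h : {nnsfun X >-> R}) : sintegral m1 h = sintegral m2 h.
  by apply: eq_fsbigr => r _; rewrite m12.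
rewrite /integral; congr (ereal_sup _ - ereal_sup _);
  by apply/seteqP; split => _ [h hf <-]; exists h.
Qed.

(** Packs the image under [phi] of the measure with density [F], so that measure-theoretic results
    apply to it; with [phi] the identity it gives [mu_w]. *)
Lemma preimage_density_measure d d' (X : measurableType d) (Y : measurableType d')
    (R : realType) (mu : {measure set X -> \bar R}) (phi : X -> Y)
    (F : X -> \bar R) :
  measurable_fun setT phi -> measurable_fun setT F -> (forall x, 0 <= F x) ->
  exists nu : {measure set Y -> \bar R},
    forall D, nu D = \int[mu]_(x in phi @^-1` D) F x.
Proof.
move=> mphi mF F0; pose nu D := \int[mu]_(x in phi @^-1` D) F x.
have nu0 : nu set0 = 0 by rewrite /nu preimage_set0 integral_set0.
have nu_ge0 D : 0 <= nu D by apply: integral_ge0.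
have nus : semi_sigma_additive nu.
  move=> G mG tG mUG; rewrite /nu preimage_bigcup.
  apply: (semi_sigma_additive_nng_induced mF F0) => //.
  - by move=> n; rewrite -[X in measurable X]setTI; exact: mphi.
  - move=> i j _ _ [x [Gi Gj]]; apply: (tG i j I I); by exists (phi x).
  - by apply: bigcup_measurable => n _; rewrite -[X in measurable X]setTI; exact: mphi.
pose M := isMeasure.Build _ _ _ nu nu0 nu_ge0 nus.
pose nu' : {measure set Y -> \bar R} := HB.pack nu M.
by exists nu'.
Qed.

Lemma integral_comp_density d d' (X : measurableType d) (Y : measurableType d')
    (R : realType) (mu : {measure set X -> \bar R})
    (nu : {measure set Y -> \bar R}) (phi : X -> Y) (F : X -> \bar R)
    (k : Y -> \bar R) :
  measurable_fun setT phi -> measurable_fun setT F -> (forall x, 0 <= F x) ->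
  (forall D, measurable D -> \int[mu]_(x in phi @^-1` D) F x = nu D) ->
  measurable_fun setT k -> (forall y, 0 <= k y) ->
  \int[mu]_x (k (phi x) * F x) = \int[nu]_y k y.
Proof.
move=> mphi mF F0 FE mk k0.
have S (s : {nnsfun Y >-> R}) :
    \int[mu]_x ((s (phi x))%:E * F x) = \int[nu]_y (s y)%:E.
  rewrite integralT_nnsfun sintegralE.
  transitivity (\int[mu]_x (\sum_(r \in range s)
      (r%:E * ((\1_(s @^-1` [set r]) (phi x))%:E * F x)))).
    apply: eq_integral => x _; rewrite {1}(fimfunE s (phi x)) -fsumEFin//.
    rewrite ge0_mule_fsuml; last by move=> r; exact: nnfun_muleindic_ge0.
    by apply: eq_fsbigr => r _; rewrite EFinM muleA.
  have mI (r : R) : measurable_fun setT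
      (fun x => (\1_(s @^-1` [set r]) (phi x))%:E * F x).
    apply: emeasurable_funM => //; apply/measurable_EFinP.
    apply: (@measurableT_comp _ _ _ _ _ _ (\1_(s @^-1` [set r]) : Y -> R)) => //.
  rewrite ge0_integral_fsum//.
  - apply: eq_fsbigr => r; rewrite inE => -[y _ <-].
    rewrite ge0_integralZl//.
    + congr *%E; rewrite -FE//.
      rewrite [RHS]integral_mkcond; apply: eq_integral => x _.
      rewrite patchE indicE.
      have -> : (x \in phi @^-1` (s @^-1` [set s y])) =
                (phi x \in s @^-1` [set s y]) by apply/idP/idP; rewrite !inE.
      by case: ifP; rewrite ?mul1e ?mul0e.
    + by move=> x _; rewrite mule_ge0.
    + by rewrite lee_fin.
  - by move=> r; apply: emeasurable_funM => //; exact: measurable_cst.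
  - move=> r x _; rewrite muleA mule_ge0// -EFinM.
    exact: nnfun_muleindic_ge0.
pose g := nnsfun_approx measurableT mk.
have gk y : (g n y)%:E @[n --> \oo] --> k y by exact: cvg_nnsfun_approx.
have gnd y : {homo (fun n => (g n y)%:E) : n m / (n <= m)%N >-> n <= m}.
  by move=> n m nm; rewrite lee_fin; exact/lefP/nd_nnsfun_approx.
have gle n y : (g n y)%:E <= k y.
  by apply: (cvge_ge _ (gk y)); exists n => // m /= nm; exact: gnd.
have mg n : measurable_fun setT (fun y => (g n y)%:E).
  exact/measurable_EFinP.
have L : \int[nu]_y (g n y)%:E @[n --> \oo] --> \int[nu]_y k y.
  have -> : \int[nu]_y k y = \int[nu]_y limn (fun n => (g n y)%:E).
    by apply: eq_integral => y _; rewrite (cvg_lim _ (gk y)).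
  apply: cvg_monotone_convergence => //.
  by move=> n y _; rewrite lee_fin.
have L' : \int[mu]_x ((g n (phi x))%:E * F x) @[n --> \oo] -->
    \int[mu]_x (k (phi x) * F x).
  (* Where [k (phi x) = 0] the approximations, lying below [k], vanish too, so [F x = +oo] does no
     harm. *)
  have C x : (g n (phi x))%:E * F x @[n --> \oo] --> k (phi x) * F x.
    apply: cvge_nneg_mulr => // [n|kx0 n]; first by rewrite lee_fin.
    by apply/eqP; rewrite eq_le -{1}kx0 gle lee_fin/=.
  have -> : \int[mu]_x (k (phi x) * F x) =
      \int[mu]_x limn (fun n => (g n (phi x))%:E * F x).
    by apply: eq_integral => x _; rewrite (cvg_lim _ (C x)).
  apply: cvg_monotone_convergence => //.
  - move=> n; apply: emeasurable_funM => //.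
    exact: (measurableT_comp (mg n) mphi).
  - by move=> n x _; rewrite mule_ge0// lee_fin.
  - by move=> x _ n m nm; rewrite lee_wpmul2r//; exact: gnd.
apply: (cvg_unique _ L') => //.
move: L; rewrite (_ : (fun n => \int[nu]_y (g n y)%:E) =
  (fun n => \int[mu]_x ((g n (phi x))%:E * F x)))//.
by apply/funext => n; rewrite S.
Qed.

Lemma measurable_preimageT d d' (X : measurableType d) (Y : measurableType d')
    (phi : X -> Y) (D : set Y) :
  measurable_fun setT phi -> measurable D -> measurable (phi @^-1` D).
Proof. by move=> mphi mD; rewrite -[X in measurable X]setTI; exact: mphi. Qed.

(* Writes a nonnegative function as a series of bounded ones, which reduces the
   s-finite Radon-Nikodym theorem below to the finite one. *)
Lemma nneg_telescope_mine (R : realType) (a : \bar R) : 0 <= a ->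
  a = \sum_(n <oo) (mine a n.+1%:R%:E - mine a n%:R%:E).
Proof.
move=> a0; apply/esym/cvg_lim => //.
have fn n : mine a n%:R%:E \is a fin_num.
  rewrite ge0_fin_numE; last by rewrite le_min a0 lee_fin/=.
  by rewrite gt_min ltry orbT.
have -> : (fun n => \sum_(0 <= i < n) (mine a i.+1%:R%:E - mine a i%:R%:E)) =
    (fun n => mine a n%:R%:E).
  apply/funext; elim=> [|n IH].
    by rewrite big_geq//; apply/esym/min_idPr.
  by rewrite big_nat_recr//= IH addeC subeK.
move: a a0 {fn} => [r r0||//].
- apply: cvg_near_cst; exists (Num.trunc r).+1 => // n /= rn.
  apply/min_idPl; rewrite lee_fin.
  by rewrite (le_trans (ltW (truncnS_gt r)))// ler_nat.
- move=> _; under eq_fun do rewrite min_r ?leey//.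
  exact/cvgeryP/cvgr_idn.
Qed.

Lemma sigma_finite_cover d (X : measurableType d) (R : realType)
    (mu : {sigma_finite_measure set X -> \bar R}) :
  exists A : (set X)^nat, [/\ forall n, measurable (A n), forall n, mu (A n) < +oo,
    nondecreasing_seq A & \bigcup_n A n = setT].
Proof.
have [F TF /all_and2[mF muF]] := sigma_finiteT mu.
exists (fun n => \big[setU/set0]_(i < n.+1) F i); split.
- by move=> n; exact: bigsetU_measurable.
- move=> n; apply: (@le_lt_trans _ _ (\sum_(i < n.+1) mu (F i))).
    exact: Boole_inequality.
  by apply: lte_sum_pinfty => i _; exact: muF.
- by move=> n m nm; apply/subsetPset/subset_bigsetU.
- by rewrite TF; apply/esym; rewrite bigcup_bigsetU_bigcup.
Qed.

(** The image of [F mu] need not be sigma-finite. [F] is cut into bounded layers and each layer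
    along a cover by sets of finite measure; every piece has a finite image measure with a density,
    and the densities are summed. The sum [H] may be infinite. *)
Lemma preimage_density_exists d d' (X : measurableType d) (Y : measurableType d')
    (R : realType) (mu : {sigma_finite_measure set X -> \bar R})
    (nu : {sigma_finite_measure set Y -> \bar R}) (phi : X -> Y)
    (F : X -> \bar R) :
  measurable_fun setT phi -> measurable_fun setT F -> (forall x, 0 <= F x) ->
  (forall D, measurable D -> nu D = 0 -> \int[mu]_(x in phi @^-1` D) F x = 0) ->
  exists H : Y -> \bar R, [/\ measurable_fun setT H, forall y, 0 <= H y &
    forall D, measurable D ->
      \int[mu]_(x in phi @^-1` D) F x = \int[nu]_(y in D) H y].
Proof.
move=> mphi.
have mpre D : measurable D -> measurable (phi @^-1` D) by exact: measurable_preimageT.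
have sum_ (G : X -> \bar R) (Gn : (X -> \bar R)^nat) :
    (forall n, measurable_fun setT (Gn n)) -> (forall n x, 0 <= Gn n x) ->
    (forall x, G x = \sum_(n <oo) Gn n x) ->
    (forall n, exists H : Y -> \bar R, [/\ measurable_fun setT H,
      forall y, 0 <= H y & forall D, measurable D ->
      \int[mu]_(x in phi @^-1` D) Gn n x = \int[nu]_(y in D) H y]) ->
    exists H : Y -> \bar R, [/\ measurable_fun setT H, forall y, 0 <= H y &
      forall D, measurable D ->
      \int[mu]_(x in phi @^-1` D) G x = \int[nu]_(y in D) H y].
  move=> mG G0 GE /choice[H /all_and3[mH H0 HE]].
  exists (fun y => \sum_(n <oo) H n y); split.
  - exact: ge0_emeasurable_sum.
  - by move=> y; exact: nneseries_ge0.
  - move=> D mD; under eq_integral do rewrite GE.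
    rewrite !integral_nneseries//; first by apply: eq_eseriesr => n _; rewrite HE.
    + by move=> n; exact: measurable_funTS.
    + exact: mpre.
    + by move=> n; exact: measurable_funTS.
have fin_ (G : X -> \bar R) : measurable_fun setT G -> (forall x, 0 <= G x) ->
    (forall D, measurable D -> nu D = 0 -> \int[mu]_(x in phi @^-1` D) G x = 0) ->
    \int[mu]_x G x < +oo ->
    exists H : Y -> \bar R, [/\ measurable_fun setT H, forall y, 0 <= H y &
      forall D, measurable D ->
      \int[mu]_(x in phi @^-1` D) G x = \int[nu]_(y in D) H y].
  move=> mG G0 Gnu Gfin.
  have [m mE] := preimage_density_measure mu mphi mG G0.
  have mT : m setT < +oo by rewrite mE preimage_setT.
  pose m' : {finite_measure set Y -> \bar R} := mfrestr measurableT mT.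
  have mnu : m' `<< nu.
    by apply/null_content_dominatesP => D mD nuD; rewrite /m'/= /mfrestr /mrestr setIT mE Gnu.
  have [H [H0 _ iH HE]] := radon_nikodym_sigma_finite mnu.
  exists H; split => //; first exact: measurable_int iH.
  by move=> D mD; rewrite -mE -HE// /m'/= /mfrestr /mrestr setIT.
have [A [mA Afin ndA AT]] := sigma_finite_cover mu.
have bnd_ (G : X -> \bar R) : measurable_fun setT G -> (forall x, 0 <= G x) ->
    (forall D, measurable D -> nu D = 0 -> \int[mu]_(x in phi @^-1` D) G x = 0) ->
    (forall x, G x <= 1) ->
    exists H : Y -> \bar R, [/\ measurable_fun setT H, forall y, 0 <= H y &
      forall D, measurable D ->
      \int[mu]_(x in phi @^-1` D) G x = \int[nu]_(y in D) H y].
  (* The cover is made disjoint so that [G] is the series of its restrictions. *)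
  move=> mG G0 Gnu G1; pose E := seqDU A.
  have mE n : measurable (E n).
    by apply: measurableD => //; exact: bigsetU_measurable.
  have mGn n : measurable_fun setT (G \_ (E n)).
    by apply/(measurable_restrictT _ (mE n)).1; exact: measurable_funTS.
  have Gn0 n x : 0 <= (G \_ (E n)) x by rewrite patchE; case: ifP.
  apply: (sum_ _ (fun n => G \_ (E n))) => //.
    move=> x; have [k _ Ek] : (\bigcup_n E n) x by rewrite -seqDU_bigcup_eq AT.
    apply/esym/cvg_lim => //; apply: cvg_near_cst; exists k.+1 => // n /= kn.
    rewrite (bigD1_seq k) ?mem_index_iota ?iota_uniq//= big1 ?adde0.
      by rewrite patchE mem_set.
    move=> i ik; rewrite patchE memNset// => Ei; move/eqP : ik; apply.
    by apply: (trivIset_seqDU A) => //; exists x.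
  move=> n; apply: fin_ => //.
  - move=> D mD nuD; apply/eqP; rewrite eq_le integral_ge0// andbT.
    rewrite -(Gnu _ mD nuD); apply: ge0_le_integral => //.
    + exact: mpre.
    + exact: measurable_funTS.
    + exact: measurable_funTS.
    + by move=> x _; rewrite patchE; case: ifP.
  - rewrite -integral_mkcond; apply: (@le_lt_trans _ _ (\int[mu]_(x in E n) 1)).
      apply: ge0_le_integral => //; exact: measurable_funTS.
    rewrite integral_cst// mul1e; apply: le_lt_trans (Afin n).
    by apply: le_measure; rewrite ?inE//; exact: subDsetl.
move=> mF F0 Fnu.
(* Each layer is at most [1], and at most [F], from which it inherits absolute continuity. *)
pose L n x := mine (F x) n.+1%:R%:E - mine (F x) n%:R%:E.
have Fmn x n : mine (F x) n%:R%:E \is a fin_num.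
  rewrite ge0_fin_numE; last by rewrite le_min F0 lee_fin/=.
  by rewrite gt_min ltry orbT.
have mL n : measurable_fun setT (L n).
  by apply: emeasurable_funB; apply: measurable_mine.
have L0 n x : 0 <= L n x.
  rewrite sube_ge0 ?Fmn//.
  by rewrite le_min ge_min lexx/= ge_min lee_fin ler_nat leqnSn orbT.
have LF n x : L n x <= F x.
  rewrite leeBlDr//; apply: (@le_trans _ _ (F x)); first by rewrite ge_min lexx.
  by rewrite leeDl// le_min F0 lee_fin/=.
have L1 n x : L n x <= 1.
  rewrite leeBlDr// addeC; have [xn|nx] := leP (F x) n%:R%:E.
    by rewrite (@le_trans _ _ (F x))// ?ge_min ?lexx// leeDl.
  by rewrite ge_min -EFinD -natr1 lexx orbT.
apply: (sum_ _ L) => //; first by move=> x; exact: nneg_telescope_mine.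
move=> n; apply: bnd_ => //.
move=> D mD nuD; apply/eqP; rewrite eq_le integral_ge0// andbT.
rewrite -(Fnu _ mD nuD); apply: ge0_le_integral => //.
- exact: mpre.
- exact: measurable_funTS.
- exact: measurable_funTS.
Qed.

(** Where the inequality fails, [g] is finite and the gap to [f] exceeds some [1/(n+1)]. On [B n]
    the integral of [g] is finite and can be cancelled, so the gap forces [mu (B n) = 0]. *)
Lemma ae_le_of_integral d (X : measurableType d) (R : realType)
    (mu : {sigma_finite_measure set X -> \bar R}) (f g : X -> \bar R) :
  measurable_fun setT f -> (forall x, 0 <= f x) ->
  measurable_fun setT g -> (forall x, 0 <= g x) ->
  (forall D, measurable D -> \int[mu]_(x in D) f x <= \int[mu]_(x in D) g x) ->
  {ae mu, forall x, f x <= g x}.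
Proof.
move=> mf f0 mg g0 fg.
have [A [mA Afin ndA AT]] := sigma_finite_cover mu.
pose B n := A n `&` [set x | g x <= n%:R%:E] `&` [set x | g x + n.+1%:R^-1%:E <= f x].
have mB n : measurable (B n).
  apply: measurableI; first apply: measurableI => //.
    rewrite -[X in measurable X]setTI; exact: emeasurable_fun_infty_c.
  rewrite -[X in measurable X]setTI; apply: emeasurable_fun_le => //.
  by apply: emeasurable_funD => //; exact: measurable_cst.
have B0 n : mu (B n) = 0.
  have Bfin : mu (B n) < +oo.
    by apply: le_lt_trans (Afin n); apply: le_measure; rewrite ?inE// => x [[]].
  have gfin : \int[mu]_(x in B n) g x < +oo.
    apply: (@le_lt_trans _ _ (\int[mu]_(x in B n) (cst n%:R%:E) x)).
      apply: ge0_le_integral => //; first exact: measurable_funTS.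
      by move=> x [[]].
    by rewrite integral_cst// lte_mul_pinfty// lee_fin.
  have := fg _ (mB n).
  have : \int[mu]_(x in B n) (g x + n.+1%:R^-1%:E) <= \int[mu]_(x in B n) f x.
    apply: ge0_le_integral => //.
    - by move=> x _; rewrite adde_ge0// lee_fin.
    - by apply: emeasurable_funD; [exact: measurable_funTS|exact: measurable_cst].
    - exact: measurable_funTS.
    - by move=> x [].
  rewrite ge0_integralD//; last exact: measurable_funTS.
  rewrite integral_cst// => /le_trans /[apply].
  rewrite -[leRHS]adde0 leeD2lE; last first.
    by rewrite ge0_fin_numE// integral_ge0.
  rewrite pmule_rle0; last by rewrite lte_fin invr_gt0.
  by move=> h; apply/eqP; rewrite eq_le h measure_ge0.
exists (\bigcup_n B n); split.
- exact: bigcup_measurable.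
- apply/eqP; rewrite eq_le measure_ge0 andbT.
  apply: (le_trans (generalized_Boole_inequality _ _ _)) => //.
    exact: bigcup_measurable.
  by rewrite eseries0// => n _ _; exact: B0.
- move=> x /= /negP; rewrite -ltNge => gf.
  have gx : g x \is a fin_num by rewrite ge0_fin_numE// (lt_le_trans gf)// leey.
  have [k _ Ak] : (\bigcup_n A n) x by rewrite AT.
  have [e e0 eg] : exists2 e : R, (0 < e)%R & g x + e%:E <= f x.
    move: gf; rewrite -(fineK gx); case: (f x) => [r||//] gf.
      exists (r - fine (g x))%R; first by rewrite subr_gt0 -lte_fin.
      by rewrite -EFinD addrC subrK.
    by exists 1%R => //; rewrite leey.
  (* A single index has to serve the cover, the bound on [g x] and the size [e] of the gap. *)
  pose n := maxn k (maxn (Num.trunc (fine (g x))).+1 (Num.trunc e^-1).+1).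
  exists n => //; split; [split|] => /=.
  - by move: Ak; apply/subsetPset/ndA; rewrite leq_maxl.
  - rewrite -(fineK gx) lee_fin; apply: (le_trans (ltW (truncnS_gt _))).
    by rewrite ler_nat /n leq_max leq_max leqnn orbT.
  - apply: le_trans eg; rewrite leeD2l// lee_fin invf_ple ?posrE//.
    apply: (le_trans (ltW (truncnS_gt _))); rewrite ler_nat.
    by rewrite /n; apply: leqW; rewrite !leq_max leqnn !orbT.
Qed.

Lemma ereal_rat_dense (R : realType) (a b : \bar R) : a < b ->
  exists q : rat, (a < (ratr q)%:E) && ((ratr q)%:E < b).
Proof.
have H (x y : R) : (x < y)%R -> a <= x%:E -> y%:E <= b ->
    exists q : rat, (a < (ratr q)%:E) && ((ratr q)%:E < b).
  move=> /rat_in_itvoo[q]; rewrite in_itv/= => /andP[xq qy] ax yb.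
  by exists q; rewrite (le_lt_trans ax) ?lte_fin//= (lt_le_trans _ yb)// lte_fin.
move: a b H => [a||] [b||]// H ab.
- exact: (H a b).
- by apply: (H a (a + 1)%R); rewrite ?leey// ltrDl.
- by apply: (H (b - 1)%R b); rewrite ?leNye// gtrBl.
- by apply: (H 0%R 1%R); rewrite ?leNye ?leey.
Qed.

(** Doob-Dynkin factorization. For rational [q] the set where [g > q] is the preimage of some [B q],
    and [e y] is the supremum of the [q] with [y] in [B q]. *)
Lemma preimage_measurable_factor d (X : measurableType d) (R : realType)
    (phi : X -> X) (g : X -> \bar R) :
  preimage_measurable phi g ->
  exists2 e : X -> \bar R, measurable_fun setT e & forall x, g x = e (phi x).
Proof.
move=> mg.
have /choice[B BP] (q : rat) : exists B, measurable B /\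
    [set x | (ratr q)%:E < g x] = phi @^-1` B.
  have [B mB] := mg _ (emeasurable_itv `](ratr q)%:E, +oo[).
  rewrite setTI => BE; exists B; split => //; rewrite BE.
  by apply/seteqP; split => x /=; rewrite in_itv/= andbT.
pose u n y : \bar R := if unpickle n is Some q then
  if y \in B q then (ratr q)%:E else -oo else -oo.
have mu_ n : measurable_fun setT (u n).
  rewrite /u; case: unpickle => [q|]; last exact: measurable_cst.
  apply: measurable_fun_ifT => //.
  apply: (measurable_fun_bool true) => //.
  by rewrite setTI preimage_mem_true; exact: (BP q).1.
exists (fun y => ereal_sup [set u n y | n in setT]).
  have := measurable_fun_esups mu_ 0%N.
  congr measurable_fun; apply/funext => y; congr ereal_sup.
  by apply/seteqP; split => _ [n _ <-]; exists n.
move=> x; apply/eqP; rewrite eq_le; apply/andP; split.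
  rewrite leNgt; apply/negP => lt.
  have [q /andP[q1 q2]] : exists q : rat, (ereal_sup [set u n (phi x) | n in setT] < (ratr q)%:E) && ((ratr q)%:E < g x).
    exact: ereal_rat_dense.
  have : u (pickle q) (phi x) <= ereal_sup [set u n (phi x) | n in setT].
    by apply: ereal_sup_ubound; exists (pickle q).
  rewrite /u pickleK.
  have : (phi @^-1` B q) x by rewrite -(BP q).2.
  rewrite /= => ?; rewrite ifT ?inE//.
  by rewrite leNgt q1.
apply: ge_ereal_sup => _ [n _ <-]; rewrite /u.
case: unpickle => [q|]; last by rewrite leNye.
case: ifPn; last by rewrite leNye.
rewrite inE => Bq; have : (phi @^-1` B q) x by [].
by rewrite -(BP q).2 => /ltW.
Qed.
End density.

(** * Spectral measures and their uniqueness *)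

Section real_inner_product.
Context (R : realType) (V : lmodType R[i]) (ip : {dot V for Num.conj}).
Implicit Types u v x y z : V.

(** [hnorm] and [spectral_form] see only the real part of [ip], which is symmetric and bilinear over
    the reals. Complex identities are recovered by testing with [i *: u] as well. *)
Definition rdot u v : R := complex.Re (ip u v).
Definition sqn u : R := rdot u u.

Lemma Re_conj_complex (z : R[i]) : complex.Re (Num.conj z) = complex.Re z.
Proof. by case: z. Qed.

Lemma rdotC u v : rdot u v = rdot v u.
Proof. by rewrite /rdot (hermC ip u v) expr0 mul1r Re_conj_complex. Qed.

Lemma rdotDl u v z : rdot (u + v) z = rdot u z + rdot v z.
Proof. by rewrite /rdot linearDl raddfD. Qed.

Lemma rdotDr u v z : rdot z (u + v) = rdot z u + rdot z v.
Proof. by rewrite rdotC rdotDl !(rdotC z). Qed.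

Lemma rdotNl u z : rdot (- u) z = - rdot u z.
Proof. by rewrite /rdot linearNl raddfN. Qed.

Lemma rdotNr u z : rdot z (- u) = - rdot z u.
Proof. by rewrite rdotC rdotNl rdotC. Qed.

Lemma rdotBl u v z : rdot (u - v) z = rdot u z - rdot v z.
Proof. by rewrite rdotDl rdotNl. Qed.

Lemma rdotBr u v z : rdot z (u - v) = rdot z u - rdot z v.
Proof. by rewrite rdotDr rdotNr. Qed.

Lemma rdotZl (c : R) u z : rdot (c%:C%C *: u) z = c * rdot u z.
Proof.
rewrite /rdot linearZl_LR /=; case: (ip u z) => a b /=.
by rewrite mul0r subr0.
Qed.

Lemma rdotZr (c : R) u z : rdot z (c%:C%C *: u) = c * rdot z u.
Proof. by rewrite rdotC rdotZl rdotC. Qed.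

Lemma rdot0l z : rdot 0 z = 0.
Proof. by rewrite /rdot linear0l. Qed.

Lemma rdot0r z : rdot z 0 = 0.
Proof. by rewrite rdotC rdot0l. Qed.

Lemma sqn0 : sqn 0 = 0.
Proof. exact: rdot0l. Qed.

Lemma sqn_ge0 u : 0 <= sqn u.
Proof.
have := dnorm_ge0 ip u; rewrite /sqn /rdot; case: (ip u u) => a b.
by rewrite lecE /= => /andP[].
Qed.

Lemma ip_sqn u : ip u u = (sqn u)%:C%C.
Proof.
have := dnorm_ge0 ip u; rewrite /sqn /rdot; case: (ip u u) => a b.
by rewrite lecE /= => /andP[/eqP -> _].
Qed.

Lemma sqn_eq0 u : sqn u = 0 -> u = 0.
Proof. by move=> u0; apply/eqP; rewrite -(dnorm_eq0 ip) ip_sqn u0. Qed.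

Lemma sqnZ (c : R) u : sqn (c%:C%C *: u) = c ^+ 2 * sqn u.
Proof. by rewrite /sqn rdotZl rdotZr mulrA. Qed.

Lemma sqnN u : sqn (- u) = sqn u.
Proof. by rewrite /sqn rdotNl rdotNr opprK. Qed.

Lemma sqnD u v : sqn (u + v) = sqn u + sqn v + 2 * rdot u v.
Proof. by rewrite /sqn rdotDl !rdotDr (rdotC v u); ring. Qed.

Lemma sqnB u v : sqn (u - v) = sqn u + sqn v - 2 * rdot u v.
Proof. by rewrite sqnD sqnN rdotNr; ring. Qed.

Lemma rdot_sqr_le u v : rdot u v ^+ 2 <= sqn u * sqn v.
Proof.
have [v0|v0] := eqVneq (sqn v) 0.
  by rewrite (sqn_eq0 v0) rdot0r expr0n mulr_ge0 ?sqn_ge0.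
have vp : 0 < sqn v by rewrite lt_neqAle eq_sym v0 sqn_ge0.
(* The component of [u] orthogonal to [v], multiplied by [sqn v] to avoid a quotient. *)
have := sqn_ge0 ((sqn v)%:C%C *: u - (rdot u v)%:C%C *: v).
rewrite sqnB !sqnZ rdotZl rdotZr.
have -> : sqn v ^+ 2 * sqn u + rdot u v ^+ 2 * sqn v -
  2 * (sqn v * (rdot u v * rdot u v)) = sqn v * (sqn u * sqn v - rdot u v ^+ 2).
  by ring.
by rewrite pmulr_rge0// subr_ge0.
Qed.

Lemma rdot_le u v : `|rdot u v| <= hnorm ip u * hnorm ip v.
Proof.
rewrite -[leLHS]sqrtr_sqr /hnorm -sqrtrM ?sqn_ge0//.
by rewrite ler_wsqrtr// rdot_sqr_le.
Qed.

Lemma hnorm_sqr u : hnorm ip u ^+ 2 = sqn u.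
Proof. by rewrite sqr_sqrtr// sqn_ge0. Qed.

Lemma hnorm_eq0 u : hnorm ip u = 0 -> u = 0.
Proof. by move=> u0; apply: sqn_eq0; rewrite -hnorm_sqr u0 expr0n. Qed.

End real_inner_product.

(** For real [q] the terms [k = 1] and [k = 3] of the polarization sum are purely imaginary, so only
    two values of [q] remain. *)
Lemma Re_polarization (R : realType) (V : lmodType R[i]) (q : V -> R) (x z : V) :
  let i := Complex 0 1 : R[i] in
  complex.Re (4^-1 * \sum_(k < 4) i ^+ k * (q (x + i ^+ k *: z))%:C%C) =
  4^-1 * (q (x + z) - q (x - z)).
Proof.
move=> i; have i2 : i ^+ 2 = -1.
  by apply/eqP; rewrite eq_complex expr2 /=; apply/andP; split; apply/eqP; ring.
have -> : \sum_(k < 4) i ^+ k * (q (x + i ^+ k *: z))%:C%C =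
    i ^+ 0 * (q (x + i ^+ 0 *: z))%:C%C + (i ^+ 1 * (q (x + i ^+ 1 *: z))%:C%C +
    (i ^+ 2 * (q (x + i ^+ 2 *: z))%:C%C + (i ^+ 3 * (q (x + i ^+ 3 *: z))%:C%C + 0))).
  by rewrite !big_ord_recl big_ord0.
have -> : i ^+ 3 = - i by rewrite exprS i2 mulrN1.
rewrite i2 !expr0 expr1 scale1r scaleN1r.
have -> : (4^-1 : R[i]) = (4^-1 : R)%:C%C by rewrite fmorphV rmorph_nat.
by rewrite /=; ring.
Qed.

Section spectral_measure_theory.
Context (R : realType) (V : lmodType R[i]) (ip : {dot V for Num.conj}).
Variable F : set R -> V -> V.
Hypothesis HF : spectral_measure ip F.
Implicit Types (D A B : set R) (x y z : V).
Local Notation rdot := (rdot ip).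
Local Notation sqn := (sqn ip).

Lemma specD D x y : measurable D -> F D (x + y) = F D x + F D y.
Proof. by move=> mD; have := spectral_linear HF mD 1 x y; rewrite !scale1r. Qed.

Lemma spec0 D : measurable D -> F D 0 = 0.
Proof.
by move=> mD; have := specD 0 0 mD; rewrite addr0 -{1}[F D 0]addr0 => /addrI.
Qed.

Lemma specZ D c x : measurable D -> F D (c *: x) = c *: F D x.
Proof. by move=> mD; have := spectral_linear HF mD c x 0; rewrite !addr0 spec0// addr0. Qed.

Lemma specN D x : measurable D -> F D (- x) = - F D x.
Proof. by move=> mD; rewrite -scaleN1r specZ// scaleN1r. Qed.

Lemma specB D x y : measurable D -> F D (x - y) = F D x - F D y.
Proof. by move=> mD; rewrite specD// specN. Qed.

Lemma rdot_spec D x y : measurable D -> rdot (F D x) y = rdot x (F D y).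
Proof. by move=> mD; rewrite /rdot/= (spectral_selfadj HF). Qed.

Lemma rdot_spec_sqn D x : measurable D -> rdot (F D x) x = sqn (F D x).
Proof. by move=> mD; rewrite /sqn -(spectral_idem HF mD x) rdot_spec// (spectral_idem HF mD). Qed.

Lemma sqn_spec_le D x : measurable D -> sqn (F D x) <= sqn x.
Proof.
move=> mD; have := sqn_ge0 ip (x - F D x).
by rewrite sqnB (rdotC _ x) rdot_spec_sqn//; lra.
Qed.

(** For the constant sequence [set0] the partial sums are the multiples of [a = F set0 x]. Two
    consecutive ones are both eventually close to [a], hence their difference, which is [a], has
    norm [0]. *)
Lemma spec_set0 x : F set0 x = 0.
Proof.
have := spectral_sigma_additive HF (F := fun=> set0) (fun=> measurable0).
move=> /(_ (@trivIset_set0 _ _ _) x).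
set a := F set0 x; rewrite bigcup_const//.
set h := (fun n => _) => h0.
have h1 : (h \o S) @ \oo --> (0 : R) by rewrite cvg_shiftS.
have h2 : (fun n => 2 * (h n * h n + h n.+1 * h n.+1)) @ \oo --> (0 : R).
  rewrite [X in _ --> X](_ : 0 = 2 * (0 * 0 + 0 * 0)); last by rewrite !mulr0 addr0 mulr0.
  by apply: cvgM; [exact: cvg_cst|apply: cvgD; apply: cvgM].
apply: (@sqn_eq0 _ _ ip); apply/eqP; rewrite eq_le sqn_ge0 andbT.
apply: (cvgr_to_ge h2); apply: nearW => n.
rewrite /h -!expr2 !hnorm_sqr big_ord_recr/= -/a.
set s := \sum_(i < n) _.
have -> : sqn a = sqn ((a - s) - (a - (s + a))).
  by congr sqn; rewrite opprB addrK subrK.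
rewrite sqnB; have := sqn_ge0 ip ((a - s) + (a - (s + a))).
by rewrite sqnD; lra.
Qed.

Lemma spec_setU A B x : measurable A -> measurable B -> A `&` B = set0 ->
  F (A `|` B) x = F A x + F B x.
Proof.
move=> mA mB AB.
have := spectral_sigma_additive HF (F := bigcup2 A B).
have mAB n : measurable (bigcup2 A B n) by case: n => [|[|n]] //=; exact: measurable0.
move=> /(_ mAB); rewrite -trivIset_bigcup2 => /(_ AB x).
rewrite bigcup2E => h0.
apply/eqP; rewrite -subr_eq0; apply/eqP; apply: hnorm_eq0.
have h1 : hnorm ip (F (A `|` B) x - (F A x + F B x)) @[_ --> \oo] --> (0 : R).
  apply: cvg_trans h0; apply: near_eq_cvg; exists 2 => // -[|[|n]]// _.
  rewrite 2!big_ord_recl/= big1 ?addr0//= => i _.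
  exact: spec_set0.
exact: (cvg_unique _ (cvg_cst _) h1).
Qed.

Lemma spec_setC D x : measurable D -> F D x + F (~` D) x = x.
Proof.
move=> mD; rewrite -spec_setU// ?setUv ?setICr//; last exact: measurableC.
exact: spectralT HF x.
Qed.

(** Orthogonality of the ranges is not an axiom here. For [y = F B x] the projection of [y] for the
    union has squared norm [sqn y + sqn (F A y)], yet projections do not increase norms. *)
Lemma spec_disjoint A B x : measurable A -> measurable B -> A `&` B = set0 ->
  F A (F B x) = 0.
Proof.
move=> mA mB AB; set y := F B x.
have yB : F B y = y by exact: (spectral_idem HF mB).
have := sqn_spec_le y (measurableU _ _ mA mB).
rewrite -rdot_spec_sqn; last exact: measurableU.
rewrite spec_setU// rdotDl yB rdot_spec_sqn// => h.
by apply: (@sqn_eq0 _ _ ip); apply/eqP; rewrite eq_le sqn_ge0 andbT; move: h; rewrite -/(sqn y); lra.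
Qed.

Lemma spec_setI A B x : measurable A -> measurable B ->
  F A (F B x) = F (A `&` B) x.
Proof.
move=> mA mB.
have mAB := measurableI _ _ mA mB.
have mAD : measurable (A `\` B) by exact: measurableD.
have mBD : measurable (B `\` A) by exact: measurableD.
have E1 y : F A y = F (A `&` B) y + F (A `\` B) y.
  by rewrite -spec_setU// ?setUIDK// setDE setIACA setICr setI0.
have E2 y : F B y = F (A `&` B) y + F (B `\` A) y.
  by rewrite setIC -spec_setU// ?setUIDK//; [exact: measurableI|rewrite setDE setIACA setICr setI0].
rewrite E1 (spec_disjoint (A := A `\` B))//; last by rewrite setDE -setIA setICl setI0.
rewrite addr0 E2 specD// (spec_disjoint (A := A `&` B) (B := B `\` A))//.
  by rewrite addr0 (spectral_idem HF).
by apply/seteqP; split => // t [[At Bt] [_ /(_ At)]].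
Qed.

Lemma spectral_form_measure x : exists m : {measure set R -> \bar R},
  forall D, measurable D -> m D = (sqn (F D x))%:E.
Proof.
pose nu D : \bar R := if `[< measurable D >] then (sqn (F D x))%:E else 0%E.
have nuE D : measurable D -> nu D = (sqn (F D x))%:E.
  by move=> mD; rewrite /nu asboolT.
have nu0 : nu set0 = 0%E by rewrite nuE// spec_set0 sqn0.
have nu_ge0 D : (0 <= nu D)%E by rewrite /nu; case: ifP; rewrite // lee_fin sqn_ge0.
have nus : semi_sigma_additive nu.
  move=> G mG tG mUG; rewrite nuE//.
  have -> : (fun n => (\sum_(0 <= i < n) nu (G i))%E) =
      EFin \o (fun n => rdot (\sum_(i < n) F (G i) x) x).
    apply/funext; elim => [|n IH] /=; first by rewrite big_geq// big_ord0 rdot0l.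
    rewrite big_nat_recr//= IH/= big_ord_recr/= rdotDl nuE// -rdot_spec_sqn//.
  apply/cvg_EFin; first exact: nearW.
  rewrite -rdot_spec_sqn//.
  have := spectral_sigma_additive HF mG tG x.
  set e := (fun n => hnorm _ _) => e0.
  (* Norm convergence of the partial sums gives convergence of their inner products with [x], by
     Cauchy-Schwarz. *)
  have e1 : e n * hnorm ip x @[n --> \oo] --> (0 : R).
    by rewrite -(mul0r (hnorm ip x)); apply: cvgM => //; exact: cvg_cst.
  apply/cvgrPdist_le => eps eps0.
  move/cvgrPdist_le : e1 => /(_ _ eps0); apply: filterS => n /=.
  rewrite sub0r normrN ger0_norm; last by rewrite mulr_ge0// sqrtr_ge0.
  by apply: le_trans; rewrite -rdotBl; exact: rdot_le.
pose M := isMeasure.Build _ _ _ nu nu0 nu_ge0 nus.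
pose nu' : {measure set R -> \bar R} := HB.pack nu M.
by exists nu'.
Qed.

Definition specm x : {measure set R -> \bar R} := sval (cid (spectral_form_measure x)).

Lemma specmE x D : measurable D -> specm x D = (sqn (F D x))%:E.
Proof. by move=> mD; rewrite /specm; case: cid => m /= ->. Qed.

Lemma spectral_form_specm x D : measurable D -> spectral_form ip F x D = specm x D.
Proof. by move=> mD; rewrite specmE// -rdot_spec_sqn. Qed.

Lemma integral_spectral_form x D (g : R -> \bar R) :
  (\int[spectral_form ip F x]_(t in D) g t = \int[specm x]_(t in D) g t)%E.
Proof. by apply: eq_raw_integral => A mA; exact: spectral_form_specm. Qed.

Lemma specmT x : specm x setT = (sqn x)%:E.
Proof. by rewrite specmE// (spectralT HF). Qed.

Lemma specm_split D x S : measurable D -> measurable S ->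
  specm x S = (specm (F D x) S + specm (F (~` D) x) S)%E.
Proof.
move=> mD mS; have mDC := measurableC mD; rewrite !specmE// -EFinD; congr EFin.
have H B : measurable B -> sqn (F S (F B x)) = rdot (F S x) (F B x).
  move=> mB; rewrite -rdot_spec_sqn// spec_setI// setIC -spec_setI// rdot_spec//.
  by rewrite (spectral_idem HF mB).
by rewrite !H// -rdotDr spec_setC// rdot_spec_sqn.
Qed.

Local Open Scope ereal_scope.

Lemma ge0_integral_specm_split D x (g : R -> \bar R) : measurable D ->
  measurable_fun setT g -> (forall t, 0 <= g t) ->
  \int[specm x]_t g t = \int[specm (F D x)]_t g t + \int[specm (F (~` D) x)]_t g t.
Proof.
move=> mD mg g0; rewrite -ge0_integral_measure_add//.
by apply: eq_raw_integral => A mA; rewrite (specm_split x mD mA) measure_addE.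
Qed.

(** The parallelogram law at the level of measures, from which the domain [specdom] is closed under
    sums. *)
Lemma ge0_integral_specm_parallelogram x y (g : R -> \bar R) :
  measurable_fun setT g -> (forall t, 0 <= g t) ->
  \int[specm (x + y)]_t g t + \int[specm (x - y)]_t g t =
  (\int[specm x]_t g t + \int[specm x]_t g t) +
  (\int[specm y]_t g t + \int[specm y]_t g t).
Proof.
move=> mg g0; rewrite -!ge0_integral_measure_add//.
apply: eq_raw_integral => A mA.
rewrite measure_addE [RHS]measure_addE.
rewrite -[X in _ = X + _]/(measure_add (specm x) (specm x) A).
rewrite -[X in _ = _ + X]/(measure_add (specm y) (specm y) A).
rewrite !measure_addE !specmE// -!EFinD.
by apply: congr1; rewrite specD// specB// sqnD sqnB; ring.
Qed.

Lemma measurable_sqrE : measurable_fun setT (fun t : R => (t ^+ 2)%:E).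
Proof. by apply/measurable_EFinP; exact: measurable_funX. Qed.

Definition specdom x := \int[specm x]_t (t ^+ 2)%:E < +oo.

Lemma specdomE x : spectral_dom ip F id x <-> specdom x.
Proof. by rewrite /spectral_dom/= integral_spectral_form. Qed.

Lemma specdomD x y : specdom x -> specdom y -> specdom (x + y).
Proof.
rewrite /specdom => dx dy.
have := ge0_integral_specm_parallelogram x y measurable_sqrE.
have h t : 0 <= (t ^+ 2)%:E :> \bar R by rewrite lee_fin sqr_ge0.
move=> /(_ h) E; apply: (@le_lt_trans _ _
  (\int[specm (x + y)]_t (t ^+ 2)%:E + \int[specm (x - y)]_t (t ^+ 2)%:E)).
  by rewrite leeDl// integral_ge0.
by rewrite E; apply: lte_add_pinfty; apply: lte_add_pinfty.
Qed.

Lemma specdom_spec D x : measurable D -> specdom x -> specdom (F D x).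
Proof.
move=> mD; rewrite /specdom => dx; apply: le_lt_trans dx.
have h t : 0 <= (t ^+ 2)%:E :> \bar R by rewrite lee_fin sqr_ge0.
rewrite (ge0_integral_specm_split x mD measurable_sqrE h).
by rewrite leeDl// integral_ge0.
Qed.

Lemma integrable_specm x : specdom x -> (specm x).-integrable setT (EFin : R -> \bar R).
Proof.
move=> dx; have h t : 0 <= (t ^+ 2)%:E :> \bar R by rewrite lee_fin sqr_ge0.
apply/integrableP; split; first exact/measurable_EFinP.
apply: (@le_lt_trans _ _ (\int[specm x]_t (1 + (t ^+ 2)%:E))).
  apply: ge0_le_integral => //.
  - apply: measurableT_comp => //; exact/measurable_EFinP.
  - by apply: emeasurable_funD; [exact: measurable_cst|exact: measurable_sqrE].
  - move=> t _; rewrite /= lee_fin.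
    have := sqr_ge0 (`|t| - 1)%R; rewrite sqrrB1 real_normK ?num_real//.
    by rewrite mulr2n; have := normr_ge0 t; lra.
rewrite ge0_integralD//; last exact: measurable_sqrE.
by rewrite integral_cst// mul1e specmT lte_add_pinfty// ltry.
Qed.

Definition specq x : R := fine (\int[specm x]_t t%:E).

Lemma specq_split D x : measurable D -> specdom x ->
  specq x = (specq (F D x) + specq (F (~` D) x))%R.
Proof.
move=> mD dx; have mDC := measurableC mD.
have i1 := integrable_specm (specdom_spec mD dx).
have i2 := integrable_specm (specdom_spec mDC dx).
rewrite /specq -fineD ?integrable_fin_num//; congr fine.
rewrite -integral_measure_add//.
by apply: eq_raw_integral => A mA; rewrite (specm_split x mD mA) measure_addE.
Qed.

Lemma specm_outside D x : measurable D -> F D x = x -> specm x (~` D) = 0.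
Proof.
move=> mD xD; rewrite specmE; last exact: measurableC.
rewrite -xD spec_setI//; last exact: measurableC.
by rewrite setICl spec_set0 sqn0.
Qed.

Lemma ball_dist_itv (c r t : R) : (0 < r)%R ->
  `[(c - r)%R, (c + r)%R]%classic t -> (`|t - c| <= r)%R.
Proof. by move=> r0; rewrite /= in_itv/= ler_norml; lra. Qed.

Lemma specdom_bounded (c r : R) x : (0 < r)%R ->
  F `[(c - r)%R, (c + r)%R]%classic x = x -> specdom x.
Proof.
move=> r0 xI; set I := [set` _] in xI.
have mI : measurable I by exact: measurable_itv.
rewrite /specdom (ge0_negligible_integral _ measurableT _ _ (specm_outside mI xI))//=; last 3 first.
- exact: measurableC.
- exact: measurable_sqrE.
- by move=> t _; rewrite lee_fin sqr_ge0.
rewrite setTD setCK.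
apply: (@le_lt_trans _ _ (\int[specm x]_(t in I) (cst ((`|c| + r) ^+ 2)%:E) t)).
  apply: ge0_le_integral => //.
  - by move=> t _; rewrite lee_fin sqr_ge0.
  - apply: measurable_funTS; exact: measurable_sqrE.
  - move=> t /(ball_dist_itv r0) tI; rewrite lee_fin -real_normK ?num_real// ler_sqr ?nnegrE//.
      by rewrite -[t](subrK c) (le_trans (ler_normD _ _))// addrC lerD2l.
    by rewrite addr_ge0// ltW.
rewrite integral_cst// specmE// -EFinM; exact: ltry.
Qed.

Lemma specq_bound (c r : R) x : (0 < r)%R ->
  F `[(c - r)%R, (c + r)%R]%classic x = x ->
  (`|specq x - c * sqn x| <= r * sqn x)%R.
Proof.
move=> r0 xI; have dx := specdom_bounded r0 xI; set I := [set` _] in xI.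
have mI : measurable I by exact: measurable_itv.
have ix := integrable_specm dx.
have xIm : specm x I = (sqn x)%:E by rewrite specmE// xI.
have qE : (specq x)%:E = \int[specm x]_(t in I) t%:E.
  rewrite /specq fineK ?integrable_fin_num//.
  rewrite (negligible_integral _ _ ix (specm_outside mI xI))//; last exact: measurableC.
  by rewrite setTD setCK.
have iI : (specm x).-integrable I (EFin : R -> \bar R).
  exact: integrableS ix.
have ic k : (specm x).-integrable I (cst k%:E).
  apply/integrableP; split; first exact: measurable_cst.
  by rewrite integral_cst// xIm -EFinM ltry.
rewrite ler_norml; apply/andP; split.
  suff : ((c - r) * sqn x <= specq x)%R by lra.
  rewrite -lee_fin qE EFinM -xIm -(integral_cst _ mI); apply: le_integral => //.
  by move=> t /set_mem; rewrite /I/= in_itv/= => /andP[? ?]; rewrite lee_fin.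
suff : (specq x <= (c + r) * sqn x)%R by lra.
rewrite -lee_fin qE EFinM -xIm -(integral_cst _ mI); apply: le_integral => //.
by move=> t /set_mem; rewrite /I/= in_itv/= => /andP[? ?]; rewrite lee_fin.
Qed.

Lemma spectral_integral_re x y z : spectral_integral ip F id (x, y) ->
  specdom z -> rdot y z = (4^-1 * (specq (x + z) - specq (x - z)))%R.
Proof.
move=> [_ H] dz; have {H} /= := H z ((specdomE z).2 dz).
have qE u : fine (\int[spectral_form ip F u]_t t%:E) = specq u.
  by rewrite integral_spectral_form.
under eq_bigr do rewrite qE.
by rewrite /rdot => ->; exact: (Re_polarization specq).
Qed.

(** On the range of [F] of the interval, [T - c] has norm at most [r]. The operator is given only by
    its quadratic form, so the bound [specq_bound] on the form is polarized with a vector [z] of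
    that range. *)
Lemma sqn_spectral_integral_le (c r : R) x y : (0 < r)%R ->
  spectral_integral ip F id (x, y) ->
  (sqn (F `[(c - r), (c + r)]%classic (y - c%:C%C *: x)) <=
   r ^+ 2 * sqn (F `[(c - r), (c + r)]%classic x))%R.
Proof.
move=> r0 Txy; set I := [set` _]; have mI : measurable I by exact: measurable_itv.
set u := F I x; set v := F I (y - c%:C%C *: x).
have uI : F I u = u by exact: spectral_idem HF _ mI x.
have vI : F I v = v by exact: (spectral_idem HF mI).
(* A scale [s] leads to [s b <= (r / 2) (a + s^2 b)] with [a = sqn u] and [b = sqn v]; the choice
   [s = r^-1] turns this into [b <= r^2 a]. *)
pose z := (r^-1)%:C%C *: v.
have zI : F I z = z by rewrite specZ// vI.
have dz : specdom z by apply: specdom_bounded r0 zI.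
have dx : specdom x by case: Txy => Tx _; exact: (specdomE x).1 Tx.
have zN : F I (- z)%R = (- z)%R.
  by rewrite (specN z mI) zI.
have dNz : specdom (- z)%R by apply: specdom_bounded r0 zN.
have := spectral_integral_re Txy dz.
rewrite (specq_split mI (specdomD dx dz)) (specq_split mI (specdomD dx dNz)).
have mIC := measurableC mI.
have zC : F (~` I) z = 0%R by rewrite -zI spec_disjoint// setICl.
rewrite !specD// !specN// zC zI oppr0 !addr0 -/u.
have -> : rdot y z = (r^-1 * (sqn v + c * rdot u v))%R.
  rewrite /z rdotZr; congr (_ * _)%R; rewrite -vI -rdot_spec//.
  have -> : F I y = (v + c%:C%C *: u)%R.
    by rewrite /v /u -specZ// -specD// subrK.
  by rewrite vI rdotDl rdotZl.
have uzI : F I (u + z)%R = (u + z)%R by rewrite specD// uI zI.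
have uNzI : F I (u - z)%R = (u - z)%R by rewrite specB// uI zI.
have := specq_bound r0 uzI; have := specq_bound r0 uNzI.
rewrite !ler_norml sqnB sqnD /z !sqnZ rdotZr => /andP[A1 A2] /andP[B1 B2] E.
have ri : (r * r^-1 = 1)%R by rewrite divff// gt_eqF.
have ri0 : (0 < r^-1)%R by rewrite invr_gt0.
set s := (r^-1)%R in A1 A2 B1 B2 E ri ri0.
set P := specq (u + s%:C%C *: v)%R in A1 A2 B1 B2 E.
set Q := specq (u - s%:C%C *: v)%R in A1 A2 B1 B2 E.
set a := sqn u in A1 A2 B1 B2 E *; set b := sqn v in A1 A2 B1 B2 E *.
set t := rdot u v in A1 A2 B1 B2 E.
have h : (s * b <= 2^-1 * (r * (a + s ^+ 2 * b)))%R by lra.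
have h2 : (r * (s * b) <= 2^-1 * (r * (r * (a + s ^+ 2 * b))))%R.
  by rewrite [leRHS]mulrCA ler_pM2l.
have e1 : (r * (s * b) = b)%R by rewrite mulrA ri mul1r.
have e2 : (r * (r * (a + s ^+ 2 * b)) = r ^+ 2 * a + b)%R.
  transitivity (r ^+ 2 * a + (r * s) ^+ 2 * b)%R; first by ring.
  by rewrite ri expr1n mul1r.
by rewrite e1 e2 in h2; lra.
Qed.

Lemma spec_null_bigcup x (A : (set R)^nat) : (forall n, measurable (A n)) ->
  (forall n, F (A n) x = 0%R) -> F (\bigcup_n A n) x = 0%R.
Proof.
move=> mA A0; apply: (@sqn_eq0 _ _ ip); apply: EFin_inj.
have mU : measurable (\bigcup_n A n) by exact: bigcup_measurable.
rewrite -specmE//; apply/eqP; rewrite eq_le measure_ge0 andbT.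
apply: (le_trans (generalized_Boole_inequality _ mA mU)).
by rewrite eseries0// => n _ _; rewrite specmE// A0 sqn0.
Qed.
End spectral_measure_theory.

(** A spectral integral depends on the projections only through the measures [spectral_form], so
    uniqueness of these is enough to compute powers. *)
Lemma spectral_integral_ext (R : realType) (V : lmodType R[i]) (ip : {dot V for Num.conj})
    (F E : set R -> V -> V) (g : R -> R) :
  (forall x D, measurable D -> spectral_form ip F x D = spectral_form ip E x D) ->
  spectral_integral ip F g = spectral_integral ip E g.
Proof.
move=> U; have UI x (G : R -> \bar R) :
    (\int[spectral_form ip F x]_t G t = \int[spectral_form ip E x]_t G t)%E.
  by apply: eq_raw_integral => D mD; exact: U.
have dE : spectral_dom ip F g = spectral_dom ip E g.
  by apply/seteqP; split => x; rewrite /spectral_dom/= UI.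
rewrite /spectral_integral dE.
by under [X in _ = X]eq_set do under eq_forall do under eq_forall do under eq_bigr do rewrite -UI.
Qed.
(** [powR] agrees with the inverse on nonnegative numbers, hence the detour through [t ^+ 2]. *)
Lemma measurable_invr (R : realType) : measurable_fun setT (fun t : R => t^-1).
Proof.
rewrite (_ : (fun t => _) = (fun t => t * (t ^+ 2) `^ (-1))).
  apply: measurable_funM => //.
  apply: (measurableT_comp (measurable_powR _)); exact: measurable_funX.
apply/funext => t; rewrite powR_inv1 ?sqr_ge0//.
have [->|t0] := eqVneq t 0; first by rewrite invr0 mul0r.
by rewrite expr2 invfM mulrA divff// mul1r.
Qed.

Section spectral_uniqueness.
Context (R : realType) (V : lmodType R[i]) (ip : {dot V for Num.conj}).
Variables F E : set R -> V -> V.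
Hypotheses (HF : spectral_measure ip F) (HE : spectral_measure ip E).
Local Notation sqn := (sqn ip).
(** With [T] the operator of [F], this inverts [T - c] on the vectors that [E] places outside the
    open interval, with bound [r^-1]. It is the only link between the two measures. *)
Hypothesis resolvent : forall (c r : R) x, 0 < r ->
  E `]c - r, c + r[%classic x = 0 ->
  exists x', [/\ E `]c - r, c + r[%classic x' = 0,
    spectral_integral ip F id (x', x + c%:C%C *: x') &
    r ^+ 2 * sqn x' <= sqn x].

(* Each resolvent step costs at most a factor [r / r'] in the norm. *)
Let kill (c r r' : R) x : 0 < r -> r < r' ->
  E `]c - r', c + r'[%classic x = 0 -> F `[c - r, c + r]%classic x = 0.
Proof.
move=> r0 rr' Ex; have r'0 : 0 < r' by exact: lt_trans rr'.
set I := [set` _]; have mI : measurable I by exact: measurable_itv.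
pose th := (r / r') ^+ 2.
have H k y : E `]c - r', c + r'[%classic y = 0 -> sqn (F I y) <= th ^+ k * sqn y.
  elim: k y => [|k IH] y Ey; first by rewrite expr0 mul1r sqn_spec_le.
  have [y' [Ey' Ty' ny']] := resolvent r'0 Ey.
  (* Here [y = (T - c) y']: passing to [y'] gains [r ^+ 2] from [F] and costs [r' ^- 2] from [E]. *)
  have := sqn_spectral_integral_le HF c r0 Ty'; rewrite addrK => /le_trans; apply.
  rewrite -/I; have := IH _ Ey' => h.
  apply: (@le_trans _ _ (r ^+ 2 * (th ^+ k * sqn y'))).
    by rewrite ler_pM2l// exprn_gt0.
  rewrite (exprSr th k) -(mulrA (th ^+ k)) mulrCA; apply: ler_wpM2l.
    by rewrite exprn_ge0// sqr_ge0.
  rewrite /th expr_div_n -(mulrA _ _ (sqn y)) ler_pM2l ?exprn_gt0//.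
  by rewrite ler_pdivlMl ?exprn_gt0.
apply: (@sqn_eq0 _ _ ip); apply/eqP; rewrite eq_le sqn_ge0 andbT.
have c0 : (fun k => th ^+ k * sqn x) @ \oo --> (0 : R).
  rewrite -[X in _ --> X](mul0r (sqn x)); apply: cvgM; last exact: cvg_cst.
  apply: cvg_expr; rewrite ger0_norm ?sqr_ge0// /th expr_lt1 ?divr_ge0 ?ltW//.
  by rewrite ltr_pdivrMr// mul1r.
by apply: (cvgr_to_ge c0); apply: nearW => k; exact: H.
Qed.

(** [kill] needs a margin around the closed interval [I]. It leaves only the part of [z] in the
    range of [E (O n)], and this tends to [E I z = 0] as the open intervals [O n] shrink to [I]. *)
Let kill_outside (c r : R) y : 0 < r ->
  F `[c - r, c + r]%classic (E (~` `[c - r, c + r]%classic) y) = 0.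
Proof.
move=> r0; set I := [set` _]; have mI : measurable I by exact: measurable_itv.
have mIC := measurableC mI.
set z := E (~` I) y.
pose O n := `]c - (r + n.+1%:R^-1), c + (r + n.+1%:R^-1)[%classic : set R.
have mO n : measurable (O n) by exact: measurable_itv.
have OI : \bigcap_n O n = I.
  apply/seteqP; split => t /=.
    move=> h; rewrite /I/= in_itv/=; apply/andP; split.
      apply/ler_addgt0Pl => e e0; have := h (Num.trunc e^-1) Logic.I.
      rewrite /O/= in_itv/= => /andP[h1 _].
      have : (Num.trunc e^-1).+1%:R^-1 <= e.
        by rewrite invf_ple ?posrE//; exact: ltW (truncnS_gt _).
      by move: h1; set u := _^-1; lra.
    apply/ler_addgt0Pl => e e0; have := h (Num.trunc e^-1) Logic.I.
    rewrite /O/= in_itv/= => /andP[_ h1].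
    have : (Num.trunc e^-1).+1%:R^-1 <= e.
      by rewrite invf_ple ?posrE//; exact: ltW (truncnS_gt _).
    by move: h1; set u := _^-1; lra.
  rewrite /I/= in_itv/= => /andP[h1 h2] n _; rewrite /O/= in_itv/=.
  have : 0 < n.+1%:R^-1 :> R by rewrite invr_gt0.
  by set u := _^-1 => u0; apply/andP; split; lra.
have le n : sqn (F I z) <= sqn (E (O n) z).
  have h : F I (E (~` O n) z) = 0.
    apply: (@kill c r (r + n.+1%:R^-1)) => //; first by rewrite ltrDl invr_gt0.
    by rewrite -/(O n) (spec_disjoint HE)// ?setICr//; exact: measurableC.
  have -> : F I z = F I (E (O n) z).
    rewrite -{1}(spec_setC HE z (mO n)) (specD HF)//.
    by rewrite h addr0.
  exact: sqn_spec_le.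
have cv : (specm HE z \o O) n @[n --> \oo] --> specm HE z I.
  rewrite -OI; apply: nonincreasing_cvg_mu => //.
  - by rewrite specmE// ltry.
  - by rewrite OI.
  - move=> n m nm; apply/subsetPset => t; rewrite /O/= !in_itv/=.
    have : m.+1%:R^-1 <= n.+1%:R^-1 :> R by rewrite lef_pV2 ?posrE// ler_nat.
    by set u := _^-1; set v := _^-1 => uv /andP[h1 h2]; apply/andP; split; lra.
have zI : specm HE z I = 0%E.
  by rewrite specmE// /z (spec_disjoint HE)// ?sqn0// setICr.
rewrite zI in cv.
apply: (@sqn_eq0 _ _ ip); apply/eqP; rewrite eq_le sqn_ge0 andbT.
rewrite -lee_fin; apply: (cvge_ge _ cv); apply: nearW => n /=.
by rewrite specmE// lee_fin.
Qed.

(** By [kill_outside] only [z = E I y] contributes to [F I y], and it remains that [F] of the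
    complement of [I] kills [z]. That complement is a countable union of compact intervals [K]: each
    has [E K z = 0], and [F K] kills the rest of [z] by [kill_outside]. *)
Let inside (c r : R) y : 0 < r ->
  F `[c - r, c + r]%classic y = E `[c - r, c + r]%classic y.
Proof.
move=> r0; set I := [set` _]; have mI : measurable I by exact: measurable_itv.
have mIC := measurableC mI.
set z := E I y.
have Fz (J : set R) : measurable J -> J `&` I = set0 ->
    (exists c' r' : R, 0 < r' /\ J = `[c' - r', c' + r']%classic) -> F J z = 0.
  move=> mJ JI [c' [r' [r'0 JE]]].
  rewrite -(spec_setC HE z mJ) (specD HF)//.
  have -> : F J (E (~` J) z) = 0 by rewrite JE kill_outside.
  rewrite addr0 (spec_disjoint HE)//.
  exact: (spec0 HF).
(* The offsets [1/(n+1) < n+2] keep every piece nondegenerate, since [kill_outside] asks for a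
   positive radius. *)
pose Kp n := `[c + r + n.+1%:R^-1, c + r + n.+2%:R]%classic : set R.
pose Kn n := `[c - r - n.+2%:R, c - r - n.+1%:R^-1]%classic : set R.
have inv1 n : n.+1%:R^-1 < n.+2%:R :> R.
  by rewrite (@le_lt_trans _ _ 1)// ?invf_le1// ?ler1n// ltr1n.
have inv0 n : 0 < n.+1%:R^-1 :> R by rewrite invr_gt0.
have Kp0 n : F (Kp n) z = 0.
  apply: Fz; first exact: measurable_itv.
    apply/seteqP; split => // t [] /=; rewrite /Kp/I/= !in_itv/=.
    by have := inv0 n; set u := _^-1 => u0 /andP[h1 _] /andP[_ h2]; lra.
  exists (c + r + 2^-1 * (n.+1%:R^-1 + n.+2%:R)), (2^-1 * (n.+2%:R - n.+1%:R^-1)).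
  split; first by rewrite mulr_gt0 ?invr_gt0// subr_gt0.
  rewrite /Kp; set u := n.+1%:R^-1; set v := n.+2%:R.
  rewrite (_ : c + r + u = c + r + 2^-1 * (u + v) - 2^-1 * (v - u)); last by lra.
  by rewrite (_ : c + r + v = c + r + 2^-1 * (u + v) + 2^-1 * (v - u)); last by lra.
have Kn0 n : F (Kn n) z = 0.
  apply: Fz; first exact: measurable_itv.
    apply/seteqP; split => // t [] /=; rewrite /Kn/I/= !in_itv/=.
    by have := inv0 n; set u := _^-1 => u0 /andP[_ h1] /andP[h2 _]; lra.
  exists (c - r - 2^-1 * (n.+1%:R^-1 + n.+2%:R)), (2^-1 * (n.+2%:R - n.+1%:R^-1)).
  split; first by rewrite mulr_gt0 ?invr_gt0// subr_gt0.
  rewrite /Kn; set u := n.+1%:R^-1; set v := n.+2%:R.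
  rewrite (_ : c - r - v = c - r - 2^-1 * (u + v) - 2^-1 * (v - u)); last by lra.
  by rewrite (_ : c - r - u = c - r - 2^-1 * (u + v) + 2^-1 * (v - u)); last by lra.
have K0 n : F (Kp n `|` Kn n) z = 0.
  have -> : Kp n `|` Kn n = \bigcup_i bigcup2 (Kp n) (Kn n) i by rewrite bigcup2E.
  apply: (spec_null_bigcup HF).
    by case=> [|[|i]]/=; [exact: measurable_itv|exact: measurable_itv|exact: measurable0].
  by case=> [|[|i]]/=; [exact: Kp0|exact: Kn0|exact: (spec_set0 HF)].
have cov : \bigcup_n (Kp n `|` Kn n) = ~` I.
  have arch (e : R) : 0 < e -> exists n : nat, n.+1%:R^-1 <= e /\ e <= n.+2%:R.
    move=> e0; exists (maxn (Num.trunc e^-1) (Num.trunc e)); split.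
      rewrite invf_ple ?posrE//; apply: (le_trans (ltW (truncnS_gt _))).
      by rewrite ler_nat ltnS leq_maxl.
    apply: (le_trans (ltW (truncnS_gt _))).
    by rewrite ler_nat ltnS ltnW// ltnS leq_maxr.
  apply/seteqP; split => t.
    move=> [n _ []]; rewrite /Kp /Kn /I/= !in_itv/= => /andP[h1 h2] /andP[h3 h4];
      have := inv0 n; move: h1 h2; set u := _^-1; set v := _.+2%:R; lra.
  rewrite /I /= in_itv/= => /negP; rewrite negb_and -!ltNge => /orP[tl|tr].
    have [n [n1 n2]] := arch (c - r - t) ltac:(lra).
    exists n => //; right; rewrite /Kn/= in_itv/=; move: n1 n2.
    by set u := _^-1; set v := _.+2%:R => *; apply/andP; split; lra.
  have [n [n1 n2]] := arch (t - (c + r)) ltac:(lra).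
  exists n => //; left; rewrite /Kp/= in_itv/=; move: n1 n2.
  by set u := _^-1; set v := _.+2%:R => *; apply/andP; split; lra.
have FC : F (~` I) z = 0.
  rewrite -cov; apply: (spec_null_bigcup HF) => // n.
  by apply: measurableU; exact: measurable_itv.
rewrite -{1}(spec_setC HE y mI) (specD HF)// kill_outside// addr0 -/z.
by rewrite -{2}(spec_setC HF z mI) FC addr0.
Qed.

(** Agreement on compact intervals passes to the half-lines [[a, +oo[] by continuity from below, and
    these form a generating pi-system. *)
Theorem spectral_form_unique x D : measurable D ->
  spectral_form ip F x D = spectral_form ip E x D.
Proof.
move=> mD; rewrite (spectral_form_specm HF)// (spectral_form_specm HE)//.
have inf (a : R) : specm HF x `[a, +oo[%classic = specm HE x `[a, +oo[%classic.
  pose J n := `[a, a + n.+1%:R]%classic : set R.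
  have mJ n : measurable (J n) by exact: measurable_itv.
  have JU : \bigcup_n J n = `[a, +oo[%classic.
    apply/seteqP; split => t; rewrite /=.
      by move=> [n _]; rewrite /J/= !in_itv/= andbT => /andP[].
    rewrite in_itv/= andbT => at_; exists (Num.trunc (t - a)) => //.
    rewrite /J/= in_itv/= at_/= -lerBlDl; exact: ltW (truncnS_gt _).
  have cv (G : set R -> V -> V) (HG : spectral_measure ip G) :
      (specm HG x \o J) n @[n --> \oo] --> specm HG x `[a, +oo[%classic.
    rewrite -JU; apply: nondecreasing_cvg_mu => //.
      by rewrite JU; exact: measurable_itv.
    move=> n m nm; apply/subsetPset => t; rewrite /J/= !in_itv/= => /andP[-> h]/=.
    by rewrite (le_trans h)// lerD2l ler_nat.
  apply: (cvg_unique _ (cv F HF)) => //.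
  have -> : specm HF x \o J = specm HE x \o J.
    apply/funext => n /=; rewrite !specmE//; congr ((sqn _)%:E).
    have := @inside (a + 2^-1 * n.+1%:R) (2^-1 * n.+1%:R) x.
    rewrite mulr_gt0 ?invr_gt0// => /(_ isT).
    suff -> : `[a + 2^-1 * n.+1%:R - 2^-1 * n.+1%:R,
      a + 2^-1 * n.+1%:R + 2^-1 * n.+1%:R]%classic = J n by [].
    rewrite /J; set u := n.+1%:R.
    rewrite (_ : a + 2^-1 * u - 2^-1 * u = a); last by lra.
    by rewrite (_ : a + 2^-1 * u + 2^-1 * u = a + u); last by lra.
  exact: cv.
apply: (measure_unique (RGenCInfty.G (R:=R)) (fun k : nat => `[- k%:R, +oo[%classic)) => //.
- exact: RGenCInfty.measurableE.
- move=> _ _ [a ->] [b ->]; exists (Num.max a b).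
  apply/seteqP; split => t /=; rewrite !in_itv/= !andbT ge_max.
    by case=> -> ->.
  by move/andP.
- by move=> k; exists (- k%:R).
- apply/seteqP; split => // t _; exists (Num.trunc `|t|).+1 => //=.
  rewrite in_itv/= andbT lerNl (le_trans _ (ltW (truncnS_gt _)))//.
  by rewrite -normrN ler_norm.
- by move=> _ [a ->]; exact: inf.
- by move=> k; rewrite specmE// ?ltry//; exact: measurable_itv.
Qed.
End spectral_uniqueness.

(** * Functions and their classes in [L^2(mu)] *)

Section L2_classes.
Context d (X : measurableType d) (R : realType).
Variable mu : {measure set X -> \bar R}.
Implicit Types (f g : X -> R[i]) (a : X -> R) (u v : L2space mu).
Local Notation ip := (L2dot mu).
Local Notation sq := (square_integrable mu).

Definition rmul a f : X -> R[i] := fun x => (a x)%:C%C * f x.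

(** A total map: functions that are not square integrable get the class [0], which keeps membership
    proofs out of the terms. *)
Definition L2of f : L2space mu := L2class (insubd (0 : L2fun mu) f).

Lemma normc_rmul a f x : normc (rmul a f x) ^+ 2 = a x ^+ 2 * normc (f x) ^+ 2.
Proof. by rewrite !Defs.sqr_normc /rmul; case: (f x) => p q /=; ring. Qed.

Lemma L2of_fun (F : L2fun mu) : L2of F = L2class F.
Proof. by rewrite /L2of valKd. Qed.

Lemma sq_fun f : sq f -> exists F : L2fun mu, (F : X -> R[i]) = f.
Proof.
move=> sf; have p : f \in @L2pred _ _ _ mu by apply/asboolP.
by exists (MkL2fun p).
Qed.

Lemma L2of_eq f g : sq f -> sq g ->
  L2of f = L2of g <-> {ae mu, forall x, f x = g x}.
Proof.
by move=> /sq_fun[F <-] /sq_fun[G <-]; rewrite !L2of_fun; exact: L2classP.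
Qed.

Lemma L2of_repr u : L2of (repr u) = u.
Proof. by rewrite L2of_fun L2class_repr. Qed.

Lemma repr_L2of f : sq f -> {ae mu, forall x, repr (L2of f) x = f x}.
Proof.
move=> sf; apply/(L2of_eq _ sf); last by rewrite L2of_repr.
exact: L2funP.
Qed.

Lemma sq_repr u : sq (repr u). Proof. exact: L2funP. Qed.

Lemma sqZD c f g : sq f -> sq g -> sq (fun x => c * f x + g x).
Proof. exact: square_integrableZD. Qed.

Lemma L2ofZD c f g : sq f -> sq g ->
  L2of (fun x => c * f x + g x) = c *: L2of f + L2of g.
Proof.
move=> sf sg; have := sqZD c sf sg.
move: sf sg => /sq_fun[F FE] /sq_fun[G GE] /sq_fun[H HE].
rewrite -HE -FE -GE !L2of_fun.
rewrite [c *: _]L2classZ L2classD; congr L2class; apply: val_inj => /=.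
by rewrite HE -FE -GE.
Qed.

Lemma sqB f g : sq f -> sq g -> sq (fun x => f x - g x).
Proof.
move=> sf sg; rewrite (_ : (fun x => _) = (fun x => -1 * g x + f x)); first exact: sqZD.
by apply/funext => x; rewrite mulN1r addrC.
Qed.

Lemma L2ofD f g : sq f -> sq g -> L2of (fun x => f x + g x) = L2of f + L2of g.
Proof.
move=> sf sg; rewrite -[L2of f]scale1r -L2ofZD//; congr L2of.
by apply/funext => x; rewrite mul1r.
Qed.

Lemma L2ofB f g : sq f -> sq g -> L2of (fun x => f x - g x) = L2of f - L2of g.
Proof.
move=> sf sg; rewrite addrC -scaleN1r -L2ofZD//; congr L2of.
by apply/funext => x; rewrite mulN1r addrC.
Qed.

Lemma L2of0 : L2of (fun=> 0) = 0.
Proof.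
have s0 := square_integrable0 mu.
have := L2ofB s0 s0; rewrite subrr => <-; congr L2of.
by apply/funext => x; rewrite subrr.
Qed.

Lemma L2dotDl u v z : ip (u + v) z = ip u z + ip v z.
Proof. exact: linearDl. Qed.

Lemma L2dotDr u v z : ip z (u + v) = ip z u + ip z v.
Proof. exact: linearDr. Qed.

Lemma L2dotBl u v z : ip (u - v) z = ip u z - ip v z.
Proof. exact: linearBl. Qed.

Lemma L2dotBr u v z : ip z (u - v) = ip z u - ip z v.
Proof. exact: linearBr. Qed.

Lemma L2dotZl c u z : ip (c *: u) z = c * ip u z.
Proof. exact: linearZl_LR. Qed.

Lemma L2dotZr c u z : ip z (c *: u) = conjc c * ip z u.
Proof. exact: linearZr_LR. Qed.

Lemma L2dot0r u : ip u 0 = 0.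
Proof. exact: linear0r. Qed.

Lemma ip_L2of f g : sq f -> sq g ->
  ip (L2of f) (L2of g) = cintegral mu setT (fun x => f x * conjc (g x)).
Proof.
by move=> /sq_fun[F <-] /sq_fun[G <-]; rewrite !L2of_fun L2dotE.
Qed.

Lemma L2_rdotE u v : rdot ip u v = complex.Re (ip u v).
Proof. by []. Qed.

Lemma sqn_L2of f : sq f -> (sqn ip (L2of f))%:E = (\int[mu]_x (normc (f x) ^+ 2)%:E)%E.
Proof.
move=> sf; rewrite /sqn L2_rdotE ip_L2of//= fineK.
  apply: eq_integral => x _; rewrite Defs.sqr_normc; case: (f x) => p q /=.
  by congr EFin; ring.
rewrite ge0_fin_numE; last first.
  by apply: integral_ge0 => x _; case: (f x) => p q /=; rewrite lee_fin; nra.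
apply: le_lt_trans sf.2; rewrite le_eqVlt; apply/orP; left; apply/eqP.
apply: eq_integral => x _; rewrite Defs.sqr_normc; case: (f x) => p q /=.
by congr EFin; ring.
Qed.

Lemma cmeasurable_rmul a f : measurable_fun setT a -> cmeasurable f ->
  cmeasurable (rmul a f).
Proof.
move=> ma [fr fi]; split.
  rewrite (_ : (fun x => _) = (fun x => a x * complex.Re (f x))).
    exact: measurable_funM.
  by apply/funext => x; rewrite /rmul; case: (f x) => p q /=; ring.
rewrite (_ : (fun x => _) = (fun x => a x * complex.Im (f x))).
  exact: measurable_funM.
by apply/funext => x; rewrite /rmul; case: (f x) => p q /=; ring.
Qed.

Lemma sq_le f g (K : R) : 0 <= K -> sq f -> cmeasurable g ->
  (forall x, normc (g x) ^+ 2 <= K * normc (f x) ^+ 2) -> sq g.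
Proof.
move=> K0 sf mg gf; split=> //.
apply: (@le_lt_trans _ _ (\int[mu]_x (K%:E * (normc (f x) ^+ 2)%:E))%E).
  apply: ge0_le_integral => //.
  - by move=> x _; rewrite lee_fin sqr_ge0.
  - by apply/measurable_EFinP; exact: measurable_sqr_normc.
  - apply: emeasurable_funM; first exact: measurable_cst.
    by apply/measurable_EFinP/measurable_sqr_normc; case: sf.
  - by move=> x _; rewrite -EFinM lee_fin.
rewrite ge0_integralZl//.
- by rewrite lte_mul_pinfty ?lee_fin//; case: sf.
- by apply/measurable_EFinP/measurable_sqr_normc; case: sf.
- by move=> x _; rewrite lee_fin sqr_ge0.
Qed.

Lemma sq_rmul_bounded a f (K : R) : measurable_fun setT a ->
  (forall x, `|a x| <= K) -> sq f -> sq (rmul a f).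
Proof.
move=> ma aK sf; apply: (@sq_le f _ (K ^+ 2)) => //; first exact: sqr_ge0.
  by apply: cmeasurable_rmul => //; case: sf.
move=> x; rewrite normc_rmul ler_wpM2r ?sqr_ge0//.
by rewrite -real_normK ?num_real// ler_sqr ?nnegrE// (le_trans _ (aK x)).
Qed.

Lemma sq_ae f g : cmeasurable g -> {ae mu, forall x, f x = g x} -> sq f -> sq g.
Proof.
move=> mg fg [mf If]; split=> //; apply: le_lt_trans If.
rewrite le_eqVlt; apply/orP; left; apply/eqP; apply: ae_eq_integral => //.
- by apply/measurable_EFinP/measurable_sqr_normc.
- by apply/measurable_EFinP/measurable_sqr_normc.
- by apply: filterS fg => x ->.
Qed.

End L2_classes.

(** The two slots carry different vectors because the form met below is [<G u, P u>]. *)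
Lemma L2_polarization d (X : measurableType d) (R : realType)
    (mu : {measure set X -> \bar R}) (a c a' c' : L2space mu) :
  let i := (Complex 0 1 : R[i]) in
  4^-1 * \sum_(k < 4) i ^+ k * L2dot mu (a + i ^+ k *: c) (a' + i ^+ k *: c') =
  L2dot mu a c'.
Proof.
move=> i; have i2 : i * i = -1.
  by apply/eqP; rewrite eq_complex /=; apply/andP; split; apply/eqP; ring.
have ci : conjc i = - i by apply/eqP; rewrite eq_complex /= oppr0 !eqxx.
have E (k : nat) : L2dot mu (a + i ^+ k *: c) (a' + i ^+ k *: c') =
    L2dot mu a a' + (- i) ^+ k * L2dot mu a c' + i ^+ k * L2dot mu c a' +
    i ^+ k * (- i) ^+ k * L2dot mu c c'.
  have ck : conjc (i ^+ k) = (- i) ^+ k.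
    by rewrite -[conjc _]/(Num.conj _) rmorphXn -ci.
  by rewrite L2dotDl !L2dotDr !L2dotZl !L2dotZr ck; ring.
under eq_bigr do rewrite E.
rewrite !big_ord_recl big_ord0 /= /bump/= !exprS !expr0 !mulr1.
set p := L2dot mu a a'; set q := L2dot mu a c'; set r := L2dot mu c a'.
set s := L2dot mu c c'.
have four : (4%:R : R[i]) != 0 by rewrite pnatr_eq0.
rewrite -[RHS](mulKf four); congr (_ * _).
(* The sum is [4 q] modulo [i * i + 1]; with the cofactor spelled out, [ring] can check it without
   knowing that [i * i = -1]. *)
transitivity (4%:R * q + (i * i + 1) * ((1 + i) * p - (i ^+ 4 - 2 * i ^+ 2 + 3) * q +
    (1 + i ^+ 4) * r + (1 - i ^+ 3) * (1 - i ^+ 2 + i ^+ 4) * s)).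
  by move: i p q r s {i2 ci E} => *; ring.
by rewrite i2 addNr mul0r addr0.
Qed.

(** * Multiplication by a function after a projection *)

Section multiplication_operator.
Context d (X : measurableType d) (R : realType).
Variable mu : {measure set X -> \bar R}.
Local Notation ip := (L2dot mu).
Local Notation sq := (square_integrable mu).
Local Notation L2of := (L2of mu).
Variables (b : X -> R) (P : L2space mu -> L2space mu).
Hypotheses (mb : measurable_fun setT b) (b0 : forall x, 0 <= b x).
Hypothesis Plin : forall (c : R[i]) u v, P (c *: u + v) = c *: P u + P v.
Hypothesis Pidem : forall u, P (P u) = P u.
Hypothesis Psa : forall u v, ip (P u) v = ip u (P v).
(** The range of [P] is stable under those multiplications by functions of [b] that stay in
    [L^2(mu)]. The instances are the identity, for [C^*C], and [cproj], for [C C^*]. *)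
Hypothesis Pmul : forall (rho : R -> R) f, measurable_fun setT rho ->
  sq f -> P (L2of f) = L2of f -> sq (rmul (rho \o b) f) ->
  P (L2of (rmul (rho \o b) f)) = L2of (rmul (rho \o b) f).
Implicit Types (u v : L2space mu) (rho sig : R -> R) (D : set R).

Let fP u : X -> R[i] := repr (P u).

(* [rho] of the operator [u |-> b * P u], which vanishes on the kernel of [P];
   hence the value [rho 0] there. *)
Definition funcalc rho u : L2space mu :=
  L2of (rmul (rho \o b) (fP u)) + (rho 0)%:C%C *: (u - P u).

Definition bounded_measurable rho :=
  measurable_fun setT rho /\ exists K : R, forall t, `|rho t| <= K.

Let PD u v : P (u + v) = P u + P v.
Proof. by have := Plin 1 u v; rewrite !scale1r. Qed.

Let P0 : P 0 = 0.
Proof. by have := PD 0 0; rewrite addr0 -{1}[P 0]addr0 => /addrI. Qed.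

Let PZ c u : P (c *: u) = c *: P u.
Proof. by have := Plin c u 0; rewrite P0 !addr0. Qed.

Let PB u v : P (u - v) = P u - P v.
Proof. by rewrite PD -scaleN1r PZ scaleN1r. Qed.

Let sqf u : sq (fP u). Proof. exact: sq_repr. Qed.

Let mrho rho : measurable_fun setT rho -> measurable_fun setT (rho \o b).
Proof. by move=> mr; exact: measurableT_comp. Qed.

Let sqr rho f : bounded_measurable rho -> sq f -> sq (rmul (rho \o b) f).
Proof.
by move=> [mr [K rK]] sf; apply: (@sq_rmul_bounded _ _ _ _ _ _ K) => //; [exact: mrho|move=> x; exact: rK].
Qed.

Let fPZD c u v : {ae mu, forall x, fP (c *: u + v) x = c * fP u x + fP v x}.
Proof.
have s := sqZD c (sqf u) (sqf v); apply/(L2of_eq (sqf _) s).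
by rewrite L2ofZD// !L2of_repr Plin.
Qed.

Let P_L2of_rmul rho u : measurable_fun setT rho -> sq (rmul (rho \o b) (fP u)) ->
  P (L2of (rmul (rho \o b) (fP u))) = L2of (rmul (rho \o b) (fP u)).
Proof. by move=> mr; apply: Pmul => //; rewrite L2of_repr Pidem. Qed.

Lemma P_funcalc rho u : bounded_measurable rho ->
  P (funcalc rho u) = L2of (rmul (rho \o b) (fP u)).
Proof.
move=> br; rewrite /funcalc PD PZ PB Pidem subrr scaler0 addr0.
by apply: P_L2of_rmul; [case: br|exact: sqr].
Qed.

Lemma funcalc_fP rho u : bounded_measurable rho ->
  {ae mu, forall x, fP (funcalc rho u) x = rmul (rho \o b) (fP u) x}.
Proof.
by move=> br; rewrite /fP P_funcalc//; apply: repr_L2of; exact: sqr.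
Qed.

Lemma rmul_ae rho f g : measurable_fun setT rho -> cmeasurable f -> cmeasurable g ->
  {ae mu, forall x, f x = g x} -> sq (rmul (rho \o b) f) ->
  L2of (rmul (rho \o b) f) = L2of (rmul (rho \o b) g).
Proof.
move=> mr mf mg fg sf.
have fg' : {ae mu, forall x, rmul (rho \o b) f x = rmul (rho \o b) g x}.
  by apply: filterS fg => x; rewrite /rmul => ->.
have sg : sq (rmul (rho \o b) g).
  by apply: sq_ae fg' sf; apply: cmeasurable_rmul => //; exact: mrho.
by apply/L2of_eq.
Qed.

Lemma funcalc_linear rho c u v : bounded_measurable rho ->
  funcalc rho (c *: u + v) = c *: funcalc rho u + funcalc rho v.
Proof.
move=> br; have [mr _] := br.
rewrite /funcalc Plin.
have -> : L2of (rmul (rho \o b) (fP (c *: u + v))) =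
    L2of (rmul (rho \o b) (fun x => c * fP u x + fP v x)).
  apply: rmul_ae => //.
  - by case: (sqf (c *: u + v)).
  - by case: (sqZD c (sqf u) (sqf v)).
  - exact: sqr.
rewrite (_ : rmul _ _ = fun x => c * rmul (rho \o b) (fP u) x + rmul (rho \o b) (fP v) x); last first.
  by apply/funext => x; rewrite /rmul mulrDr mulrCA.
rewrite L2ofZD; [|exact: sqr..].
rewrite [c *: (_ + _)]scalerDr [RHS]addrACA; congr (_ + _).
rewrite scalerA (mulrC c) -scalerA -scalerDr; congr (_ *: _).
by rewrite opprD addrACA scalerBr.
Qed.

Lemma funcalc_comp rho sig u : bounded_measurable rho -> bounded_measurable sig ->
  funcalc sig (funcalc rho u) = funcalc (fun t => sig t * rho t) u.
Proof.
move=> br bs; have [mr _] := br; have [ms _] := bs.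
rewrite {1}/funcalc P_funcalc//; congr (_ + _).
  rewrite (rmul_ae (g := rmul (rho \o b) (fP u))) => //.
  - by congr L2of; apply/funext => x; rewrite /rmul/= rmorphM mulrA.
  - by case: (sqf (funcalc rho u)).
  - by case: (sqr br (sqf u)).
  - exact: funcalc_fP.
  - exact: sqr.
rewrite {1}/funcalc addrAC addrN add0r scalerA.
by rewrite rmorphM.
Qed.

Lemma funcalcD rho sig u : bounded_measurable rho -> bounded_measurable sig ->
  funcalc (fun t => rho t + sig t) u = funcalc rho u + funcalc sig u.
Proof.
move=> br bs; rewrite /funcalc addrACA -L2ofD; [|exact: sqr..].
congr (L2of _ + _); last by rewrite rmorphD scalerDl.
by apply/funext => x; rewrite /rmul/= rmorphD mulrDl.
Qed.

Lemma funcalcZ rho (c : R) u : bounded_measurable rho ->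
  funcalc (fun t => c * rho t) u = c%:C%C *: funcalc rho u.
Proof.
move=> br; rewrite /funcalc [RHS]scalerDr scalerA -rmorphM; congr (_ + _).
have s0 := square_integrable0 mu.
rewrite -[RHS]addr0 -(L2of0 mu) -L2ofZD//; last exact: sqr.
by congr L2of; apply/funext => x; rewrite /rmul/= rmorphM mulrA addr0.
Qed.

Lemma funcalc_selfadj rho u v : bounded_measurable rho ->
  ip (funcalc rho u) v = ip u (funcalc rho v).
Proof.
move=> br; rewrite /funcalc L2dotDl L2dotDr; congr (_ + _).
  have sru := sqr br (sqf u); have srv := sqr br (sqf v).
  rewrite -P_L2of_rmul//; last by case: br.
  rewrite Psa -(P_L2of_rmul (u := v))//; last by case: br.
  rewrite -[RHS]Psa -(L2of_repr (P v)) -(L2of_repr (P u)) !ip_L2of//; try exact: sqf.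
  congr cintegral; apply/funext => x; rewrite /rmul /fP /=.
  apply/eqP; rewrite eq_complex.
  case: (repr (P u) x) (repr (P v) x) => p q [p' q'] /=.
  by apply/andP; split; apply/eqP; ring.
rewrite L2dotZl L2dotZr conjc_real; congr (_ * _).
by rewrite L2dotBl L2dotBr Psa.
Qed.

(** With [sig] the square root of [rho], the form is [sqn (funcalc sig u)]. Pythagoras applies, as
    one summand of [funcalc] lies in the range of [P] and the other in its kernel. *)
Lemma rdot_funcalc rho u : bounded_measurable rho -> (forall t, 0 <= rho t) ->
  (rdot ip (funcalc rho u) u)%:E =
  (\int[mu]_x ((rho (b x))%:E * (normc (fP u x) ^+ 2)%:E)
   + (rho 0)%:E * (sqn ip (u - P u))%:E)%E.
Proof.
move=> br rho0; have [mr _] := br.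
pose sig := fun t => Num.sqrt (rho t).
have bs : bounded_measurable sig.
  split; first exact: (measurableT_comp (continuous_measurable_fun (@sqrt_continuous R)) mr).
  have [_ [K rK]] := br; exists (Num.sqrt K) => t.
  rewrite ger0_norm ?sqrtr_ge0// ler_wsqrtr//.
  by rewrite (le_trans _ (rK t))// ler_norm.
have rE : rho = (fun t => sig t * sig t).
  by apply/funext => t; rewrite -expr2 sqr_sqrtr.
have -> : rdot ip (funcalc rho u) u = sqn ip (funcalc sig u).
  by rewrite rE -funcalc_comp// L2_rdotE funcalc_selfadj.
rewrite /funcalc sqnD sqnZ EFinD EFinD sqn_L2of; last exact: sqr.
have -> : rdot ip (L2of (rmul (sig \o b) (fP u))) ((sig 0)%:C%C *: (u - P u)) = 0.
  rewrite rdotZr L2_rdotE -P_L2of_rmul; [|by case: bs|exact: sqr].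
  by rewrite Psa PB Pidem subrr L2dot0r/= mulr0.
rewrite mulr0 adde0; congr (_ + _)%E.
  by apply: eq_integral => x _; rewrite normc_rmul -EFinM/= rE expr2.
by rewrite -EFinM rE expr2.
Qed.

Lemma funcalc1 u : funcalc (fun=> 1) u = u.
Proof.
rewrite /funcalc (_ : rmul _ _ = fP u); last by apply/funext => x; rewrite /rmul mul1r.
by rewrite L2of_repr scale1r addrC subrK.
Qed.

Definition mult_spectral D : L2space mu -> L2space mu := funcalc \1_D.

Let bind D : measurable D -> bounded_measurable (\1_D : R -> R).
Proof.
move=> mD; split; first exact: measurable_indic.
by exists 1 => t; rewrite indicE; case: (_ \in _); rewrite ?normr1 ?normr0.
Qed.

(** The spectral measure of [u] is the image under [b] of [|P u|^2 mu] plus a point mass at [0],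
    which accounts for the component of [u] in the kernel of [P]. *)
Lemma mult_form_measure u : exists N : {measure set R -> \bar R},
  (forall D, measurable D -> N D = (sqn ip (mult_spectral D u))%:E) /\
  forall G : R -> \bar R, measurable_fun setT G -> (forall t, 0 <= G t)%E ->
    (\int[N]_t G t = \int[mu]_x (G (b x) * (normc (fP u x) ^+ 2)%:E)
      + G 0%R * (sqn ip (u - P u))%:E)%E.
Proof.
have mf : measurable_fun setT (fun x => (normc (fP u x) ^+ 2)%:E).
  by apply/measurable_EFinP/measurable_sqr_normc; case: (sqf u).
have f0 x : (0 <= (normc (fP u x) ^+ 2)%:E)%E by rewrite lee_fin sqr_ge0.
have [N1 N1E] := preimage_density_measure mu mb mf f0.
pose c : {nonneg R} := NngNum (sqn_ge0 ip (u - P u)).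
pose N2 : {measure set R -> \bar R} := mscale c (dirac (0 : R)).
have I G : measurable_fun setT G -> (forall t, 0 <= G t)%E ->
    (\int[measure_add N1 N2]_t G t = \int[mu]_x (G (b x) * (normc (fP u x) ^+ 2)%:E)
      + G 0%R * (sqn ip (u - P u))%:E)%E.
  move=> mG G0; rewrite ge0_integral_measure_add//; congr (_ + _)%E.
    by rewrite (integral_comp_density (nu := N1) mb mf f0).
  rewrite ge0_integral_mscale// integral_dirac// diracT mul1e muleC//.
exists (measure_add N1 N2); split=> // D mD.
have mI : measurable_fun setT (EFin \o (\1_D : R -> R)).
  by apply/measurable_EFinP; exact: measurable_indic.
have I0 (t : R) : (0 <= (EFin \o (\1_D : R -> R)) t)%E by rewrite lee_fin.
have := I _ mI I0; rewrite integral_indic// setIT => ->.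
rewrite -rdot_funcalc//; last exact: bind.
congr EFin; rewrite L2_rdotE /sqn L2_rdotE -funcalc_selfadj; last exact: bind.
rewrite funcalc_comp; [|exact: bind..].
have -> : (fun t => \1_D t * \1_D t) = \1_D :> (R -> R) => //.
by apply/funext => t; rewrite indicE; case: (_ \in _); rewrite ?mulr1 ?mulr0.
Qed.

Lemma mult_spectral_setD A B u : measurable A -> measurable B -> A `<=` B ->
  mult_spectral B u - mult_spectral A u = mult_spectral (B `\` A) u.
Proof.
move=> mA mB AB; apply/eqP; rewrite subr_eq; apply/eqP.
rewrite -funcalcD; [|apply: bind..] => //; last exact: measurableD.
congr (funcalc _ u); apply/funext => t; rewrite !indicE.
have [tA|tA] := boolP (t \in A).
  have tB : t \in B by rewrite inE; apply: AB; rewrite inE in tA.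
  rewrite tB [t \in _ `\` _](_ : _ = false) ?add0r//.
  by apply/negbTE; rewrite notin_setE => -[_]; apply; rewrite inE in tA.
have -> : (t \in B `\` A) = (t \in B).
  apply/idP/idP; rewrite !inE; first by case.
  by move=> tB; split=> //; rewrite notin_setE in tA.
exact: (esym (addr0 _)).
Qed.

Lemma mult_spectral_set0 u : mult_spectral set0 u = 0.
Proof.
have [N [NE _]] := mult_form_measure u.
apply: (@sqn_eq0 _ _ ip); apply: EFin_inj.
by rewrite -NE// measure0.
Qed.

Lemma mult_spectral_bigsetU (F : (set R)^nat) n u : (forall n, measurable (F n)) ->
  trivIset setT F ->
  \sum_(i < n) mult_spectral (F i) u = mult_spectral (\big[setU/set0]_(i < n) F i) u.
Proof.
move=> mF tF; elim: n => [|n IH]; first by rewrite !big_ord0 mult_spectral_set0.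
rewrite !big_ord_recr/= IH.
set U := \big[setU/set0]_(i < n) F i.
have mU : measurable U by exact: bigsetU_measurable.
have := @mult_spectral_setD U (U `|` F n) u mU (measurableU _ _ mU (mF n)) (@subsetUl _ _ _).
have -> : (U `|` F n) `\` U = F n.
  have UF : U `&` F n = set0.
    apply/seteqP; split => // t []; rewrite /U -bigcup_mkord => -[k /= kn Fk] Fn.
    by have kE := tF k n I I (ex_intro _ t (conj Fk Fn)); rewrite kE ltnn in kn.
  apply/seteqP; split => t; first by case=> -[].
  move=> Ft; split; first by right.
  by move=> Ut; have : (U `&` F n) t by []; rewrite UF.
by move/eqP; rewrite subr_eq addrC => /eqP ->.
Qed.

Lemma mult_spectral_measure : spectral_measure ip mult_spectral.
Proof.
split.
- by move=> D mD c x y; apply: funcalc_linear; exact: bind.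
- move=> D mD x; rewrite /mult_spectral funcalc_comp; [|exact: bind..].
  congr (funcalc _ x); apply/funext => t; rewrite indicE.
  by case: (_ \in _); rewrite ?mulr1 ?mulr0.
- by move=> D mD x y; apply: funcalc_selfadj; exact: bind.
- move=> x; rewrite /mult_spectral -[RHS]funcalc1; congr (funcalc _ x).
  by apply/funext => t; rewrite indicT.
move=> F mF tF x; have [N [NE _]] := mult_form_measure x.
have mUF : measurable (\bigcup_n F n) by exact: bigcup_measurable.
pose U n := \big[setU/set0]_(i < n) F i.
have mU n : measurable (U n) by exact: bigsetU_measurable.
pose W n := \bigcup_n F n `\` U n.
have mW n : measurable (W n) by exact: measurableD.
have UU n : U n `<=` \bigcup_n F n by rewrite /U -bigcup_mkord => t [k _ Fk]; exists k.
(* The squared norm of the remainder is [N (W n)], where [N] is finite and [W n] decreases to the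
   empty set. *)
have cv : (N \o W) n @[n --> \oo] --> 0%E.
  have -> : (0%E = N (\bigcap_n W n)).
    rewrite (_ : \bigcap_n W n = set0) ?measure0//.
    apply/seteqP; split => // t h.
    have [[k _ Fk] _] := h 0%N I.
    have [_] := h k.+1 I; apply.
    by rewrite /U -bigcup_mkord; exists k => /=.
  apply: nonincreasing_cvg_mu => //.
  - by rewrite /= NE// ltry.
  - by apply: bigcap_measurable => //; exists 0%N.
  - move=> n m nm; apply/subsetPset => t [Ft Ut]; split=> // h; apply: Ut.
    by move: h; rewrite /U -!bigcup_mkord => -[k /= kn Fk]; exists k => //=; exact: leq_trans kn nm.
have h2 : (fun n => hnorm ip (mult_spectral (W n) x) ^+ 2) @ \oo --> (0 : R).
  have /fine_cvgP[_ cv'] := cv.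
  apply: cvg_trans cv'; apply: near_eq_cvg; apply: nearW => n.
  by rewrite /= hnorm_sqr NE.
have h1 : (fun n => Num.sqrt (hnorm ip (mult_spectral (W n) x) ^+ 2)) @ \oo --> (0 : R).
  by rewrite -[X in _ --> X]sqrtr0; apply: continuous_cvg => //; exact: sqrt_continuous.
apply: cvg_trans h1; apply: near_eq_cvg; apply: nearW => n /=.
rewrite sqrtr_sqr ger0_norm ?sqrtr_ge0//.
by rewrite mult_spectral_bigsetU// (mult_spectral_setD _ (mU n) mUF (UU n)).
Qed.

Lemma integral_mult_form u (G : R -> \bar R) :
  measurable_fun setT G -> (forall t, 0 <= G t)%E ->
  (\int[spectral_form ip mult_spectral u]_t G t =
   \int[mu]_x (G (b x) * (normc (fP u x) ^+ 2)%:E)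
     + G 0%R * (sqn ip (u - P u))%:E)%E.
Proof.
move=> mG G0; have [N [NE NG]] := mult_form_measure u.
rewrite -NG//; apply: eq_raw_integral => D mD.
by rewrite (spectral_form_specm mult_spectral_measure)// specmE// NE.
Qed.

Variable g : R -> R.
(** [g 0 = 0] removes the point mass of the kernel of [P], so that [mult_op] has no term in
    [u - P u]. *)
Hypotheses (mg : measurable_fun setT g) (g0 : g 0 = 0) (g_ge0 : forall t, 0 <= t -> 0 <= g t).

Definition mult_op : set (L2space mu * L2space mu) :=
  [set uv | sq (rmul (g \o b) (fP uv.1)) /\ uv.2 = L2of (rmul (g \o b) (fP uv.1))].

Let G u := L2of (rmul (g \o b) (fP u)).

Lemma mult_spectral_dom u : spectral_dom ip mult_spectral g u <-> sq (rmul (g \o b) (fP u)).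
Proof.
rewrite /spectral_dom/= integral_mult_form; last 2 first.
- by apply/measurable_EFinP; exact: measurable_funX.
- by move=> t; rewrite lee_fin sqr_ge0.
rewrite g0 expr0n mul0e adde0.
rewrite (_ : (fun x => _) = (fun x => (normc (rmul (g \o b) (fP u) x) ^+ 2)%:E)); last first.
  by apply/funext => x; rewrite normc_rmul EFinM.
split=> [h|[]//]; split=> //; apply: cmeasurable_rmul; first exact: mrho.
by case: (sqf u).
Qed.

Lemma mult_spectral_q u : sq (rmul (g \o b) (fP u)) ->
  (Complex (fine (\int[spectral_form ip mult_spectral u]_t (g t)%:E)%E) 0 : R[i]) =
  ip (G u) (P u).
Proof.
move=> su; rewrite -(L2of_repr (P u)) ip_L2of//; last exact: sqf.
have mgE : measurable_fun setT (EFin \o g) by exact/measurable_EFinP.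
apply/eqP; rewrite eq_complex /=; apply/andP; split; apply/eqP; last first.
  rewrite [X in fine X](_ : _ = 0%E)// integral0_eq// => x _.
  by rewrite /rmul /fP/=; case: (repr (P u) x) => p q /=; congr EFin; ring.
congr fine.
rewrite (integral_spectral_form mult_spectral_measure) [LHS]integralE.
rewrite -!(integral_spectral_form mult_spectral_measure) integral_mult_form; last 2 first.
- exact: measurable_funepos.
- by move=> t; exact: funepos_ge0.
rewrite integral_mult_form; last 2 first.
- exact: measurable_funeneg.
- by move=> t; exact: funeneg_ge0.
rewrite !funeposE !funenegE g0 oppe0 maxxx !mul0e !adde0.
(* [g] may be negative at negative arguments, but [b] takes no such values. *)
rewrite [X in (_ - X)%E]integral0_eq ?sube0; last first.
  by move=> x _; rewrite funenegE max_r ?mul0e// leeNl oppe0 lee_fin g_ge0.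
apply: eq_integral => x _; rewrite funeposE max_l ?lee_fin ?g_ge0// -EFinM; congr EFin.
by rewrite Defs.sqr_normc /rmul /fP/=; case: (repr (P u) x) => p q /=; ring.
Qed.

Lemma mult_op_GD u v (c : R[i]) : sq (rmul (g \o b) (fP u)) -> sq (rmul (g \o b) (fP v)) ->
  sq (rmul (g \o b) (fP (u + c *: v))) /\ G (u + c *: v) = G u + c *: G v.
Proof.
move=> su sv.
have E : {ae mu, forall x, c * rmul (g \o b) (fP v) x + rmul (g \o b) (fP u) x =
    rmul (g \o b) (fP (u + c *: v)) x}.
  rewrite addrC; apply: filterS (fPZD c v u) => x.
  by rewrite /rmul => ->; rewrite mulrDr mulrCA.
have s := sqZD c sv su.
have s' : sq (rmul (g \o b) (fP (u + c *: v))).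
  apply: sq_ae E s; apply: cmeasurable_rmul; first exact: mrho.
  by case: (sqf (u + c *: v)).
split=> //; rewrite /G [RHS]addrC -L2ofZD//; apply/L2of_eq => //.
by apply: filterS E => x ->.
Qed.

Lemma mult_op_form u z : sq (rmul (g \o b) (fP u)) -> sq (rmul (g \o b) (fP z)) ->
  let q x := (Complex (fine (\int[spectral_form ip mult_spectral x]_t (g t)%:E)%E) 0 : R[i]) in
  let i := (Complex 0 1 : R[i]) in
  4^-1 * \sum_(k < 4) i ^+ k * q (u + i ^+ k *: z) = ip (G u) z.
Proof.
move=> su sz q i.
have qE c : q (u + c *: z) = ip (G u + c *: G z) (P u + c *: P z).
  have [s GE] := mult_op_GD c su sz.
  by rewrite /q mult_spectral_q// GE PD PZ.
under eq_bigr do rewrite qE.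
have -> : ip (G u) z = ip (G u) (P z).
  by rewrite -Psa P_L2of_rmul.
exact: L2_polarization.
Qed.

(** In the harder inclusion [v] is recovered from its inner products with the domain. The difference
    [r = v - G u] is tested against its own projections for the sets where [|g| <= n]: these
    projections lie in the domain, hence vanish, and the sets exhaust the line. *)
Lemma mult_spectral_integral : spectral_integral ip mult_spectral g = mult_op.
Proof.
apply/seteqP; split => -[u v] /=; rewrite /spectral_integral /mult_op/=.
  move=> [/mult_spectral_dom du H]; split=> //.
  apply/eqP; rewrite -subr_eq0; apply/eqP; set r := v - _.
  pose D n := [set t | `|g t| <= n%:R].
  have mD n : measurable (D n).
    have mag : measurable_fun setT (fun t => `|g t|) by exact: measurableT_comp.
    have := mag measurableT _ (measurable_itv `]-oo, n%:R]); rewrite setTI.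
    by congr measurable; apply/seteqP; split => t; rewrite /= in_itv.
  have dz n : sq (rmul (g \o b) (fP (mult_spectral (D n) r))).
    apply: (@sq_ae _ _ _ mu (rmul ((fun t => g t * \1_(D n) t) \o b) (fP r))).
    - apply: cmeasurable_rmul; first exact: mrho.
      by case: (sqf (mult_spectral (D n) r)).
    - apply: filterS (funcalc_fP r (bind (mD n))) => x.
      by rewrite /rmul/= => ->; rewrite rmorphM mulrA.
    - apply: sqr (sqf r); split.
        by apply: measurable_funM => //; exact: measurable_indic.
      exists n%:R => t; rewrite indicE; case: (boolP (_ \in _)) => h.
        by rewrite mulr1; move: h; rewrite inE.
      by rewrite mulr0 normr0.
  have r0 n : mult_spectral (D n) r = 0.
    have /mult_spectral_dom dzn := dz n.
    have := H _ dzn; rewrite mult_op_form// => E.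
    apply: (@sqn_eq0 _ _ ip).
    rewrite -(rdot_spec_sqn mult_spectral_measure)// rdotC L2_rdotE.
    by rewrite L2dotBl E subrr.
  have : mult_spectral (\bigcup_n D n) r = 0.
    exact: (spec_null_bigcup mult_spectral_measure).
  have -> : \bigcup_n D n = setT.
    apply/seteqP; split => // t _; exists (Num.trunc `|g t|).+1 => //=.
    exact: ltW (truncnS_gt _).
  by rewrite (spectralT mult_spectral_measure).
move=> [du ->]; split; first exact/mult_spectral_dom.
by move=> z /mult_spectral_dom dz; rewrite mult_op_form.
Qed.
End multiplication_operator.

Section mult_op_power.
Context d (X : measurableType d) (R : realType).
Variable mu : {measure set X -> \bar R}.
Local Notation ip := (L2dot mu).
Local Notation sq := (square_integrable mu).
Variables (b : X -> R) (P : L2space mu -> L2space mu).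
Hypotheses (mb : measurable_fun setT b) (b0 : forall x, 0 <= b x).
Hypothesis Plin : forall (c : R[i]) u v, P (c *: u + v) = c *: P u + P v.
Hypothesis Pidem : forall u, P (P u) = P u.
Hypothesis Psa : forall u v, ip (P u) v = ip u (P v).
Hypothesis Pmul : forall (rho : R -> R) f, measurable_fun setT rho ->
  sq f -> P (L2of mu f) = L2of mu f -> sq (rmul (rho \o b) f) ->
  P (L2of mu (rmul (rho \o b) f)) = L2of mu (rmul (rho \o b) f).

Let E := mult_spectral b P.
Let HE : spectral_measure ip E := mult_spectral_measure mb Plin Pidem Psa Pmul.

Let bind D : measurable D -> bounded_measurable (\1_D : R -> R).
Proof.
move=> mD; split; first exact: measurable_indic.
by exists 1 => t; rewrite indicE; case: (_ \in _); rewrite ?normr1 ?normr0.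
Qed.

(** The resolvent is the functional calculus of [(t - c)^-1] cut off on [J], a function bounded by
    [r^-1]. Off [J] one has [t * rho t = 1 + c * rho t], and [x] has no component in the range of
    [E J]. *)
Lemma mult_resolvent (c r : R) x : 0 < r -> E `]c - r, c + r[%classic x = 0 ->
  exists x', [/\ E `]c - r, c + r[%classic x' = 0,
    mult_op b P id (x', x + c%:C%C *: x') & r ^+ 2 * sqn ip x' <= sqn ip x].
Proof.
move=> r0; set J := [set` _] => EJ.
have mJ : measurable J by exact: measurable_itv.
pose rho (t : R) := (t - c)^-1 * \1_(~` J) t.
have Jt t : t \in ~` J -> r <= `|t - c|.
  rewrite inE /J/= in_itv/= => /negP; rewrite negb_and -!leNgt ler_normr.
  by move=> /orP[h|h]; apply/orP; [right|left]; lra.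
have mrho : measurable_fun setT rho.
  apply: measurable_funM; last by apply: measurable_indic; exact: measurableC.
  by apply: (measurableT_comp (@measurable_invr R)); exact: measurable_funB.
have rb t : `|rho t| <= r^-1.
  rewrite /rho indicE; case: (boolP (_ \in _)) => [/Jt h|_].
    rewrite mulr1 normfV lef_pV2 ?posrE//; exact: lt_le_trans h.
  by rewrite mulr0 normr0 invr_ge0 ltW.
have brho : bounded_measurable rho by split=> //; exists r^-1.
have bJ := bind mJ; have bJC := bind (measurableC mJ).
have trho t : t * rho t = \1_(~` J) t + c * rho t.
  rewrite /rho indicE; case: (boolP (_ \in _)) => [/Jt h|_]; last by rewrite !mulr0 addr0.
  rewrite !mulr1; have tc : t - c != 0 by rewrite -normr_gt0 (lt_le_trans r0).
  by rewrite -{1}[t](subrK c) mulrDl divff.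
have btrho : bounded_measurable (fun t => t * rho t).
  split; first exact: measurable_funM.
  exists (1 + `|c| * r^-1) => t; rewrite trho (le_trans (ler_normD _ _))// lerD//.
    by rewrite indicE; case: (_ \in _); rewrite ?normr1 ?normr0.
  by rewrite normrM ler_wpM2l.
have s : sq (rmul (id \o b) (repr (P (funcalc b P rho x)))).
  apply: (@sq_ae _ _ _ mu (rmul ((fun t => t * rho t) \o b) (repr (P x)))).
  - by apply: cmeasurable_rmul => //; case: (sq_repr (P (funcalc b P rho x))).
  - have := funcalc_fP mb Plin Pidem Pmul x brho; apply: filterS => y.
    by rewrite /rmul/= => ->; rewrite rmorphM mulrA.
  - have [m1 [K m2]] := btrho.
    apply: (@sq_rmul_bounded _ _ _ _ _ _ K); last exact: sq_repr.
      exact: measurableT_comp.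
    by move=> y; exact: m2.
exists (funcalc b P rho x); split.
- rewrite /E /mult_spectral (funcalc_comp mb Plin Pidem Pmul)//.
  rewrite (_ : (fun t => _) = (fun t => 0 * rho t)); last first.
    apply/funext => t; rewrite mul0r /rho !indicE in_setC.
    by case: (_ \in J); rewrite ?mulr0 ?mul0r.
  by rewrite funcalcZ//= scale0r.
- rewrite /mult_op/=; split=> //.
  have xE : E (~` J) x = x by rewrite -{2}(spec_setC HE x mJ) EJ add0r.
  have -> : x + c%:C%C *: funcalc b P rho x =
      L2of mu (rmul ((fun t => t * rho t) \o b) (repr (P x))).
    rewrite -{1}xE -funcalcZ// /E /mult_spectral -funcalcD//; last first.
      by split; [exact: measurable_funM|exists (`|c| * r^-1) => t; rewrite normrM ler_wpM2l].
    rewrite (_ : (fun t => _) = (fun t => t * rho t)); last by apply/funext => t; rewrite trho.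
    (* [t * rho t] vanishes at [0], so the kernel term of [funcalc] disappears. *)
    by rewrite {1}/funcalc mul0r scale0r addr0.
  have [m1 [K m2]] := btrho.
  apply/L2of_eq => //.
    apply: (@sq_rmul_bounded _ _ _ _ _ _ K); last exact: sq_repr.
      exact: measurableT_comp.
    by move=> y; exact: m2.
  have := funcalc_fP mb Plin Pidem Pmul x brho; apply: filterS => y.
  by rewrite /rmul/= => ->; rewrite rmorphM mulrA.
(* The norm bound is positivity of the calculus for the function [1 - r^2 rho^2]. *)
- have r2 t : r ^+ 2 * (rho t * rho t) <= 1.
    have h : r * `|rho t| <= 1.
      by apply: (le_trans (ler_wpM2l (ltW r0) (rb t))); rewrite divff// gt_eqF.
    have -> : r ^+ 2 * (rho t * rho t) = (r * `|rho t|) ^+ 2.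
      by rewrite exprMn real_normK ?num_real.
    by apply: exprn_ile1 => //; rewrite mulr_ge0// ltW.
  have brr : bounded_measurable (fun t => rho t * rho t).
    split; first exact: measurable_funM.
    by exists (r^-1 * r^-1) => t; rewrite normrM ler_pM.
  have bm : bounded_measurable (fun t => - r ^+ 2 * (rho t * rho t)).
    split; first by apply: measurable_funM => //; case: brr.
    exists 1 => t; rewrite mulNr normrN ger0_norm// mulr_ge0 ?sqr_ge0//.
  have b1 : bounded_measurable (fun _ : R => 1 : R).
    by split; [exact: measurable_cst|exists 1 => t; rewrite normr1].
  have btau : bounded_measurable (fun t => 1 + - r ^+ 2 * (rho t * rho t)).
    split; first by apply: measurable_funD => //; case: bm.
    have [_ [K hK]] := bm.
    by exists (1 + K) => t; rewrite (le_trans (ler_normD _ _))// normr1 lerD2l.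
  have : 0 <= rdot ip (funcalc b P (fun t => 1 + - r ^+ 2 * (rho t * rho t)) x) x.
    rewrite -lee_fin rdot_funcalc//.
      rewrite adde_ge0//; first by apply: integral_ge0 => y _; rewrite mule_ge0// lee_fin ?sqr_ge0// mulNr subr_ge0.
      by rewrite mule_ge0// lee_fin ?sqn_ge0// mulNr subr_ge0.
    by move=> t; rewrite mulNr subr_ge0.
  rewrite funcalcD// funcalcZ// funcalc1 rdotDl rdotZl.
  rewrite -(funcalc_comp mb Plin Pidem Pmul)//.
  have -> : rdot ip (funcalc b P rho (funcalc b P rho x)) x = sqn ip (funcalc b P rho x).
    by rewrite L2_rdotE funcalc_selfadj.
  by rewrite mulNr subr_ge0.
Qed.

Theorem oppow_mult_op (s : R) : 0 < s ->
  oppow ip (mult_op b P id) s = mult_op b P (fun t => t `^ s).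
Proof.
(* The choice operator returns some spectral measure [F] of the operator; [E] shows that there is
   one, and uniqueness replaces [F] by [E]. *)
move=> s0; rewrite /oppow /spectral_measure_of; case: xgetP => [F _ [HF FE]|/(_ E)]; last first.
  case; split; first exact: HE.
  exact: mult_spectral_integral.
have U := spectral_form_unique HF HE.
rewrite -(mult_spectral_integral mb b0 Plin Pidem Psa Pmul); last 3 first.
- exact: measurable_powR.
- by rewrite powR0// gt_eqF.
- by move=> t _; exact: powR_ge0.
apply: spectral_integral_ext; apply: U => c r x r0 Ex.
by rewrite FE; exact: mult_resolvent.
Qed.
End mult_op_power.

(** * The measure of the weighted composition operator *)

Section integral_helpers.
Local Open Scope ereal_scope.
Context d (X : measurableType d) (R : realType) (mu : {measure set X -> \bar R}).
Implicit Types (D : set X) (f g F H k : X -> \bar R).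

Lemma integral_indicM D F : measurable D ->
  \int[mu]_(x in D) F x = \int[mu]_x ((\1_D x)%:E * F x).
Proof.
move=> mD; rewrite integral_mkcond; apply: eq_integral => x _.
by rewrite patchE indicE; case: ifP; rewrite ?mul1e ?mul0e.
Qed.

Lemma measurable_indicE D : measurable D -> measurable_fun setT (fun x => (\1_D x : R)%:E).
Proof. by move=> mD; apply/measurable_EFinP; exact: measurable_indic. Qed.

Lemma ge0_integral_eq0_ae D f : measurable D -> measurable_fun setT f ->
  (forall x, 0 <= f x) -> \int[mu]_(x in D) f x = 0 ->
  {ae mu, forall x, D x -> f x = 0}.
Proof.
move=> mD mf f0 I0; apply/ae_eq_integral_abs => //; first exact: measurable_funTS.
by under eq_integral do rewrite gee0_abs//.
Qed.

Lemma ae_ge0_integral_eq0 D f : measurable D -> measurable_fun setT f ->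
  (forall x, 0 <= f x) -> {ae mu, forall x, D x -> f x = 0} ->
  \int[mu]_(x in D) f x = 0.
Proof.
move=> mD mf f0 ae0; rewrite -[RHS](integral0 mu D).
by apply: ge0_ae_eq_integral => //; exact: measurable_funTS.
Qed.

Lemma ae_ge0_le_integralT f g : measurable_fun setT f -> (forall x, 0 <= f x) ->
  measurable_fun setT g -> (forall x, 0 <= g x) ->
  {ae mu, forall x, f x <= g x} -> \int[mu]_x f x <= \int[mu]_x g x.
Proof.
move=> mf f0 mg g0 fg; apply: ae_ge0_le_integral => //.
by apply: filterS fg => x h _.
Qed.

Lemma ae_ge0_eq_integralT f g : measurable_fun setT f -> (forall x, 0 <= f x) ->
  measurable_fun setT g -> (forall x, 0 <= g x) ->
  {ae mu, forall x, f x = g x} -> \int[mu]_x f x = \int[mu]_x g x.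
Proof.
move=> mf f0 mg g0 fg; apply: ge0_ae_eq_integral => //.
by apply: filterS fg => x h _.
Qed.

Lemma ae_ge0_eq_integralD D f g : measurable D -> measurable_fun setT f -> (forall x, 0 <= f x) ->
  measurable_fun setT g -> (forall x, 0 <= g x) ->
  {ae mu, forall x, f x = g x} -> \int[mu]_(x in D) f x = \int[mu]_(x in D) g x.
Proof.
move=> mD mf f0 mg g0 fg; apply: ge0_ae_eq_integral => //; try exact: measurable_funTS.
by apply: filterS fg => x h _.
Qed.

(** Both sides integrate [k] against the image of [F mu] under [phi], which has density [H]. *)
Lemma integral_transfer (phi : X -> X) F H k :
  measurable_fun setT phi ->
  measurable_fun setT F -> (forall x, 0 <= F x) ->
  measurable_fun setT H -> (forall x, 0 <= H x) ->
  measurable_fun setT k -> (forall x, 0 <= k x) ->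
  (forall D, measurable D -> \int[mu]_(x in phi @^-1` D) F x = \int[mu]_(x in D) H x) ->
  \int[mu]_x (k (phi x) * F x) = \int[mu]_x (k x * H x).
Proof.
move=> mphi mF F0 mH H0 mk k0 E.
have [nu nuE] := preimage_density_measure mu mphi mF F0.
rewrite (integral_comp_density (nu := nu) mphi mF F0)//.
apply/esym; apply: (integral_comp_density (nu := nu) (phi := idfun)) => //.
- exact: measurable_id.
- by move=> D mD; rewrite nuE E.
Qed.
End integral_helpers.

Section weighted_composition_measure.
Context d (X : measurableType d) (R : realType).
Variables (mu : {sigma_finite_measure set X -> \bar R}) (phi : X -> X) (w : X -> R[i]).
Hypotheses (mw : cmeasurable w) (mphi : measurable_fun setT phi).
Local Open Scope ereal_scope.

Definition weight (x : X) : R := (normc (w x) ^+ 2)%R.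

Local Notation om := weight.

Lemma weight_ge0 x : (0 <= om x)%R. Proof. exact: sqr_ge0. Qed.

Lemma weight_eq0 x : om x = 0%R -> w x = 0%R.
Proof. by move=> /eqP; rewrite sqrf_eq0 => /eqP /eq0_normc. Qed.

Lemma weight_neq0 x : (om x == 0%R) = (w x == 0%R).
Proof.
apply/eqP/eqP => [/weight_eq0//|w0].
by rewrite /om w0 normc0 expr0n.
Qed.

Lemma measurable_weight : measurable_fun setT om.
Proof. exact: measurable_sqr_normc. Qed.

Lemma measurable_weightE : measurable_fun setT (fun x => (om x)%:E).
Proof. by apply/measurable_EFinP; exact: measurable_weight. Qed.

Let omE0 x : 0 <= (om x)%:E. Proof. by rewrite lee_fin weight_ge0. Qed.

Let mpre D : measurable D -> measurable (phi @^-1` D).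
Proof. exact: measurable_preimageT. Qed.

Lemma weighted_measureE : exists nu : {measure set X -> \bar R},
  forall D, nu D = weighted_measure mu w D.
Proof. exact: (preimage_density_measure mu (@measurable_id _ X setT) measurable_weightE omE0). Qed.

Lemma integral_weighted_measureT (g : X -> \bar R) :
  measurable_fun setT g -> (forall x, 0 <= g x) ->
  \int[weighted_measure mu w]_x g x = \int[mu]_x (g x * (om x)%:E).
Proof.
move=> mg g0; have [nu nuE] := weighted_measureE.
transitivity (\int[nu]_x g x).
  by apply: eq_raw_integral => D mD; rewrite nuE.
apply/esym/(integral_comp_density (phi := idfun)) => //.
- exact: measurable_id.
- exact: measurable_weightE.
Qed.

Lemma integral_weighted_measure D (g : X -> \bar R) : measurable D ->
  measurable_fun setT g -> (forall x, 0 <= g x) ->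
  \int[weighted_measure mu w]_(x in D) g x = \int[mu]_(x in D) (g x * (om x)%:E).
Proof.
move=> mD mg g0; have [nu nuE] := weighted_measureE.
transitivity (\int[nu]_(x in D) g x).
  by apply: eq_raw_integral => A mA; rewrite nuE.
rewrite integral_indicM//.
transitivity (\int[weighted_measure mu w]_x ((\1_D x)%:E * g x)).
  by apply: eq_raw_integral => A mA; rewrite nuE.
rewrite integral_weighted_measureT.
- by rewrite [RHS]integral_indicM//; apply: eq_integral => x _; rewrite muleA.
- by apply: emeasurable_funM => //; exact: measurable_indicE.
- by move=> x; rewrite mule_ge0// lee_fin.
Qed.

Lemma ae_weighted_measure (Q : X -> Prop) :
  {ae weighted_measure mu w, forall x, Q x} <->
  {ae mu, forall x, w x != 0%R -> Q x}.
Proof.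
have mw0 : measurable [set x | w x = 0%R].
  have := measurable_weight measurableT (measurable_set1 0%R); rewrite setTI.
  congr measurable; apply/seteqP; split => x /=; first exact: weight_eq0.
  by move=> w0; apply/eqP; rewrite weight_neq0 w0.
split=> -[A [mA A0 QA]].
- have := ge0_integral_eq0_ae mA measurable_weightE omE0 A0.
  apply: filterS => x h w0; apply: contrapT => nQ.
  have [/eqP] := h (QA _ nQ); rewrite weight_neq0 => /eqP w00.
  by rewrite w00 eqxx in w0.
- exists (A `|` [set x | w x = 0%R]); split.
  + exact: measurableU.
  + apply: ae_ge0_integral_eq0 => //; [exact: measurableU|exact: measurable_weightE|].
    exists A; split=> // x /= h; apply: contrapT => nA; apply: h => -[//|/= w0].
    by rewrite /om w0 normc0 expr0n.
  + move=> x /= nQ; have [w0|w0] := eqVneq (w x) 0%R; first by right.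
    by left; apply: QA => /(_ w0).
Qed.

Hypothesis dom : weighted_pushforward mu phi w `<< mu.
Let h := wcomp_deriv mu phi w.

Lemma wcomp_derivP : is_wcomp_deriv mu phi w h.
Proof.
rewrite /h /wcomp_deriv; case: xgetP => // noex; exfalso.
have [] := @preimage_density_exists _ _ _ _ _ mu mu phi (fun x => (om x)%:E).
- exact: mphi.
- exact: measurable_weightE.
- exact: omE0.
- move=> D mD D0; move/null_content_dominatesP : dom; exact.
by move=> H [mH H0 HE]; apply: (noex H); split.
Qed.

Let mh : measurable_fun setT h. Proof. by case: wcomp_derivP. Qed.
Let h0 x : 0 <= h x. Proof. by case: wcomp_derivP. Qed.

Lemma transfer_h k : measurable_fun setT k -> (forall x, 0 <= k x) ->
  \int[mu]_x (k (phi x) * (om x)%:E) = \int[mu]_x (k x * h x).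
Proof.
move=> mk k0; apply: integral_transfer => //; first exact: measurable_weightE.
by case: wcomp_derivP.
Qed.

(** Every [f] in the domain satisfies [\int |f|^2 h dmu < +oo], hence vanishes almost everywhere on
    [S], where [h] is infinite. The squared distance from such an [f] to the indicator of a subset
    of [S] is at least the measure of that subset, so density forces this measure to be [0]. *)
Lemma densely_defined_deriv_lty : densely_defined (L2dot mu) (wcomp mu phi w) ->
  {ae mu, forall x, h x < +oo}.
Proof.
move=> dd.
have [A [mA Afin ndA AT]] := sigma_finite_cover mu.
pose S := [set x | h x = +oo].
have mS : measurable S.
  by have := mh measurableT (emeasurable_set1 +oo); rewrite setTI.
pose B n := S `&` A n.
have mB n : measurable (B n) by exact: measurableI.
have B0 n : mu (B n) = 0.
  have Bfin : mu (B n) < +oo.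
    by apply: le_lt_trans (Afin n); apply: le_measure; rewrite ?inE//; exact: subIsetr.
  pose i : X -> R[i] := fun x => (\1_(B n) x)%:C%C.
  have ni x : (normc (i x) ^+ 2 = \1_(B n) x)%R.
    by rewrite Defs.sqr_normc /i/= indicE; case: (_ \in _); rewrite /= ?expr1n ?expr0n/= ?addr0.
  have si : square_integrable mu i.
    split; first by split; [exact: measurable_indic|exact: measurable_cst].
    under eq_integral do rewrite ni.
    by rewrite integral_indic// setIT.
  apply/eqP; rewrite eq_le measure_ge0 andbT.
  apply/lee_addgt0Pr => e e0; rewrite add0e.
  have se0 : (0 < Num.sqrt e)%R by rewrite sqrtr_gt0.
  have [y [z [f [g [/= yE zE gE]]]] ny] := dd (L2of mu i) _ se0.
  have nf x : (normc (g x) ^+ 2 = normc (f (phi x)) ^+ 2 * om x)%R.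
    by rewrite gE normcM exprMn mulrC.
  have [[mf1 mf2] _] := L2funP f; have [_ Ig] := L2funP g.
  have mnf : measurable_fun setT (fun x => (normc (f x) ^+ 2)%:E).
    by apply/measurable_EFinP/measurable_sqr_normc.
  have nf0 x : 0 <= (normc (f x) ^+ 2)%:E by rewrite lee_fin sqr_ge0.
  have fh : \int[mu]_x ((normc (f x) ^+ 2)%:E * h x) < +oo.
    rewrite -transfer_h//; apply: le_lt_trans Ig.
    by under [leRHS]eq_integral do rewrite nf.
  have ifh : mu.-integrable setT (fun x => (normc (f x) ^+ 2)%:E * h x).
    apply/integrableP; split; first exact: emeasurable_funM.
    by under eq_integral do rewrite gee0_abs ?mule_ge0//.
  have f0 : {ae mu, forall x, S x -> f x = 0%R}.
    have := integrable_ae measurableT ifh; apply: filterS => x /(_ I) + Sx.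
    rewrite (Sx : h x = +oo); have [f0 _|fN0] := eqVneq (f x) 0%R; first exact: f0.
    rewrite gt0_muley// lte_fin exprn_even_gt0//=.
    by apply: contra fN0 => /eqP /eq0_normc ->.
  have sf : square_integrable mu f := L2funP f.
  have sif := sqB si sf.
  have : (sqn (L2dot mu) (L2of mu i - y) < e)%R.
    have y0 : (0 <= hnorm (L2dot mu) (L2of mu i - y))%R by exact: sqrtr_ge0.
    rewrite -hnorm_sqr -(sqr_sqrtr (ltW e0)) ltr_pXn2r ?nnegrE// sqrtr_ge0//.
  rewrite yE -L2of_fun -L2ofB// -lte_fin sqn_L2of// => /ltW; apply: le_trans.
  have -> : mu (B n) = \int[mu]_x (\1_(B n) x)%:E by rewrite integral_indic// setIT.
  apply: ae_ge0_le_integralT.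
  - exact: measurable_indicE.
  - by move=> x; rewrite lee_fin.
  - by apply/measurable_EFinP/measurable_sqr_normc; case: sif.
  - by move=> x; rewrite lee_fin sqr_ge0.
  - apply: filterS f0 => x fx; rewrite lee_fin; have [xB|xB] := boolP (x \in B n); last first.
      by rewrite indicE (negbTE xB) sqr_ge0.
    rewrite fx ?subr0 ?ni//.
    by move: xB; rewrite inE => -[].
exists (\bigcup_n B n); split; first exact: bigcup_measurable.
  apply/eqP; rewrite eq_le measure_ge0 andbT.
  have mUB : measurable (\bigcup_n B n) by exact: bigcup_measurable.
  apply: (le_trans (generalized_Boole_inequality mu mB mUB)).
  by rewrite eseries0// => n _ _; exact: B0.
move=> x /= /negP; rewrite -leNgt leye_eq => /eqP hx.
have [n _ Anx] : (\bigcup_n A n) x by rewrite AT.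
by exists n.
Qed.

Hypothesis hfin : {ae mu, forall x, h x < +oo}.

Definition wcomp_derivR x : R := fine (h x).
Local Notation b := wcomp_derivR.

Lemma wcomp_derivR_ge0 x : (0 <= b x)%R.
Proof. exact: fine_ge0. Qed.

Lemma measurable_wcomp_derivR : measurable_fun setT b.
Proof. exact: measurableT_comp. Qed.

Let b0 := wcomp_derivR_ge0.
Let mb := measurable_wcomp_derivR.
Let bE0 x : 0 <= (b x)%:E. Proof. by rewrite lee_fin. Qed.
Let mbE : measurable_fun setT (fun x => (b x)%:E). Proof. exact/measurable_EFinP. Qed.

Lemma ae_wcomp_derivE : {ae mu, forall x, h x = (b x)%:E}.
Proof. by apply: filterS hfin => x hx; rewrite fineK// ge0_fin_numE. Qed.

Lemma transfer_b k : measurable_fun setT k -> (forall x, 0 <= k x) ->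
  \int[mu]_x (k (phi x) * (om x)%:E) = \int[mu]_x (k x * (b x)%:E).
Proof.
move=> mk k0; rewrite transfer_h//; apply: ae_ge0_eq_integralT.
- exact: emeasurable_funM.
- by move=> x; rewrite mule_ge0.
- exact: emeasurable_funM.
- by move=> x; rewrite mule_ge0.
- by apply: filterS ae_wcomp_derivE => x ->.
Qed.

Lemma transfer_ae (Q : X -> Prop) : {ae mu, forall x, Q x} ->
  {ae mu, forall x, w x != 0%R -> Q (phi x)}.
Proof.
move=> [N [mN N0 QN]].
have I0 : \int[mu]_(x in phi @^-1` N) (om x)%:E = 0.
  by move/null_content_dominatesP : dom => /(_ N mN N0).
have := ge0_integral_eq0_ae (mpre mN) measurable_weightE omE0 I0.
apply: filterS => x hx w0; apply: contrapT => nQ.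
by have [/eqP] := hx (QN _ nQ); rewrite weight_neq0 (negbTE w0).
Qed.

(** The preimage of the zero set of [b] has [mu_w]-measure equal to the integral of [b] over that
    zero set. This is what permits division by [b o phi]. *)
Lemma ae_derivR_phi_gt0 : {ae mu, forall x, w x != 0%R -> (0 < b (phi x))%R}.
Proof.
have mZ : measurable [set x | b x = 0%R].
  by have := mb measurableT (measurable_set1 0%R); rewrite setTI.
have I0 : \int[mu]_(x in phi @^-1` [set x | b x = 0%R]) (om x)%:E = 0.
  rewrite integral_indicM; last exact: mpre.
  rewrite (_ : (fun x => _) = (fun x => (\1_([set x | b x = 0%R]) (phi x))%:E * (om x)%:E)).
    rewrite (transfer_b (k := fun x => (\1_([set x | b x = 0%R]) x)%:E))//; last exact: measurable_indicE.
    rewrite integral0_eq// => x _; rewrite indicE.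
    by case: (boolP (_ \in _)) => [|_]; rewrite ?mul0e// inE/= => ->; rewrite mule0.
  by apply/funext => x; rewrite !indicE; congr ((_%:R)%:E * _); apply/idP/idP; rewrite !inE.
have := ge0_integral_eq0_ae (mpre mZ) measurable_weightE omE0 I0.
apply: filterS => x hx w0; rewrite lt_neqAle b0 andbT eq_sym; apply/eqP => bx.
by have [/eqP] := hx bx; rewrite weight_neq0 (negbTE w0).
Qed.

(* [E_(phi,w) f = e o phi], the equation of the conditional expectation being
   transported to [mu] along [phi]. *)
Definition cond (f e : X -> \bar R) :=
  [/\ measurable_fun setT e, forall x, 0 <= e x &
   forall D, measurable D ->
   \int[mu]_(x in phi @^-1` D) (f x * (om x)%:E) = \int[mu]_(x in D) (e x * (b x)%:E)].

Let mfom f : measurable_fun setT f -> measurable_fun setT (fun x => f x * (om x)%:E).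
Proof. by move=> mf; apply: emeasurable_funM => //; exact: measurable_weightE. Qed.

Let mfb f : measurable_fun setT f -> measurable_fun setT (fun x => f x * (b x)%:E).
Proof. by move=> mf; exact: emeasurable_funM. Qed.

Lemma transfer_cond f e k : measurable_fun setT f -> (forall x, 0 <= f x) -> cond f e ->
  measurable_fun setT k -> (forall x, 0 <= k x) ->
  \int[mu]_x (k (phi x) * (f x * (om x)%:E)) = \int[mu]_x (k x * (e x * (b x)%:E)).
Proof.
move=> mf f0 [me e0 E] mk k0; apply: integral_transfer => //.
- exact: mfom.
- by move=> x; rewrite mule_ge0.
- exact: mfb.
- by move=> x; rewrite mule_ge0.
Qed.

(** [H] is the density of the image of [f mu_w], and [e = H / b]. Where [b = 0] the inverse is [0],
    but [H] vanishes there as well, because [b o phi > 0] almost everywhere for [mu_w]. *)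
Lemma cond_exists f : measurable_fun setT f -> (forall x, 0 <= f x) ->
  exists e, cond f e.
Proof.
move=> mf f0.
have [] := @preimage_density_exists _ _ _ _ _ mu mu phi (fun x => f x * (om x)%:E).
- exact: mphi.
- exact: mfom.
- by move=> x; rewrite mule_ge0.
- move=> D mD D0.
  have I0 : \int[mu]_(x in phi @^-1` D) (om x)%:E = 0.
    by move/null_content_dominatesP : dom => /(_ D mD D0).
  apply: ae_ge0_integral_eq0; [exact: mpre|exact: mfom|by move=> x; rewrite mule_ge0|].
  apply: filterS (ge0_integral_eq0_ae (mpre mD) measurable_weightE omE0 I0) => x hx /hx ->.
  by rewrite mule0.
move=> H [mH H0 HE]; exists (fun x => H x * (b x)^-1%:E); split.
- apply: emeasurable_funM => //; apply/measurable_EFinP.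
  exact: (measurableT_comp (@measurable_invr R)).
- by move=> x; rewrite mule_ge0// lee_fin invr_ge0.
move=> D mD; rewrite HE//; apply: ae_ge0_eq_integralD => //.
- apply: emeasurable_funM => //; apply: emeasurable_funM => //; apply/measurable_EFinP.
  exact: (measurableT_comp (@measurable_invr R)).
- by move=> x; rewrite !mule_ge0// lee_fin invr_ge0.
have mZ : measurable [set x | b x = 0%R].
  by have := mb measurableT (measurable_set1 0%R); rewrite setTI.
have HZ : \int[mu]_(x in [set x | b x = 0%R]) H x = 0.
  rewrite -HE//; apply: ae_ge0_integral_eq0; [exact: mpre|exact: mfom|by move=> x; rewrite mule_ge0|].
  apply: filterS ae_derivR_phi_gt0 => x h1 /= h2.
  have [w0|/h1] := eqVneq (w x) 0%R; last by rewrite h2 ltxx.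
  by rewrite /om w0 normc0 expr0n mule0.
apply: filterS (ge0_integral_eq0_ae mZ mH H0 HZ) => x hx.
have [bx|bx] := eqVneq (b x) 0%R; first by rewrite hx// !mul0e.
by rewrite -muleA -EFinM mulVf// mule1.
Qed.

Lemma cond_unique f e e' : cond f e -> cond f e' ->
  {ae mu, forall x, e x * (b x)%:E = e' x * (b x)%:E}.
Proof.
have le f1 e1 e2 : cond f1 e1 -> cond f1 e2 ->
    {ae mu, forall x, e1 x * (b x)%:E <= e2 x * (b x)%:E}.
  move=> [m1 p1 E1] [m2 p2 E2]; apply: ae_le_of_integral.
  - exact: mfb.
  - by move=> x; rewrite mule_ge0.
  - exact: mfb.
  - by move=> x; rewrite mule_ge0.
  - by move=> D mD; rewrite -E1// E2.
move=> c1 c2; apply: filterS2 (le _ _ _ c1 c2) (le _ _ _ c2 c1) => x h1 h2.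
by apply/eqP; rewrite eq_le h1.
Qed.

Lemma cond_localize f e A : measurable A -> cond f e ->
  cond (fun x => (\1_A (phi x))%:E * f x) (fun x => (\1_A x)%:E * e x).
Proof.
move=> mA [me e0 E]; split.
- by apply: emeasurable_funM => //; exact: measurable_indicE.
- by move=> x; rewrite mule_ge0// lee_fin.
move=> D mD.
have iI : forall x, (\1_(phi @^-1` D) x * \1_A (phi x) = \1_(phi @^-1` (D `&` A)) x :> R)%R.
  by move=> x; rewrite preimage_setI indicI/= !indicE.
rewrite integral_indicM; last exact: mpre.
transitivity (\int[mu]_x ((\1_(phi @^-1` (D `&` A)) x)%:E * (f x * (om x)%:E))).
  by apply: eq_integral => x _; rewrite -iI EFinM !muleA.
rewrite -integral_indicM; last by apply: mpre; exact: measurableI.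
rewrite E; last exact: measurableI.
rewrite integral_indicM; last exact: measurableI.
rewrite [RHS]integral_indicM//; apply: eq_integral => x _.
by rewrite indicI/= EFinM !muleA.
Qed.

(** The version selected by [condexp] is measurable for preimages under [phi], hence factors through
    [phi], and its equation over [mu_w] becomes [cond]. *)
Lemma condexpP f : measurable_fun setT f -> (forall x, 0 <= f x) ->
  exists2 e, cond f e & forall x, condexp mu phi w f x = e (phi x).
Proof.
move=> mf f0; have [e ce] := cond_exists mf f0; have [me e0 eE] := ce.
have iE g D : measurable D -> measurable_fun setT g -> (forall x, 0 <= g x) ->
    \int[weighted_measure mu w]_(x in phi @^-1` D) g (phi x) = \int[mu]_(x in D) (g x * (b x)%:E).
  move=> mD mg g0; rewrite integral_weighted_measure//; last 2 first.
  - exact: mpre.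
  - exact: measurableT_comp.
  rewrite integral_indicM; last exact: mpre.
  rewrite (_ : (fun x => _) = (fun x => ((\1_D (phi x))%:E * g (phi x)) * (om x)%:E)); last first.
    by apply/funext => x; rewrite -muleA.
  rewrite (transfer_b (k := fun x => (\1_D x)%:E * g x)).
  - by rewrite [RHS]integral_indicM//; apply: eq_integral => x _; rewrite muleA.
  - by apply: emeasurable_funM => //; exact: measurable_indicE.
  - by move=> x; rewrite mule_ge0// lee_fin.
rewrite /condexp; case: xgetP => [g _ [pg g0 gE]|/(_ (e \o phi)) noex]; last first.
  exfalso; apply: noex; split.
  - move=> B mB; exists (e @^-1` B); last by rewrite setTI.
    by rewrite -[X in measurable X]setTI; exact: me.
  - by move=> x; exact: e0.
  - move=> D mD; rewrite (iE e)// integral_weighted_measure// ?eE//.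
    exact: mpre.
have [e1 me1 ge1] := preimage_measurable_factor pg.
(* Off the range of [phi] the factor [e1] may be negative, so its positive part is taken. *)
pose e2 x := maxe (e1 x) 0.
have e2E x : e2 (phi x) = g x by rewrite /e2 -ge1; apply/max_idPl.
have me2 : measurable_fun setT e2 by apply: measurable_maxe => //; exact: measurable_cst.
have e20 x : 0 <= e2 x by rewrite le_max lexx orbT.
exists e2; last by move=> x; rewrite e2E.
split=> // D mD; rewrite -(iE e2)// -integral_weighted_measure//; last exact: mpre.
by rewrite -gE// (_ : (fun x => e2 (phi x)) = g)//; apply/funext.
Qed.
End weighted_composition_measure.

(** * Conditional expectations *)

Section monotone_limits.
Local Open Scope ereal_scope.
Context d (X : measurableType d) (R : realType).

Lemma ge0_integral_le_of_cvg (mu : {measure set X -> \bar R}) (g : nat -> X -> \bar R)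
    (F : X -> \bar R) (K : \bar R) :
  (forall n, measurable_fun setT (g n)) -> (forall n x, 0 <= g n x) ->
  (forall x, {homo g ^~ x : m n / (m <= n)%N >-> m <= n}) ->
  (forall x, g n x @[n --> \oo] --> F x) ->
  (forall n, \int[mu]_x g n x <= K) -> \int[mu]_x F x <= K.
Proof.
move=> mg g0 ndg gF gK.
have H := @cvg_monotone_convergence _ _ _ mu setT measurableT g mg
  (fun n x _ => g0 n x) (fun x _ => ndg x).
have E : (fun x => limn (g ^~ x)) = F.
  by apply/funext => x; apply: cvg_lim => //; exact: gF.
rewrite /= E in H; rewrite -(cvg_lim _ H)//; apply: lime_le.
  by apply/cvg_ex; exists (\int[mu]_x F x).
exact: nearW.
Qed.

(** The truncations below use this cover, with [a] the sum of the nonnegative functions to be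
    bounded. *)
Lemma finite_sublevel_cover (mu : {sigma_finite_measure set X -> \bar R}) (a : X -> R) :
  measurable_fun setT a ->
  exists Y : (set X)^nat, [/\ forall n, measurable (Y n), forall n, mu (Y n) < +oo,
    nondecreasing_seq Y, forall x, exists n, Y n x & forall n x, Y n x -> (a x <= n%:R)%R].
Proof.
move=> ma; have [A [mA Afin ndA AT]] := sigma_finite_cover mu.
have mS n : measurable [set x | (a x <= n%:R)%R].
  rewrite (_ : [set x | _] = setT `&` a @^-1` `]-oo, n%:R]); first exact: ma.
  by apply/seteqP; split => x /=; rewrite in_itv/=; [|case].
exists (fun n => A n `&` [set x | (a x <= n%:R)%R]); split.
- by move=> n; exact: measurableI.
- move=> n; apply: le_lt_trans (Afin n); apply: le_measure; rewrite ?inE//.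
  exact: measurableI.
- move=> m n mn; apply/subsetPset => x [/= Ax ax]; split => /=.
    by have /subsetPset := ndA _ _ mn; exact.
  by rewrite (le_trans ax)// ler_nat.
- move=> x; have [n _ An] : (\bigcup_n A n) x by rewrite AT.
  exists (maxn n (Num.bound `|a x|)); split => /=.
    by have /subsetPset := ndA _ _ (leq_maxl n (Num.bound `|a x|)); exact.
  rewrite (@le_trans _ _ (Num.bound `|a x|)%:R)//; last by rewrite ler_nat leq_maxr.
  by rewrite (le_trans (ler_norm _))// ltW// archi_boundP// normr_ge0.
- by move=> n x [].
Qed.

End monotone_limits.

Section conditional_expectation.
Context d (X : measurableType d) (R : realType).
Variables (mu : {sigma_finite_measure set X -> \bar R}) (phi : X -> X) (w : X -> R[i]).
Hypotheses (mw : cmeasurable w) (mphi : measurable_fun setT phi).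
Hypothesis dom : weighted_pushforward mu phi w `<< mu.
Hypothesis hfin : {ae mu, forall x, (wcomp_deriv mu phi w x < +oo)%E}.
Local Open Scope ereal_scope.
Local Notation b := (wcomp_derivR mu phi w).
Local Notation om := (weight w).
Local Notation cond := (cond mu phi w).

Let b0 : forall x, (0 <= b x)%R := wcomp_derivR_ge0 mw mphi dom.
Let mb : measurable_fun setT b := measurable_wcomp_derivR mw mphi dom.
Let o0 : forall x, (0 <= om x)%R := weight_ge0 w.
Let mo : measurable_fun setT om := measurable_weight mw.

(* For [q = s = b ^ p] this is assertion (iv); for [q = s = 1] it always holds and
   gives the L^2 bound for conditional expectations. *)
Definition weight_pair (q s : X -> R) :=
  [/\ measurable_fun setT q /\ measurable_fun setT s, forall x, (0 <= q x)%R,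
   forall x, (0 <= s x)%R, {ae mu, forall x, w x != 0%R -> (0 < s x)%R} &
   forall k : X -> R, measurable_fun setT k -> (forall x, (0 <= k x)%R) ->
   \int[mu]_x (k (phi x) * (q (phi x) / s x) * om x)%:E <= \int[mu]_x (k x * b x)%:E].

Lemma weight_pair1 : weight_pair (fun=> 1%R) (fun=> 1%R).
Proof.
split=> //; first by apply: aeW.
move=> k mk k0; have := transfer_b mw mphi dom hfin (k := fun x => (k x)%:E).
rewrite (_ : (fun x => _) = (fun x => (k (phi x) * (1 / 1) * om x)%:E)); last first.
  by apply/funext => x; rewrite divr1 mulr1.
by move=> ->//; exact/measurable_EFinP.
Qed.

(** For a truncation [en] of [e] and [I = \int q en^2 b dmu], the argument yields
    [I <= (I + S) / 2]. The truncation makes [I] finite, so that it can be absorbed; monotone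
    convergence removes it afterwards. *)
Lemma cond_jensen q s f e : weight_pair q s -> measurable_fun setT f -> (forall x, 0 <= f x) ->
  cond f e ->
  \int[mu]_x ((q x)%:E * (e x ^+ 2 * (b x)%:E)) <= \int[mu]_x ((s x)%:E * (f x ^+ 2 * (om x)%:E)).
Proof.
move=> [[mq ms] q0 s0 sp Hqs] mf f0 ce; have [me e0 _] := ce.
set S := \int[mu]_x (_ * (f x ^+ 2 * _)).
have mqb : measurable_fun setT (fun x => q x + b x)%R by exact: measurable_funD.
have [Y [mY Yfin ndY YT Yle]] := finite_sublevel_cover mu mqb.
(* Cut at height [n] and to [Y n], where [q + b <= n]. *)
pose en n x : R := (fine (mine (e x) n%:R%:E) * \1_(Y n) x)%R.
have fn n x : mine (e x) n%:R%:E \is a fin_num.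
  rewrite ge0_fin_numE; last by rewrite le_min e0 lee_fin/=.
  by rewrite gt_min ltry orbT.
have men n : measurable_fun setT (en n).
  apply: measurable_funM; last exact: measurable_indic.
  apply: measurableT_comp => //; apply: measurable_mine => //; exact: measurable_cst.
have en0 n x : (0 <= en n x)%R.
  by rewrite mulr_ge0// fine_ge0// le_min e0 lee_fin/=.
have eni n x : (en n x <= n%:R)%R.
  rewrite /en -[leRHS]mulr1 ler_pM//; first by rewrite fine_ge0// le_min e0 lee_fin/=.
  by rewrite -lee_fin fineK// ge_min lexx orbT.
have ene n x : (en n x)%:E <= e x.
  rewrite /en EFinM fineK// indicE; case: (_ \in _); last by rewrite mule0.
  by rewrite mule1 ge_min lexx.
have nden x : {homo en ^~ x : m n / (m <= n)%N >-> (m <= n)%R}.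
  move=> m n mn; rewrite /en ler_pM//; first by rewrite fine_ge0// le_min e0 lee_fin/=.
    rewrite fine_le// le_min ge_min lexx/= ge_min; apply/orP; right.
    by rewrite lee_fin ler_nat.
  rewrite !indicE; case: (boolP (x \in Y m)) => [xm|_]; last by rewrite ler0n.
  by rewrite mem_set//; have /subsetPset := ndY _ _ mn; apply; rewrite inE in xm.
pose g n x := (q x * (en n x ^+ 2 * b x))%R.
have mg n : measurable_fun setT (g n).
  apply: measurable_funM => //; apply: measurable_funM => //; exact: measurable_funX.
have g0 n x : (0 <= g n x)%R by rewrite /g mulr_ge0// mulr_ge0// sqr_ge0.
have gfin n : \int[mu]_x (g n x)%:E < +oo.
  apply: (@le_lt_trans _ _ (\int[mu]_x ((n%:R * (n%:R ^+ 2 * n%:R))%:E * (\1_(Y n) x)%:E))).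
    apply: ge0_le_integral => //.
    - by move=> x _; rewrite lee_fin.
    - exact/measurable_EFinP.
    - by apply: emeasurable_funM; [exact: measurable_cst|exact: measurable_indicE].
    - move=> x _; rewrite lee_fin indicE; have [xY|xY] := boolP (x \in Y n); last first.
        by rewrite /g /en indicE (negbTE xY) mulr0 expr0n mul0r mulr0 mulr0.
      rewrite inE in xY; have qb := Yle _ _ xY; rewrite mulr1.
      have qn : (q x <= n%:R)%R by apply: le_trans qb; rewrite lerDl.
      have bn : (b x <= n%:R)%R by apply: le_trans qb; rewrite lerDr.
      apply: ler_pM => //; first by rewrite mulr_ge0// sqr_ge0.
      by apply: ler_pM => //; [exact: sqr_ge0|rewrite ler_pXn2r ?nnegrE].
  rewrite ge0_integralZl//.
  - rewrite integral_indic// setIT; apply: lte_mul_pinfty => //.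
    exact: Yfin.
  - exact: measurable_indicE.
have mS : measurable_fun setT (fun x => (s x)%:E * (f x ^+ 2 * (om x)%:E)).
  apply: emeasurable_funM; first exact/measurable_EFinP.
  apply: emeasurable_funM; last exact/measurable_EFinP.
  rewrite (_ : (fun x => _) = (fun x => f x * f x)); last by apply/funext => x; rewrite expe2.
  exact: emeasurable_funM.
have S0 x : 0 <= (s x)%:E * (f x ^+ 2 * (om x)%:E) by rewrite !mule_ge0 ?lee_fin// expe_ge0.
have gS n : \int[mu]_x (g n x)%:E <= S.
  (* This is [x^2 / s] times [om] for [x = (q en) o phi]; [weight_pair] with [k = q en^2] bounds its
     integral. *)
  pose A x := ((q (phi x) * en n (phi x) ^+ 2) * (q (phi x) / s x) * om x)%R.
  have mis : measurable_fun setT (fun x => (s x)^-1)%R by exact: (measurableT_comp (@measurable_invr R)).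
  have mA : measurable_fun setT A.
    apply: measurable_funM => //; apply: measurable_funM.
      by apply: measurable_funM; [|apply: measurable_funX]; exact: measurableT_comp.
    by apply: measurable_funM => //; exact: measurableT_comp.
  have A0 x : (0 <= A x)%R by rewrite /A mulr_ge0// mulr_ge0 ?divr_ge0// mulr_ge0// sqr_ge0.
  have AI : \int[mu]_x (A x)%:E <= \int[mu]_x (g n x)%:E.
    have := Hqs (fun x => q x * en n x ^+ 2)%R.
    rewrite /A /g.
    rewrite (_ : (fun x => (q x * (en n x ^+ 2 * b x))%:E) = (fun x => (q x * en n x ^+ 2 * b x)%:E)); last first.
      by apply/funext => x; rewrite mulrA.
    apply; last by move=> x; rewrite mulr_ge0// sqr_ge0.
    by apply: measurable_funM => //; exact: measurable_funX.
  have : \int[mu]_x (g n x)%:E <= 2^-1%:E * (\int[mu]_x (g n x)%:E + S).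
    apply: (@le_trans _ _ (\int[mu]_x ((q x * en n x)%:E * (e x * (b x)%:E)))).
      apply: ge0_le_integral => //.
      - by move=> x _; rewrite lee_fin.
      - exact/measurable_EFinP.
      - apply: emeasurable_funM; first by apply/measurable_EFinP; exact: measurable_funM.
        by apply: emeasurable_funM => //; exact/measurable_EFinP.
      - move=> x _; have -> : g n x = ((q x * en n x) * (en n x * b x))%R by rewrite /g; ring.
        rewrite EFinM lee_pmul//.
        + by rewrite lee_fin mulr_ge0.
        + by rewrite lee_fin mulr_ge0.
        + by rewrite EFinM lee_pmul// lee_fin.
    rewrite -(transfer_cond mw mphi dom mf f0 ce (k := fun x => (q x * en n x)%:E)); last 2 first.
    - by apply/measurable_EFinP; exact: measurable_funM.
    - by move=> x; rewrite lee_fin mulr_ge0.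
    apply: (@le_trans _ _ (\int[mu]_x (2^-1%:E * ((A x)%:E + (s x)%:E * (f x ^+ 2 * (om x)%:E))))).
      apply: ae_ge0_le_integralT.
      - apply: emeasurable_funM.
          apply/measurable_EFinP; by apply: measurable_funM; exact: measurableT_comp.
        by apply: emeasurable_funM => //; exact/measurable_EFinP.
      - by move=> x; rewrite !mule_ge0// lee_fin// mulr_ge0.
      - apply: emeasurable_funM; first exact: measurable_cst.
        by apply: emeasurable_funD => //; exact/measurable_EFinP.
      - by move=> x; rewrite mule_ge0// adde_ge0// lee_fin.
      - apply: filterS sp => x sx; have [w0|w0] := eqVneq (w x) 0%R.
          have ox : om x = 0%R by apply/eqP; rewrite weight_neq0 w0.
          by rewrite /A ox !mule0 mulr0 adde0 mule0.
        have {}sx := sx w0.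
        have ox : (0 < om x)%R by rewrite lt_neqAle o0 andbT eq_sym weight_neq0.
        (* If [f x] is infinite so is the right side, as [s x] and [om x] are positive here. *)
        have := f0 x; case: (f x) => [r| |]// r0; last first.
          rewrite [leRHS](_ : _ = +oo) ?leey// expe2 mulyy gt0_mulye ?lte_fin//.
          by rewrite gt0_muley ?lte_fin// addey// gt0_muley// lte_fin invr_gt0.
        rewrite [leRHS](_ : _ = (2^-1 * (A x + s x * (r * r * om x)))%:E)//.
        rewrite -!EFinM lee_fin /A.
        set Q := q _; set V := en _ _.
        have : (0 <= (Q * V / s x - r) ^+ 2 * (s x * om x))%R.
          by rewrite mulr_ge0 ?sqr_ge0// mulr_ge0// ltW.
        have -> : ((Q * V / s x - r) ^+ 2 * (s x * om x) =
          Q * V ^+ 2 * (Q / s x) * om x + s x * (r * r * om x) - 2 * (Q * V * (r * om x)))%R.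
          by field; rewrite gt_eqF.
        lra.
    rewrite ge0_integralZl//.
    + rewrite lee_pmul2l ?lte_fin ?invr_gt0// ge0_integralD//.
      * by rewrite leeD2r.
      * by move=> x _; rewrite lee_fin.
      * exact/measurable_EFinP.
    + by apply: emeasurable_funD => //; exact/measurable_EFinP.
    + by move=> x _; rewrite adde_ge0// lee_fin.
  have := gfin n; have : 0 <= \int[mu]_x (g n x)%:E by apply: integral_ge0 => x _; rewrite lee_fin.
  have : 0 <= S by apply: integral_ge0.
  move: S => [v| |]//; last by move=> *; rewrite leey.
  case: (\int[mu]_x _) => [u| |]// _ _ _; rewrite -EFinD -EFinM !lee_fin; lra.
apply: (@ge0_integral_le_of_cvg _ _ _ mu (fun n x => (g n x)%:E)) => //.
- by move=> n; exact/measurable_EFinP.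
- by move=> x m n mn; rewrite lee_fin /g ler_wpM2l// ler_wpM2r// ler_pXn2r ?nnegrE// nden.
- move=> x; have [n0 Yn0] := YT x.
  have Yn n : (n0 <= n)%N -> x \in Y n.
    by move=> nn; rewrite inE; have /subsetPset := ndY _ _ nn; exact.
  have := e0 x; case ex : (e x) => [r| |]// r0.
    apply: cvg_near_cst; near=> n.
    rewrite /g /en ex indicE Yn; last by near: n; exact: nbhs_infty_ge.
    rewrite (min_idPl _) ?mulr1//= ?expe2 -?EFinM//.
    by rewrite lee_fin; near: n; exact: nbhs_infty_ger.
  rewrite expe2 mulyy.
  (* Here [e x = +oo]: a vanishing factor gives [0] along the whole sequence, and otherwise [g n x]
     grows like [n^2]. *)
  have [qx|qx] := eqVneq (q x) 0%R.
    by rewrite /g qx mul0e; under eq_fun do rewrite mul0r; exact: cvg_cst.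
  have [bx|bx] := eqVneq (b x) 0%R.
    by rewrite /g bx !mule0; under eq_fun do rewrite !mulr0; exact: cvg_cst.
  have qp : (0 < q x)%R by rewrite lt_neqAle eq_sym qx q0.
  have bp : (0 < b x)%R by rewrite lt_neqAle eq_sym bx b0.
  rewrite gt0_mulye ?lte_fin// gt0_muley ?lte_fin//; apply/cvgeyPge => A.
  near=> n; rewrite lee_fin /g /en ex indicE Yn; last by near: n; exact: nbhs_infty_ge.
  rewrite (min_idPr _) ?leey//= mulr1.
  have n1 : (1 <= n%:R :> R)%R by near: n; exact: nbhs_infty_ger.
  have nA : (A / (q x * b x) <= n%:R)%R by near: n; exact: nbhs_infty_ger.
  rewrite ler_pdivrMr ?mulr_gt0// in nA.
  rewrite (le_trans nA)// [leRHS](_ : _ = n%:R ^+ 2 * (q x * b x))%R; last by ring.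
  by rewrite ler_wpM2r ?mulr_ge0// expr2 ler_peMl.
Unshelve. all: by end_near.
Qed.
End conditional_expectation.

Section signed_integrals.
Local Open Scope ereal_scope.
Context d (X : measurableType d) (R : realType) (mu : {measure set X -> \bar R}).
Implicit Types (a f u v : X -> R).

Lemma ge0_integrable u : measurable_fun setT u -> (forall x, (0 <= u x)%R) ->
  \int[mu]_x (u x)%:E < +oo -> mu.-integrable setT (fun x => (u x)%:E).
Proof.
move=> mu0 u0 Iu; apply/integrableP; split; first exact/measurable_EFinP.
by under eq_integral do rewrite gee0_abs ?lee_fin//.
Qed.

Lemma integrable_ge0_dom u v : measurable_fun setT u -> measurable_fun setT v ->
  (forall x, (`|u x| <= v x)%R) -> \int[mu]_x (v x)%:E < +oo ->
  mu.-integrable setT (fun x => (u x)%:E).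
Proof.
move=> mu0 mv uv Iv; have v0 x : (0 <= v x)%R by apply: le_trans (uv x).
apply: le_integrable (ge0_integrable mv v0 Iv) => //; first exact/measurable_EFinP.
by move=> x _ /=; rewrite lee_fin (ger0_norm (v0 x)).
Qed.

Lemma le_integral_lty u v : measurable_fun setT u -> (forall x, (0 <= u x)%R) ->
  measurable_fun setT v -> (forall x, (u x <= v x)%R) -> \int[mu]_x (v x)%:E < +oo ->
  \int[mu]_x (u x)%:E < +oo.
Proof.
move=> mu0 u0 mv uv; apply: le_lt_trans; apply: ge0_le_integral => //.
- by move=> x _; rewrite lee_fin.
- exact/measurable_EFinP.
- exact/measurable_EFinP.
- by move=> x _; rewrite lee_fin.
Qed.

Lemma integralD_lty u v : measurable_fun setT u -> (forall x, (0 <= u x)%R) ->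
  measurable_fun setT v -> (forall x, (0 <= v x)%R) ->
  \int[mu]_x (u x)%:E < +oo -> \int[mu]_x (v x)%:E < +oo ->
  \int[mu]_x (u x + v x)%:E < +oo.
Proof.
move=> mu0 u0 mv v0 Iu Iv; under eq_integral do rewrite EFinD.
rewrite ge0_integralD//.
- by rewrite lte_add_pinfty.
- by move=> x _; rewrite lee_fin.
- exact/measurable_EFinP.
- by move=> x _; rewrite lee_fin.
- exact/measurable_EFinP.
Qed.

(** Serves the four products of the positive and negative parts of two signed functions. *)
Lemma integral_diff4 (u v u' v' : X -> R) :
  measurable_fun setT u /\ measurable_fun setT v ->
  measurable_fun setT u' /\ measurable_fun setT v' ->
  (forall x, (0 <= u x)%R) -> (forall x, (0 <= v x)%R) ->
  (forall x, (0 <= u' x)%R) -> (forall x, (0 <= v' x)%R) ->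
  \int[mu]_x (u x)%:E < +oo -> \int[mu]_x (v x)%:E < +oo ->
  \int[mu]_x (u' x)%:E < +oo -> \int[mu]_x (v' x)%:E < +oo ->
  \int[mu]_x (u x + v x - (u' x + v' x))%:E =
  \int[mu]_x (u x)%:E + \int[mu]_x (v x)%:E - (\int[mu]_x (u' x)%:E + \int[mu]_x (v' x)%:E).
Proof.
move=> [m1 m2] [m3 m4] p1 p2 p3 p4 I1 I2 I3 I4.
have i1 := ge0_integrable m1 p1 I1; have i2 := ge0_integrable m2 p2 I2.
have i3 := ge0_integrable m3 p3 I3; have i4 := ge0_integrable m4 p4 I4.
under eq_integral do rewrite EFinB !EFinD.
rewrite integralB//; [|exact: integrableD..].
by rewrite !integralD.
Qed.

Lemma integral_pos_neg (g : X -> R) (D : set X) :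
  \int[mu]_(x in D) (g x)%:E =
  \int[mu]_(x in D) (Num.max (g x) 0)%:E - \int[mu]_(x in D) (Num.max (- g x) 0)%:E.
Proof.
by rewrite integralE; congr (_ - _); apply: eq_integral => x _;
  rewrite ?funeposE ?funenegE -?EFinN EFin_max.
Qed.

End signed_integrals.

Section real_conditional_expectation.
Context d (X : measurableType d) (R : realType).
Variables (mu : {sigma_finite_measure set X -> \bar R}) (phi : X -> X) (w : X -> R[i]).
Hypotheses (mw : cmeasurable w) (mphi : measurable_fun setT phi).
Hypothesis dom : weighted_pushforward mu phi w `<< mu.
Hypothesis hfin : {ae mu, forall x, (wcomp_deriv mu phi w x < +oo)%E}.
Local Open Scope ereal_scope.
Local Notation b := (wcomp_derivR mu phi w).
Local Notation om := (weight w).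
Local Notation cond := (cond mu phi w).
Local Notation weight_pair := (weight_pair mu phi w).
Implicit Types (a f c : X -> R).

Let b0 : forall x, (0 <= b x)%R := wcomp_derivR_ge0 mw mphi dom.
Let mb : measurable_fun setT b := measurable_wcomp_derivR mw mphi dom.
Let o0 : forall x, (0 <= om x)%R := weight_ge0 w.
Let mo : measurable_fun setT om := measurable_weight mw.

Let mphiT (f : X -> R) : measurable_fun setT f -> measurable_fun setT (fun x => f (phi x)).
Proof. by move=> mf; exact: measurableT_comp. Qed.

Let msq (f g : X -> R) : measurable_fun setT f -> measurable_fun setT g ->
  measurable_fun setT (fun x => f x ^+ 2 * g x)%R.
Proof. by move=> mf mg; apply: measurable_funM => //; exact: measurable_funX. Qed.

Lemma jensen1 (f a : X -> R) :
  (forall q s, weight_pair q s ->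
   \int[mu]_x (q x * (a x ^+ 2 * b x))%:E <= \int[mu]_x (s x * (f x ^+ 2 * om x))%:E) ->
  \int[mu]_x (f x ^+ 2 * om x)%:E < +oo -> \int[mu]_x (a x ^+ 2 * b x)%:E < +oo.
Proof.
move=> /(_ _ _ (weight_pair1 mw mphi dom hfin)) J.
apply: le_lt_trans; under [leLHS]eq_integral do rewrite -[X in X%:E]mul1r.
by under [leRHS]eq_integral do rewrite -[X in X%:E]mul1r.
Qed.

(** The bound for [q = s = 1] makes [e^2 b] integrable. Hence [e] is finite almost everywhere on
    [b > 0], and [fine] loses nothing next to the factor [b]. *)
Lemma jensen_fine (f : X -> R) e : measurable_fun setT f -> (forall x, (0 <= f x)%R) ->
  \int[mu]_x (f x ^+ 2 * om x)%:E < +oo -> cond (EFin \o f) e ->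
  {ae mu, forall x, e x * (b x)%:E = (fine (e x) * b x)%:E} /\
  forall q s, weight_pair q s ->
   \int[mu]_x (q x * (fine (e x) ^+ 2 * b x))%:E <= \int[mu]_x (s x * (f x ^+ 2 * om x))%:E.
Proof.
move=> mf f0 If ce; have [me e0 _] := ce.
have mfE : measurable_fun setT (EFin \o f) by exact/measurable_EFinP.
have f0E x : 0 <= (EFin \o f) x by rewrite lee_fin.
have J q s (qs : weight_pair q s) := cond_jensen mw mphi dom qs mfE f0E ce.
have me2 : measurable_fun setT (fun x => e x ^+ 2 * (b x)%:E).
  apply: emeasurable_funM; last exact/measurable_EFinP.
  rewrite (_ : (fun x => _) = (fun x => e x * e x)); last by apply/funext => x; rewrite expe2.
  exact: emeasurable_funM.
have eb : {ae mu, forall x, e x * (b x)%:E = (fine (e x) * b x)%:E}.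
  have I1 : mu.-integrable setT (fun x => e x ^+ 2 * (b x)%:E).
    apply/integrableP; split => //.
    under eq_integral do rewrite gee0_abs ?mule_ge0 ?expe_ge0 ?lee_fin//.
    apply: le_lt_trans If.
    have := J _ _ (weight_pair1 mw mphi dom hfin).
    by congr (_ <= _); apply: eq_integral => x _; rewrite mul1e// expe2.
  have := integrable_ae measurableT I1; apply: filterS => x /(_ I).
  have := e0 x; case: (e x) => [r| |]// _; rewrite ?EFinM//=.
  have [->|bx] := eqVneq (b x) 0%R; first by rewrite !mule0.
  by rewrite mulyy gt0_mulye// lte_fin lt_neqAle eq_sym bx b0.
split=> // q s qs; have [[mq ms] q0 s0 _ _] := qs.
apply: le_trans (J _ _ qs).
rewrite le_eqVlt; apply/orP; left; apply/eqP; apply: ae_ge0_eq_integralT.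
- apply/measurable_EFinP; apply: measurable_funM => //; apply: msq => //.
  exact: measurableT_comp.
- by move=> x; rewrite lee_fin mulr_ge0// mulr_ge0 ?sqr_ge0.
- by apply: emeasurable_funM => //; exact/measurable_EFinP.
- by move=> x; rewrite mule_ge0 ?lee_fin// mule_ge0 ?expe_ge0 ?lee_fin.
- apply: filterS eb => x ebx; rewrite expe2 -muleA ebx.
  have [bx|bx] := eqVneq (b x) 0%R; first by rewrite bx !mulr0 !mule0.
  have -> : e x = (fine (e x))%:E.
    move: ebx; have := e0 x; case: (e x) => [r| |]// _.
    by rewrite gt0_mulye// lte_fin lt_neqAle eq_sym bx b0.
  by rewrite -!EFinM; congr EFin => /=; ring.
Qed.

Lemma cond_nneg_exists f : measurable_fun setT f -> (forall x, (0 <= f x)%R) ->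
  \int[mu]_x (f x ^+ 2 * om x)%:E < +oo ->
  exists a : X -> R, [/\ measurable_fun setT a, forall x, (0 <= a x)%R,
    forall c : X -> R, measurable_fun setT c -> (forall x, (0 <= c x)%R) ->
      \int[mu]_x (c (phi x) * (f x * om x))%:E = \int[mu]_x (c x * (a x * b x))%:E &
    forall q s, weight_pair q s ->
      \int[mu]_x (q x * (a x ^+ 2 * b x))%:E <= \int[mu]_x (s x * (f x ^+ 2 * om x))%:E].
Proof.
move=> mf f0 If.
have mfE : measurable_fun setT (EFin \o f) by exact/measurable_EFinP.
have f0E x : 0 <= (EFin \o f) x by rewrite lee_fin.
have [e ce] := cond_exists mw mphi dom hfin mfE f0E; have [me e0 _] := ce.
have [eb J] := jensen_fine mf f0 If ce.
have ma : measurable_fun setT (fun x => fine (e x)) by exact: measurableT_comp.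
exists (fun x => fine (e x)); split=> //.
  by move=> x; rewrite fine_ge0.
move=> c mc c0.
have := transfer_cond mw mphi dom mfE f0E ce (k := fun x => (c x)%:E).
have -> : \int[mu]_x ((c (phi x))%:E * ((EFin \o f) x * (om x)%:E)) =
  \int[mu]_x (c (phi x) * (f x * om x))%:E by [].
move=> ->; [|exact/measurable_EFinP|by []].
apply: ae_ge0_eq_integralT.
- apply: emeasurable_funM; first exact/measurable_EFinP.
  by apply: emeasurable_funM => //; exact/measurable_EFinP.
- by move=> x; rewrite !mule_ge0 ?lee_fin.
- by apply/measurable_EFinP; apply: measurable_funM => //; exact: measurable_funM.
- by move=> x; rewrite lee_fin mulr_ge0// mulr_ge0// fine_ge0.
- by apply: filterS eb => x ->.
Qed.

Lemma max0B (r : R) : (r = Num.max r 0 - Num.max (- r) 0)%R.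
Proof.
have [h|h] := leP 0%R r; first by rewrite max_r ?subr0// oppr_le0.
by rewrite max_l ?sub0r ?opprK// oppr_ge0 ltW.
Qed.

Lemma max0_sqr (r : R) : (Num.max r 0 ^+ 2 + Num.max (- r) 0 ^+ 2 = r ^+ 2)%R.
Proof.
have [h|h] := leP 0%R r; first by rewrite max_r ?expr0n ?addr0// oppr_le0.
by rewrite max_l ?expr0n ?add0r ?sqrrN// oppr_ge0 ltW.
Qed.

Lemma max0_sqr_le (r : R) : (Num.max r 0 ^+ 2 <= r ^+ 2)%R.
Proof. by rewrite -(max0_sqr r) lerDl sqr_ge0. Qed.

Let mmax (f : X -> R) : measurable_fun setT f ->
  measurable_fun setT (fun x => Num.max (f x) 0)%R.
Proof. by move=> mf; apply: measurable_maxr => //; exact: measurable_cst. Qed.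

Let max0 (r : R) : (0 <= Num.max r 0)%R. Proof. by rewrite le_max lexx orbT. Qed.

(* [E_(phi,w) f = a o phi] in weak form, for a signed square integrable [f]. *)
Definition cpair (f a : X -> R) := forall c : X -> R, measurable_fun setT c ->
  \int[mu]_x (c x ^+ 2 * b x)%:E < +oo ->
  \int[mu]_x (c (phi x) * (f x * om x))%:E = \int[mu]_x (c x * (a x * b x))%:E.

(** The two signed parts are treated separately without losing a constant:
    [(a1 - a2)^2 <= a1^2 + a2^2] for nonnegative [a1] and [a2], and the squares of the parts of [f]
    add up to [f^2]. *)
Lemma cond_real_exists f : measurable_fun setT f ->
  \int[mu]_x (f x ^+ 2 * om x)%:E < +oo ->
  exists a : X -> R, [/\ measurable_fun setT a, cpair f a &
    forall q s, weight_pair q s ->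
      \int[mu]_x (q x * (a x ^+ 2 * b x))%:E <= \int[mu]_x (s x * (f x ^+ 2 * om x))%:E].
Proof.
move=> mf If.
pose pos (g : X -> R) x := Num.max (g x) 0%R.
pose neg (g : X -> R) x := Num.max (- g x)%R 0%R.
have mpos g : measurable_fun setT g -> measurable_fun setT (pos g) by exact: mmax.
have mneg g : measurable_fun setT g -> measurable_fun setT (neg g).
  by move=> mg; apply: mmax; exact: measurable_funN.
have pos0 g x : (0 <= pos g x)%R by exact: max0.
have neg0 g x : (0 <= neg g x)%R by exact: max0.
have gE g x : (g x = pos g x - neg g x)%R by exact: max0B.
have possq (g v : X -> R) : measurable_fun setT g -> measurable_fun setT v -> (forall x, (0 <= v x)%R) ->
    \int[mu]_x (g x ^+ 2 * v x)%:E < +oo -> \int[mu]_x (pos g x ^+ 2 * v x)%:E < +oo.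
  move=> mg mv v0; apply: le_integral_lty.
  - exact: msq (mpos _ mg) mv.
  - by move=> x; rewrite mulr_ge0 ?sqr_ge0.
  - exact: msq.
  - by move=> x; rewrite ler_wpM2r// max0_sqr_le.
have negsq (g v : X -> R) : measurable_fun setT g -> measurable_fun setT v -> (forall x, (0 <= v x)%R) ->
    \int[mu]_x (g x ^+ 2 * v x)%:E < +oo -> \int[mu]_x (neg g x ^+ 2 * v x)%:E < +oo.
  move=> mg mv v0 Ig; apply: (possq (fun x => - g x)%R) => //; first exact: measurable_funN.
  by under eq_integral do rewrite sqrrN.
have [a1 [ma1 a10 E1 J1]] := cond_nneg_exists (mpos _ mf) (pos0 f) (possq _ _ mf mo o0 If).
have [a2 [ma2 a20 E2 J2]] := cond_nneg_exists (mneg _ mf) (neg0 f) (negsq _ _ mf mo o0 If).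
exists (fun x => a1 x - a2 x)%R; split; first exact: measurable_funB.
- move=> c mc Ic.
  have fin1 (g a : X -> R) : measurable_fun setT g -> (forall x, (0 <= g x)%R) ->
      measurable_fun setT a -> (forall x, (0 <= a x)%R) ->
      \int[mu]_x (g x ^+ 2 * b x)%:E < +oo ->
      \int[mu]_x (a x ^+ 2 * b x)%:E < +oo -> \int[mu]_x (g x * (a x * b x))%:E < +oo.
    move=> mg g0 ma a0 Ig Ia.
    apply: (@le_integral_lty _ _ _ _ _ (fun x => g x ^+ 2 * b x + a x ^+ 2 * b x)%R).
    - by apply: measurable_funM => //; exact: measurable_funM.
    - by move=> x; rewrite !mulr_ge0.
    - by apply: measurable_funD; exact: msq.
    - move=> x; rewrite mulrA -mulrDl ler_wpM2r//.
      by have := sqr_ge0 (g x - a x); have := sqr_ge0 (g x + a x); lra.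
    - by apply: integralD_lty => //; try exact: msq; move=> x; rewrite mulr_ge0 ?sqr_ge0.
  have Ia1 := jensen1 J1 (possq _ _ mf mo o0 If).
  have Ia2 := jensen1 J2 (negsq _ _ mf mo o0 If).
  have Ic1 := possq _ _ mc mb b0 Ic; have Ic2 := negsq _ _ mc mb b0 Ic.
  have mM (u v t : X -> R) : measurable_fun setT u -> measurable_fun setT v ->
      measurable_fun setT t -> measurable_fun setT (fun x => u x * (v x * t x))%R.
    by move=> *; apply: measurable_funM => //; exact: measurable_funM.
  transitivity (\int[mu]_x (pos c (phi x) * (pos f x * om x) + neg c (phi x) * (neg f x * om x) -
     (pos c (phi x) * (neg f x * om x) + neg c (phi x) * (pos f x * om x)))%:E).
    by apply: eq_integral => x _; congr EFin; rewrite {1}(gE c) {1}(gE f); ring.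
  transitivity (\int[mu]_x (pos c x * (a1 x * b x) + neg c x * (a2 x * b x) -
     (pos c x * (a2 x * b x) + neg c x * (a1 x * b x)))%:E); last first.
    by apply: eq_integral => x _; congr EFin; rewrite [in RHS](gE c); ring.
  have mc1 := mphiT (mpos _ mc); have mc2 := mphiT (mneg _ mc).
  have [mf1 mf2] := (mpos _ mf, mneg _ mf).
  have [mp mn] := (mpos _ mc, mneg _ mc).
  rewrite integral_diff4//; try (by split; exact: mM); try (by move=> x; apply: mulr_ge0; rewrite ?pos0 ?neg0// mulr_ge0 ?pos0 ?neg0); last 4 first.
  - by rewrite E1//; exact: fin1.
  - by rewrite E2//; exact: fin1.
  - by rewrite E2//; exact: fin1.
  - by rewrite E1//; exact: fin1.
  rewrite E1// E2// E2// E1// integral_diff4//; try (by split; exact: mM);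
    try (by move=> x; apply: mulr_ge0; rewrite ?pos0 ?neg0// mulr_ge0 ?pos0 ?neg0); exact: fin1.
- move=> q s qs; have [[mq ms] q0 s0 _ _] := qs.
  apply: (@le_trans _ _ (\int[mu]_x ((q x * (a1 x ^+ 2 * b x))%:E + (q x * (a2 x ^+ 2 * b x))%:E))).
    apply: ge0_le_integral => //.
    - by move=> x _; rewrite lee_fin mulr_ge0// mulr_ge0 ?sqr_ge0.
    - apply/measurable_EFinP; apply: measurable_funM => //; apply: msq => //.
      exact: measurable_funB.
    - by apply: emeasurable_funD; apply/measurable_EFinP; apply: measurable_funM => //; exact: msq.
    - move=> x _; rewrite -EFinD lee_fin -mulrDr ler_wpM2l// -mulrDl ler_wpM2r//.
      have : (0 <= a1 x * a2 x)%R by rewrite mulr_ge0.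
      by rewrite sqrrB; lra.
  rewrite ge0_integralD//; last 4 first.
  - by move=> x _; rewrite lee_fin mulr_ge0// mulr_ge0 ?sqr_ge0.
  - by apply/measurable_EFinP; apply: measurable_funM => //; exact: msq.
  - by move=> x _; rewrite lee_fin mulr_ge0// mulr_ge0 ?sqr_ge0.
  - by apply/measurable_EFinP; apply: measurable_funM => //; exact: msq.
  apply: (le_trans (leeD (J1 _ _ qs) (J2 _ _ qs))).
  rewrite -ge0_integralD//; last 4 first.
  - by move=> x _; rewrite lee_fin mulr_ge0// mulr_ge0 ?sqr_ge0.
  - by apply/measurable_EFinP; apply: measurable_funM => //; apply: msq => //; exact: mpos.
  - by move=> x _; rewrite lee_fin mulr_ge0// mulr_ge0 ?sqr_ge0.
  - by apply/measurable_EFinP; apply: measurable_funM => //; apply: msq => //; exact: mneg.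
  rewrite le_eqVlt; apply/orP; left; apply/eqP; apply: eq_integral => x _.
  by rewrite -EFinD; congr EFin; rewrite -mulrDr -mulrDl max0_sqr.
Qed.

(** The test sets are those where [a' < a], cut down to where [b] has finite integral. The
    hypothesis speaks of [fine] because [is_condexpC] equates values of [cintegral]; the square
    bounds make the integrals finite. *)
Lemma cond_real_le a a' : measurable_fun setT a -> measurable_fun setT a' ->
  \int[mu]_x (a x ^+ 2 * b x)%:E < +oo -> \int[mu]_x (a' x ^+ 2 * b x)%:E < +oo ->
  (forall D, measurable D -> \int[mu]_(x in D) (b x)%:E < +oo ->
    fine (\int[mu]_(x in D) (a x * b x)%:E) = fine (\int[mu]_(x in D) (a' x * b x)%:E)) ->
  {ae mu, forall x, (a x * b x <= a' x * b x)%R}.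
Proof.
move=> ma ma' Ia Ia' H.
have [Y [mY Yfin ndY YT Yle]] := finite_sublevel_cover mu mb.
pose D n := Y n `&` [set x | (a' x < a x)%R].
have mD n : measurable (D n).
  apply: measurableI => //.
  have -> : [set x | (a' x < a x)%R] = (fun x => a x - a' x)%R @^-1` `]0%R, +oo[.
    by apply/seteqP; split => x /=; rewrite in_itv/= andbT subr_gt0.
  by apply: measurable_preimageT => //; exact: measurable_funB.
have Dfin n : \int[mu]_(x in D n) (b x)%:E < +oo.
  apply: (@le_lt_trans _ _ (n%:R%:E * mu (Y n))); last first.
    by apply: lte_mul_pinfty => //; exact: Yfin.
  apply: (@le_trans _ _ (\int[mu]_(x in D n) n%:R%:E)).
    apply: ge0_le_integral => //.
    - by move=> x _; rewrite lee_fin.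
    - by apply: measurable_funTS; exact/measurable_EFinP.
    - by move=> x [/Yle h _]; rewrite lee_fin.
  rewrite integral_cst// lee_wpmul2l//; apply: le_measure; rewrite ?inE//; exact: subIsetl.
have J n (c : X -> R) : measurable_fun setT c -> \int[mu]_x (c x ^+ 2 * b x)%:E < +oo ->
    mu.-integrable (D n) (fun x => (c x * b x)%:E).
  move=> mc Ic; have mcb : measurable_fun setT (fun x => c x * b x)%R by exact: measurable_funM.
  apply/integrableP; split; first by apply: measurable_funTS; exact/measurable_EFinP.
  have m1 : measurable_fun setT (fun x => (c x ^+ 2 * b x)%:E) by apply/measurable_EFinP; exact: msq.
  have m2 : measurable_fun setT (fun x => (b x)%:E) by exact/measurable_EFinP.
  apply: (@le_lt_trans _ _ (\int[mu]_(x in D n) ((c x ^+ 2 * b x)%:E + (b x)%:E))).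
    apply: ge0_le_integral => //.
    - by apply: measurable_funTS; apply: measurableT_comp => //; exact/measurable_EFinP.
    - by apply: measurable_funTS; exact: emeasurable_funD.
    - move=> x _; rewrite /= -EFinD lee_fin normrM (ger0_norm (b0 x)) -{3}[b x]mul1r -mulrDl.
      rewrite ler_wpM2r// ler_norml; have := sqr_ge0 (c x - 1); have := sqr_ge0 (c x + 1).
      by move=> h1 h2; apply/andP; split; nra.
  rewrite ge0_integralD//; try (by exact: measurable_funTS).
  - apply: lte_add_pinfty => //; apply: le_lt_trans Ic; apply: ge0_subset_integral => //.
    by move=> x _; rewrite lee_fin mulr_ge0 ?sqr_ge0.
  - by move=> x _; rewrite lee_fin mulr_ge0 ?sqr_ge0.
  - by move=> x _; rewrite lee_fin.
have aeD n : {ae mu, forall x, D n x -> (a x - a' x) * b x = 0}%R.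
  have i1 := J n _ ma Ia; have i2 := J n _ ma' Ia'.
  have E : \int[mu]_(x in D n) ((Num.max (a x - a' x) 0 * b x)%:E) = 0.
    transitivity (\int[mu]_(x in D n) ((a x * b x)%:E - (a' x * b x)%:E)).
      apply: eq_integral => x; rewrite inE => -[_ /= h].
      by rewrite -EFinB -mulrBl max_l// subr_ge0 ltW.
    rewrite integralB//.
    rewrite -(fineK (integrable_fin_num (mD n) i1)) -(fineK (integrable_fin_num (mD n) i2)).
    by rewrite H// subee.
  have := ge0_integral_eq0_ae (mD n) _ _ E.
  have mE : measurable_fun setT (fun x => (Num.max (a x - a' x) 0 * b x)%:E).
    by apply/measurable_EFinP; apply: measurable_funM => //; apply: mmax; exact: measurable_funB.
  move=> /(_ mE) H1; apply: filterS (H1 _).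
    move=> x h Dx; have [/eqP] := h Dx; rewrite max_l; first by move=> /eqP.
    by rewrite subr_ge0 ltW//; case: Dx.
  by move=> x; rewrite lee_fin mulr_ge0.
apply: filterS (ae_foralln aeD) => x h; rewrite leNgt; apply/negP => lt.
have aa : (a' x < a x)%R by rewrite ltNge; apply/negP => le; move: lt; rewrite ltNge ler_wpM2r.
have [n Yn] := YT x; have := h n (conj Yn aa).
by move: lt; rewrite -subr_gt0 -mulrBl => + E; rewrite E ltxx.
Qed.

Lemma cond_real_unique a a' : measurable_fun setT a -> measurable_fun setT a' ->
  \int[mu]_x (a x ^+ 2 * b x)%:E < +oo -> \int[mu]_x (a' x ^+ 2 * b x)%:E < +oo ->
  (forall D, measurable D -> \int[mu]_(x in D) (b x)%:E < +oo ->
    fine (\int[mu]_(x in D) (a x * b x)%:E) = fine (\int[mu]_(x in D) (a' x * b x)%:E)) ->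
  {ae mu, forall x, (a x * b x = a' x * b x)%R}.
Proof.
move=> ma ma' Ia Ia' H.
have H' D : measurable D -> \int[mu]_(x in D) (b x)%:E < +oo ->
    fine (\int[mu]_(x in D) (a' x * b x)%:E) = fine (\int[mu]_(x in D) (a x * b x)%:E).
  by move=> mD DI; rewrite H.
apply: filterS2 (cond_real_le ma ma' Ia Ia' H) (cond_real_le ma' ma Ia' Ia H') => x h1 h2.
by apply/eqP; rewrite eq_le h1 h2.
Qed.

End real_conditional_expectation.

Section complex_conditional_expectation.
Context d (X : measurableType d) (R : realType).
Variables (mu : {sigma_finite_measure set X -> \bar R}) (phi : X -> X) (w : X -> R[i]).
Hypotheses (mw : cmeasurable w) (mphi : measurable_fun setT phi).
Hypothesis dom : weighted_pushforward mu phi w `<< mu.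
Hypothesis hfin : {ae mu, forall x, (wcomp_deriv mu phi w x < +oo)%E}.
Local Open Scope ereal_scope.
Local Notation b := (wcomp_derivR mu phi w).
Local Notation om := (weight w).
Local Notation weight_pair := (weight_pair mu phi w).
Local Notation cpair := (cpair mu phi w).
Implicit Types (a c g : X -> R) (f kap : X -> R[i]).

Let b0 : forall x, (0 <= b x)%R := wcomp_derivR_ge0 mw mphi dom.
Let mb : measurable_fun setT b := measurable_wcomp_derivR mw mphi dom.
Let o0 : forall x, (0 <= om x)%R := weight_ge0 w.
Let mo : measurable_fun setT om := measurable_weight mw.
Let mpre D : measurable D -> measurable (phi @^-1` D).
Proof. exact: measurable_preimageT. Qed.

Let mmax g : measurable_fun setT g -> measurable_fun setT (fun x => (Num.max (g x) 0)%:E).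
Proof. by move=> mg; apply/measurable_EFinP/measurable_maxr => //; exact: measurable_cst. Qed.

Let mnmax g : measurable_fun setT g -> measurable_fun setT (fun x => (Num.max (- g x) 0)%:E).
Proof. by move=> mg; apply: (mmax (g := fun x => (- g x)%R)); exact: measurable_funN. Qed.

Let max0 (r : R) : 0 <= (Num.max r 0)%:E. Proof. by rewrite lee_fin le_max lexx orbT. Qed.

Let max_om (r t : R) : (0 <= t)%R ->
  (Num.max (r * t) 0 = Num.max r 0 * t)%R /\ (Num.max (- (r * t)) 0 = Num.max (- r) 0 * t)%R.
Proof. by move=> t0; rewrite -mulNr !maxr_pMl// !mul0r. Qed.

Lemma integral_weighted_measureR D g : measurable D -> measurable_fun setT g ->
  \int[weighted_measure mu w]_(x in D) (g x)%:E = \int[mu]_(x in D) (g x * om x)%:E.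
Proof.
move=> mD mg; have [nu nuE] := weighted_measureE mu mw.
transitivity (\int[nu]_(x in D) (g x)%:E); first by apply: eq_raw_integral => A mA; rewrite nuE.
rewrite integral_pos_neg [RHS]integral_pos_neg; congr (_ - _).
- transitivity (\int[weighted_measure mu w]_(x in D) (Num.max (g x) 0)%:E).
    by apply: eq_raw_integral => A mA; rewrite nuE.
  rewrite integral_weighted_measure//; last exact: mmax.
  by apply: eq_integral => x _; rewrite (max_om _ _).1.
- transitivity (\int[weighted_measure mu w]_(x in D) (Num.max (- g x) 0)%:E).
    by apply: eq_raw_integral => A mA; rewrite nuE.
  rewrite integral_weighted_measure//; last exact: mnmax.
  by apply: eq_integral => x _; rewrite (max_om _ _).2.
Qed.

Lemma transfer_bD D (k : X -> \bar R) : measurable D -> measurable_fun setT k -> (forall x, 0 <= k x) ->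
  \int[mu]_(x in phi @^-1` D) (k (phi x) * (om x)%:E) = \int[mu]_(x in D) (k x * (b x)%:E).
Proof.
move=> mD mk k0; rewrite integral_indicM; last exact: mpre.
rewrite [RHS]integral_indicM//.
transitivity (\int[mu]_x (((\1_D (phi x))%:E * k (phi x)) * (om x)%:E)).
  by apply: eq_integral => x _; rewrite muleA.
rewrite (transfer_b mw mphi dom hfin (k := fun x => (\1_D x)%:E * k x)).
- by apply: eq_integral => x _; rewrite muleA.
- by apply: emeasurable_funM => //; exact: measurable_indicE.
- by move=> x; rewrite mule_ge0// lee_fin.
Qed.

Lemma transfer_bR D g : measurable D -> measurable_fun setT g ->
  \int[mu]_(x in phi @^-1` D) (g (phi x) * om x)%:E = \int[mu]_(x in D) (g x * b x)%:E.
Proof.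
move=> mD mg.
rewrite integral_pos_neg [RHS]integral_pos_neg; congr (_ - _).
- under eq_integral do rewrite (max_om _ (o0 _)).1.
  under [RHS]eq_integral do rewrite (max_om _ (b0 _)).1.
  by rewrite -(transfer_bD (k := fun x => (Num.max (g x) 0)%:E))//; exact: mmax.
- under eq_integral do rewrite (max_om _ (o0 _)).2.
  under [RHS]eq_integral do rewrite (max_om _ (b0 _)).2.
  by rewrite -(transfer_bD (k := fun x => (Num.max (- g x) 0)%:E))//; exact: mnmax.
Qed.

Lemma cpair_ae g a a' : measurable_fun setT a -> measurable_fun setT a' ->
  {ae mu, forall x, (a x * b x = a' x * b x)%R} -> cpair g a -> cpair g a'.
Proof.
move=> ma ma' aa H c mc Ic; rewrite H//; apply: ae_eq_integral => //.
- by apply/measurable_EFinP; apply: measurable_funM => //; exact: measurable_funM.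
- by apply/measurable_EFinP; apply: measurable_funM => //; exact: measurable_funM.
- by apply: filterS aa => x -> _.
Qed.

(** The conditional expectation is kept together with all its weighted quadratic bounds, which must
    hold for whichever version [condexpC] selects. *)
Definition cexp f kap := [/\ cmeasurable kap,
  cpair (fun x => complex.Re (f x)) (fun x => complex.Re (kap x)),
  cpair (fun x => complex.Im (f x)) (fun x => complex.Im (kap x)) &
  forall q s, weight_pair q s ->
   \int[mu]_x (q x * (normc (kap x) ^+ 2 * b x))%:E <=
   \int[mu]_x (s x * (normc (f x) ^+ 2 * om x))%:E].

Let msq g c : measurable_fun setT g -> measurable_fun setT c ->
  measurable_fun setT (fun x => g x ^+ 2 * c x)%R.
Proof. by move=> mf mg; apply: measurable_funM => //; exact: measurable_funX. Qed.

Lemma weighted_normcD (s : X -> R) f : measurable_fun setT s -> (forall x, (0 <= s x)%R) ->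
  forall c, measurable_fun setT c -> (forall x, (0 <= c x)%R) -> cmeasurable f ->
  \int[mu]_x (s x * (normc (f x) ^+ 2 * c x))%:E =
  \int[mu]_x (s x * (complex.Re (f x) ^+ 2 * c x))%:E +
  \int[mu]_x (s x * (complex.Im (f x) ^+ 2 * c x))%:E.
Proof.
move=> ms s0 c mc c0 [fr fi]; rewrite -ge0_integralD//.
- by apply: eq_integral => x _; rewrite Defs.sqr_normc mulrDl mulrDr.
- by move=> x _; rewrite lee_fin mulr_ge0// mulr_ge0// sqr_ge0.
- by apply/measurable_EFinP; apply: measurable_funM => //; exact: msq.
- by move=> x _; rewrite lee_fin mulr_ge0// mulr_ge0// sqr_ge0.
- by apply/measurable_EFinP; apply: measurable_funM => //; exact: msq.
Qed.

Lemma normc_lty f c : measurable_fun setT c -> (forall x, (0 <= c x)%R) -> cmeasurable f ->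
  \int[mu]_x (normc (f x) ^+ 2 * c x)%:E < +oo ->
  \int[mu]_x (complex.Re (f x) ^+ 2 * c x)%:E < +oo /\
  \int[mu]_x (complex.Im (f x) ^+ 2 * c x)%:E < +oo.
Proof.
move=> mc c0 mf If; have [fr fi] := mf.
split; apply: le_integral_lty If; try exact: msq.
- by move=> x; rewrite mulr_ge0// sqr_ge0.
- by apply: measurable_funM => //; exact: measurable_sqr_normc.
- by move=> x; rewrite ler_wpM2r// Defs.sqr_normc lerDl sqr_ge0.
- by move=> x; rewrite mulr_ge0// sqr_ge0.
- by apply: measurable_funM => //; exact: measurable_sqr_normc.
- by move=> x; rewrite ler_wpM2r// Defs.sqr_normc lerDr sqr_ge0.
Qed.

Lemma cexp_exists f : cmeasurable f -> \int[mu]_x (normc (f x) ^+ 2 * om x)%:E < +oo ->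
  exists kap, cexp f kap.
Proof.
move=> mf If; have [fr fi] := mf; have [Ir Ii] := normc_lty mo o0 mf If.
have [a [ma pa Ja]] := cond_real_exists mw mphi dom hfin fr Ir.
have [c [mc pc Jc]] := cond_real_exists mw mphi dom hfin fi Ii.
exists (fun x => Complex (a x) (c x)); split=> // q s qs.
have [[mq ms] q0 s0 _ _] := qs.
by rewrite !weighted_normcD//= leeD// ?Ja// Jc.
Qed.

Lemma cexp_lty f kap : cexp f kap -> \int[mu]_x (normc (f x) ^+ 2 * om x)%:E < +oo ->
  \int[mu]_x (normc (kap x) ^+ 2 * b x)%:E < +oo.
Proof.
move=> [_ _ _ J]; apply: le_lt_trans.
have := J _ _ (weight_pair1 mw mphi dom hfin).
by congr (_ <= _); apply: eq_integral => x _; rewrite mul1r.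
Qed.

Lemma square_integrable_weighted f : cmeasurable f ->
  square_integrable (weighted_measure mu w) f <-> \int[mu]_x (normc (f x) ^+ 2 * om x)%:E < +oo.
Proof.
move=> mf; have -> : \int[mu]_x (normc (f x) ^+ 2 * om x)%:E = \int[weighted_measure mu w]_x (normc (f x) ^+ 2)%:E.
  by rewrite integral_weighted_measureR//; exact: measurable_sqr_normc.
by split=> [[]//|]; split.
Qed.

Lemma cmeasurable_comp f : cmeasurable f -> cmeasurable (fun x => f (phi x)).
Proof. by move=> [fr fi]; split; [exact: (measurableT_comp fr mphi)|exact: (measurableT_comp fi mphi)]. Qed.

Lemma transfer_normc f : cmeasurable f ->
  \int[mu]_x (normc (f (phi x)) ^+ 2 * om x)%:E = \int[mu]_x (normc (f x) ^+ 2 * b x)%:E.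
Proof.
move=> mf; have := transfer_bR measurableT (measurable_sqr_normc mf).
by rewrite preimage_setT.
Qed.

Lemma cpair_set g a D : cpair g a -> measurable D -> \int[mu]_(x in D) (b x)%:E < +oo ->
  \int[mu]_(x in phi @^-1` D) (g x * om x)%:E = \int[mu]_(x in D) (a x * b x)%:E.
Proof.
move=> pa mD ID; have mi : measurable_fun setT (\1_D : X -> R) by exact: measurable_indic.
rewrite integral_indicM; last exact: mpre.
rewrite [RHS]integral_indicM//; apply: (pa _ mi).
rewrite integral_indicM// in ID; apply: le_lt_trans ID.
rewrite le_eqVlt; apply/orP; left; apply/eqP; apply: eq_integral => x _.
by rewrite -EFinM indicE; case: (_ \in _); rewrite ?expr1n ?expr0n.
Qed.

Lemma weighted_measure_preimage D : measurable D ->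
  weighted_measure mu w (phi @^-1` D) = \int[mu]_(x in D) (b x)%:E.
Proof.
move=> mD; have := transfer_bR mD (@measurable_cst _ _ X R setT 1%R).
by under eq_integral do rewrite mul1r; under [in X in _ = X -> _]eq_integral do rewrite mul1r.
Qed.

(** The version [g] is known only through integrals over sets of finite [mu_w]-measure. It factors
    as [kap' o phi], these integrals identify [kap'] with [kap] where [b > 0], and every clause of
    [cexp] carries the factor [b]. *)
Lemma condexpC_unique f kap (g : X -> R[i]) : cmeasurable f -> \int[mu]_x (normc (f x) ^+ 2 * om x)%:E < +oo ->
  cexp f kap -> is_condexpC mu phi w f g ->
  exists2 kap', forall x, g x = kap' (phi x) & cexp f kap'.
Proof.
move=> mf If ce [pr pim sg H]; have [[kr ki] cr ci J] := ce.
have Ik := cexp_lty ce If; have [Ikr Iki] := normc_lty mb b0 (conj kr ki) Ik.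
have factor a : preimage_measurable phi a -> exists2 a' : X -> R, measurable_fun setT a' & forall x, a x = a' (phi x).
  move=> pa; have pE : preimage_measurable phi (EFin \o a).
    move=> B mB; have := pa (EFin @^-1` B); rewrite comp_preimage; apply.
    exact: (measurable_preimageT (phi := EFin)).
  have [e me eE] := preimage_measurable_factor pE.
  by exists (fine \o e); [exact: measurableT_comp|move=> x; rewrite /= -eE].
have [r mr rE] := factor _ pr; have [i mi iE] := factor _ pim.
pose kap' x := Complex (r x) (i x).
have gE x : g x = kap' (phi x) by rewrite /kap' -rE -iE; case: (g x).
have gk : g = (fun x => kap' (phi x)) by apply/funext.
have mk' : cmeasurable kap' by [].
have Ik' : \int[mu]_x (normc (kap' x) ^+ 2 * b x)%:E < +oo.
  rewrite -transfer_normc//; move/square_integrable_weighted : sg; rewrite gk.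
  by apply; exact: cmeasurable_comp.
have [Ir' Ii'] := normc_lty mb b0 mk' Ik'.
have key (D : set X) : measurable D -> \int[mu]_(x in D) (b x)%:E < +oo ->
   fine (\int[mu]_(x in D) (complex.Re (kap x) * b x)%:E) = fine (\int[mu]_(x in D) (r x * b x)%:E) /\
   fine (\int[mu]_(x in D) (complex.Im (kap x) * b x)%:E) = fine (\int[mu]_(x in D) (i x * b x)%:E).
  move=> mD ID; have := H _ mD; rewrite weighted_measure_preimage// => /(_ ID).
  rewrite /cintegral gk => -[] /=.
  rewrite !integral_weighted_measureR//; try exact: mpre; try exact: (measurableT_comp _ mphi);
    try by case: mf.
  by rewrite !transfer_bR// (cpair_set cr)// (cpair_set ci)// => -> ->.
have er := cond_real_unique mw mphi dom kr mr Ikr Ir' (fun D mD ID => (key D mD ID).1).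
have ei := cond_real_unique mw mphi dom ki mi Iki Ii' (fun D mD ID => (key D mD ID).2).
exists kap' => //; split=> //.
- exact: cpair_ae er cr.
- exact: cpair_ae ei ci.
- move=> q s qs; apply: le_trans (J _ _ qs); have [[mq ms] q0 s0 _ _] := qs.
  rewrite le_eqVlt; apply/orP; left; apply/eqP; apply: ae_eq_integral => //.
  + by apply/measurable_EFinP; apply: measurable_funM => //; apply: measurable_funM => //; exact: measurable_sqr_normc.
  + by apply/measurable_EFinP; apply: measurable_funM => //; apply: measurable_funM => //; exact: measurable_sqr_normc.
  + apply: filterS2 er ei => x er ei _; congr EFin; rewrite !Defs.sqr_normc /=; congr (_ * _)%R.
    have [bx|bx] := eqVneq (b x) 0%R; first by rewrite bx !mulr0.
    by rewrite (mulIf bx er) (mulIf bx ei).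
Qed.

Lemma condexpCP f : cmeasurable f -> \int[mu]_x (normc (f x) ^+ 2 * om x)%:E < +oo ->
  exists2 kap, forall x, condexpC mu phi w f x = kap (phi x) & cexp f kap.
Proof.
move=> mf If; have [kap ck] := cexp_exists mf If; have [mk cr ci J] := ck.
rewrite /condexpC; case: xgetP => [g _ Hg|/(_ (kap \o phi)) no].
  exact: (condexpC_unique mf If ck Hg).
exfalso; apply: no; have mkp := cmeasurable_comp mk; split.
- move=> B mB; exists ((fun x => complex.Re (kap x)) @^-1` B); last by rewrite setTI.
  by rewrite -[X in measurable X]setTI; apply: mk.1.
- move=> B mB; exists ((fun x => complex.Im (kap x)) @^-1` B); last by rewrite setTI.
  by rewrite -[X in measurable X]setTI; apply: mk.2.
- apply/square_integrable_weighted => //; rewrite transfer_normc//.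
  exact: cexp_lty ck If.
- move=> D mD; rewrite weighted_measure_preimage// => ID.
  rewrite /cintegral; have [fr fi] := mf; have [kr ki] := mk.
  rewrite !integral_weighted_measureR//; try exact: mpre; try exact: mkp.1; try exact: mkp.2.
  rewrite (cpair_set cr)// (cpair_set ci)//.
  rewrite (transfer_bR (g := fun x => complex.Re (kap x)))//.
  by rewrite (transfer_bR (g := fun x => complex.Im (kap x))).
Qed.

End complex_conditional_expectation.

(** * The weighted composition operator and its adjoint *)

Section adjoint_graphs.
Context (R : realType) (V : lmodType R[i]) (ip : {dot V for Num.conj}).
Implicit Types (A : set (V * V)) (x y u v : V).

Lemma rdot_i_eq0 u x : rdot ip u x = 0 -> rdot ip (Complex 0 1 *: u) x = 0 -> ip u x = 0.
Proof.
rewrite /rdot linearZl_LR/=; case: (ip u x) => a c /= ->.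
by rewrite mul0r mul1r sub0r => /eqP; rewrite oppr_eq0 => /eqP ->.
Qed.

Lemma rdot_iZl u v : rdot ip (Complex 0 1 *: u) v = rdot ip u (Complex 0 (-1) *: v).
Proof.
rewrite /rdot linearZl_LR/= linearZr_LR/=; case: (ip u v) => a c /=.
by rewrite !mul0r mul1r opprK mul1r.
Qed.

(** The graph is stable under scalars, so the real identity applied to the pair multiplied by [i]
    supplies the imaginary parts. *)
Lemma adjoint_rdotP A x y : (forall c u v, A (u, v) -> A (c *: u, c *: v)) ->
  adjoint ip A (x, y) <-> forall u v, A (u, v) -> rdot ip v x = rdot ip u y.
Proof.
move=> AZ; split=> [H u v /H/= E|H u v uv /=]; first by rewrite /rdot E.
have := H _ _ (AZ (Complex 0 1) _ _ uv); have := H _ _ uv; rewrite /rdot !linearZl_LR/=.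
case: (ip v x) (ip u y) => a c [a' c'] /= -> /eqP.
by rewrite !mul0r !mul1r !sub0r eqr_opp => /eqP ->.
Qed.

Lemma adjoint_linear A (c : R[i]) x y x' y' : adjoint ip A (x, y) -> adjoint ip A (x', y') ->
  adjoint ip A (c *: x + x', c *: y + y').
Proof.
move=> H H' u v uv /=.
by rewrite !linearDr/= !linearZr_LR/= (H _ _ uv) (H' _ _ uv).
Qed.

Lemma adjoint0 A : adjoint ip A (0, 0).
Proof. by move=> u v _ /=; rewrite !linear0r. Qed.

Lemma adjointZ A (c : R[i]) x y : adjoint ip A (x, y) -> adjoint ip A (c *: x, c *: y).
Proof. by move=> H; have := adjoint_linear c H (@adjoint0 A); rewrite !addr0. Qed.

Lemma cvg_rdot (un : nat -> V) u v : hnorm ip (un n - u) @[n --> \oo] --> (0 : R) ->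
  rdot ip v (un n) @[n --> \oo] --> rdot ip v u.
Proof.
move=> H; apply/cvgrPdist_le => e e0.
have e1 : 0 < e / (hnorm ip v + 1) by rewrite divr_gt0// ltr_pwDr// sqrtr_ge0.
move/cvgrPdist_lt : H => /(_ _ e1); apply: filterS => n.
rewrite sub0r normrN (ger0_norm (sqrtr_ge0 _)) => Hn.
rewrite -rdotBr rdotC -(sqrtr_sqr (rdot _ _ _)).
apply: (@le_trans _ _ (Num.sqrt (sqn ip (u - un n) * sqn ip v))).
  by apply: ler_wsqrtr; exact: rdot_sqr_le.
rewrite sqrtrM ?sqn_ge0// -opprB sqnN -/(hnorm ip (un n - u)) -/(hnorm ip v).
have v0 : 0 <= hnorm ip v by exact: sqrtr_ge0.
have u0 : 0 <= hnorm ip (un n - u) by exact: sqrtr_ge0.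
move: Hn; rewrite ltr_pdivlMr ?ltr_pwDr// => Hn; apply: le_trans (ltW Hn).
by rewrite ler_wpM2l// lerDl.
Qed.

Lemma adjoint_closed A : (forall c u v, A (u, v) -> A (c *: u, c *: v)) ->
  closed_operator ip (adjoint ip A).
Proof.
move=> AZ un vn x y H ux vy; apply/adjoint_rdotP => // u v uv.
have h1 := cvg_rdot (v := v) ux; have h2 := cvg_rdot (v := u) vy.
apply: (cvg_unique _ h1 _) => //.
rewrite (_ : (fun n => _) = (fun n => rdot ip u (vn n))) //.
by apply/funext => n; have /adjoint_rdotP := H n; exact.
Qed.
End adjoint_graphs.

Section projection_operator.
Context d (X : measurableType d) (R : realType).
Variables (mu : {sigma_finite_measure set X -> \bar R}) (phi : X -> X) (w : X -> R[i]).
Hypotheses (mw : cmeasurable w) (mphi : measurable_fun setT phi).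
Hypothesis dom : weighted_pushforward mu phi w `<< mu.
Hypothesis hfin : {ae mu, forall x, (wcomp_deriv mu phi w x < +oo)%E}.
Local Notation b := (wcomp_derivR mu phi w).
Local Notation om := (weight w).
Local Notation cpair := (cpair mu phi w).
Local Notation ip := (L2dot mu).
Local Notation sq := (square_integrable mu).
Local Notation L2of := (L2of mu).
Local Notation Re := (@complex.Re R).
Local Notation Im := (@complex.Im R).
Implicit Types (a : X -> R) (c f g k : X -> R[i]) (u v : L2space mu).

Let b0 : forall x, (0 <= b x)%R := wcomp_derivR_ge0 mw mphi dom.
Let mb : measurable_fun setT b := measurable_wcomp_derivR mw mphi dom.
Let o0 : forall x, (0 <= om x)%R := weight_ge0 w.
Let mo : measurable_fun setT om := measurable_weight mw.

Lemma cmeasurable_mul f g : cmeasurable f -> cmeasurable g -> cmeasurable (fun x => f x * g x).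
Proof.
move=> [fr fi] [gr gi]; split.
  rewrite (_ : (fun x => _) = (fun x => Re (f x) * Re (g x) - Im (f x) * Im (g x))).
    by apply: measurable_funB; exact: measurable_funM.
  by apply/funext => x; case: (f x) (g x) => ? ? [].
rewrite (_ : (fun x => _) = (fun x => Re (f x) * Im (g x) + Im (f x) * Re (g x))).
  by apply: measurable_funD; exact: measurable_funM.
by apply/funext => x; case: (f x) (g x) => ? ? [].
Qed.

Definition wphi c x := w x * c (phi x).

Lemma cmeasurable_wphi c : cmeasurable c -> cmeasurable (wphi c).
Proof. by move=> mc; apply: cmeasurable_mul => //; exact: cmeasurable_comp. Qed.

Lemma normc_wphi c x : normc (wphi c x) ^+ 2 = normc (c (phi x)) ^+ 2 * om x.
Proof. by rewrite /wphi normcM exprMn mulrC. Qed.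

Definition bfin c := cmeasurable c /\ (\int[mu]_x (normc (c x) ^+ 2 * b x)%:E < +oo)%E.

Lemma sq_wphi c : cmeasurable c -> sq (wphi c) <-> bfin c.
Proof.
move=> mc; rewrite /bfin -(transfer_normc mw mphi dom hfin mc).
have -> : (\int[mu]_x (normc (c (phi x)) ^+ 2 * om x)%:E = \int[mu]_x (normc (wphi c x) ^+ 2)%:E)%E.
  by apply: eq_integral => x _; rewrite normc_wphi.
by split=> -[_ H]; split=> //; exact: cmeasurable_wphi.
Qed.

Lemma bfin_sq c : bfin c -> sq (wphi c). Proof. by move=> H; apply/sq_wphi => //; case: H. Qed.

Lemma wphi_ae k k' : {ae mu, forall x, k x * (b x)%:C%C = k' x * (b x)%:C%C} ->
  {ae mu, forall x, wphi k x = wphi k' x}.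
Proof.
move=> /(transfer_ae mw mphi dom) H.
apply: filterS2 H (ae_derivR_phi_gt0 mw mphi dom hfin) => x h1 h2.
have [w0|w0] := eqVneq (w x) 0; first by rewrite /wphi w0 !mul0r.
have bn : (b (phi x))%:C%C != 0 :> R[i] by rewrite eq_complex/= eqxx andbT gt_eqF// h2.
by rewrite /wphi (mulIf bn (h1 w0)).
Qed.

Lemma L2of_wphi_ae k k' : {ae mu, forall x, k x * (b x)%:C%C = k' x * (b x)%:C%C} ->
  bfin k -> bfin k' -> L2of (wphi k) = L2of (wphi k').
Proof. by move=> H /bfin_sq s /bfin_sq s'; apply/L2of_eq => //; exact: wphi_ae. Qed.

(** Multiplied by [|w|^2], the quotient [f / w] becomes [f conj(w)], which makes sense where [w = 0]
    too. Measurability of [divw] and the pairing with [w (c o phi)] are read off from this. *)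
Lemma divwE f x : Re (divw w f x) * om x = Re (f x) * Re (w x) + Im (f x) * Im (w x) /\
  Im (divw w f x) * om x = Im (f x) * Re (w x) - Re (f x) * Im (w x).
Proof.
rewrite /divw /weight; have [->|w0] := eqVneq (w x) 0.
  by rewrite normc0 expr0n/= !mulr0 addr0 subr0.
have := w0; rewrite Defs.sqr_normc; case: (w x) (f x) => wr wi [fr fi] /=.
rewrite eq_complex/= negb_and => W.
have N : wr ^+ 2 + wi ^+ 2 != 0.
  by rewrite paddr_eq0 ?sqr_ge0// !sqrf_eq0 negb_and.
by split; field.
Qed.

Lemma cmeasurable_divw f : cmeasurable f -> cmeasurable (divw w f).
Proof.
move=> [fr fi]; have [wr wi] := mw.
have mi : measurable_fun setT (fun x => (om x)^-1) by exact: (measurableT_comp (@measurable_invr R)).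
have E (t s : R) x : t * om x = s -> (w x = 0 -> t = 0) -> t = s * (om x)^-1.
  move=> <-; have [->|w0] := eqVneq (w x) 0; first by move=> ->//; rewrite !mul0r.
  by rewrite mulfK// weight_neq0.
have D0 x : w x = 0 -> divw w f x = 0 by move=> w0; rewrite /divw w0 eqxx.
split.
- rewrite (_ : (fun x => _) = (fun x => (Re (f x) * Re (w x) + Im (f x) * Im (w x)) * (om x)^-1)).
    by apply: measurable_funM => //; apply: measurable_funD; exact: measurable_funM.
  by apply/funext => x; apply: E; [exact: (divwE f x).1|move=> /D0 ->].
- rewrite (_ : (fun x => _) = (fun x => (Im (f x) * Re (w x) - Re (f x) * Im (w x)) * (om x)^-1)).
    by apply: measurable_funM => //; apply: measurable_funB; exact: measurable_funM.
  by apply/funext => x; apply: E; [exact: (divwE f x).2|move=> /D0 ->].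
Qed.

Lemma normc_divw_le f x : normc (divw w f x) ^+ 2 * om x <= normc (f x) ^+ 2.
Proof.
rewrite /divw; have [w0|w0] := eqVneq (w x) 0; first by rewrite normc0 expr0n mul0r sqr_ge0.
by rewrite /weight -exprMn -normcM divfK.
Qed.

Lemma divw_lty f : sq f -> (\int[mu]_x (normc (divw w f x) ^+ 2 * om x)%:E < +oo)%E.
Proof.
move=> [mf If]; apply: le_integral_lty If.
- by apply: measurable_funM => //; apply: measurable_sqr_normc; exact: cmeasurable_divw.
- by move=> x; rewrite mulr_ge0// sqr_ge0.
- exact: measurable_sqr_normc.
- by move=> x; exact: normc_divw_le.
Qed.

(* [k o phi] is the conditional expectation of [u_w]. *)
Definition ckap u k := [/\ bfin k,
  cpair (fun x => Re (divw w (repr u) x)) (fun x => Re (k x)) &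
  cpair (fun x => Im (divw w (repr u) x)) (fun x => Im (k x))].

Definition bform c k : R := fine (\int[mu]_x ((Re (c x) * Re (k x) + Im (c x) * Im (k x)) * b x)%:E)%E.

Lemma rdot_L2of f g : sq f -> sq g ->
  rdot ip (L2of f) (L2of g) = fine (\int[mu]_x (Re (f x) * Re (g x) + Im (f x) * Im (g x))%:E)%E.
Proof.
move=> sf sg; rewrite L2_rdotE ip_L2of//=; congr fine; apply: eq_integral => x _; congr EFin.
by case: (f x) (g x) => ? ? [? ?] /=; ring.
Qed.

Let bfinR k : bfin k -> (\int[mu]_x (Re (k x) ^+ 2 * b x)%:E < +oo)%E /\
  (\int[mu]_x (Im (k x) ^+ 2 * b x)%:E < +oo)%E.
Proof. by move=> [mk Ik]; exact: (normc_lty mb b0 mk Ik). Qed.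

Let int_prod (f g v : X -> R) : measurable_fun setT f -> measurable_fun setT g ->
  measurable_fun setT v -> (forall x, 0 <= v x) ->
  (\int[mu]_x (f x ^+ 2 * v x)%:E < +oo)%E -> (\int[mu]_x (g x ^+ 2 * v x)%:E < +oo)%E ->
  mu.-integrable setT (fun x => (f x * (g x * v x))%:E).
Proof.
move=> mf mg mv v0 If Ig.
have m2 (h : X -> R) : measurable_fun setT h -> measurable_fun setT (fun x => h x ^+ 2 * v x).
  by move=> mh; apply: measurable_funM => //; exact: measurable_funX.
apply: (@integrable_ge0_dom _ _ _ mu _ (fun x => f x ^+ 2 * v x + g x ^+ 2 * v x)).
- by apply: measurable_funM => //; exact: measurable_funM.
- by apply: measurable_funD; exact: m2.
- move=> x; rewrite mulrA -mulrDl normrM (ger0_norm (v0 x)) ler_wpM2r// ler_norml.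
  by have := sqr_ge0 (f x - g x); have := sqr_ge0 (f x + g x); move=> *; apply/andP; split; nra.
- by apply: integralD_lty => //; try exact: m2; move=> x; rewrite mulr_ge0 ?sqr_ge0.
Qed.

(** As [u conj(w) = u_w |w|^2], the left side pairs [c o phi] with [u_w] over [mu_w]. There [u_w]
    may be replaced by its conditional expectation [k o phi], and the result is moved to [b mu]. *)
Lemma rdot_wphi u k c : ckap u k -> bfin c -> rdot ip u (L2of (wphi c)) = bform c k.
Proof.
move=> [bk pr pim] bc; rewrite -{1}(L2of_repr u) rdot_L2of; [|exact: sq_repr|exact: bfin_sq].
set f := repr u; have sf : sq f := sq_repr u.
have mc : cmeasurable c by case: bc.
have mk : cmeasurable k by case: bk.
have [cr ci] := mc; have [kr ki] := mk.
have mf := cmeasurable_divw sf.1; have [fr fi] := mf.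
have If := normc_lty mo o0 mf (divw_lty sf); have Ic := bfinR bc; have Ik := bfinR bk.
have mcp := cmeasurable_comp mphi mc; have [cpr cpi] := mcp.
have [_ Icp] := bc; rewrite -(transfer_normc mw mphi dom hfin mc) in Icp.
have Icp2 := normc_lty mo o0 mcp Icp.
rewrite /bform; congr fine.
transitivity (\int[mu]_x ((Re (c (phi x)) * (Re (divw w f x) * om x))%:E +
   (Im (c (phi x)) * (Im (divw w f x) * om x))%:E))%E.
  apply: eq_integral => x _; rewrite -EFinD; congr EFin.
  rewrite (divwE f x).1 (divwE f x).2 /wphi.
  by case: (f x) (w x) (c (phi x)) => ? ? [? ?] [? ?] /=; ring.
rewrite integralD//; [|exact: (int_prod cpr fr mo o0 Icp2.1 If.1)|exact: (int_prod cpi fi mo o0 Icp2.2 If.2)].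
rewrite (pr _ cr Ic.1) (pim _ ci Ic.2) -integralD//;
  [|exact: (int_prod cr kr mb b0 Ic.1 Ik.1)|exact: (int_prod ci ki mb b0 Ic.2 Ik.2)].
by apply: eq_integral => x _; rewrite -EFinD; congr EFin; ring.
Qed.

Lemma ckap_wphi k : bfin k -> ckap (L2of (wphi k)) k.
Proof.
move=> bk; have mk : cmeasurable k by case: bk.
have [kr ki] := mk; have sk := bfin_sq bk.
have mD := cmeasurable_divw (sq_repr (L2of (wphi k))).1.
have Dk : {ae mu, forall x, divw w (repr (L2of (wphi k))) x * (om x)%:C%C = k (phi x) * (om x)%:C%C}.
  apply: filterS (repr_L2of sk) => x; rewrite /divw; have [w0 _|w0 ->] := eqVneq (w x) 0.
    have -> : om x = 0 by apply/eqP; rewrite weight_neq0 w0.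
    by rewrite !mulr0.
  by rewrite /wphi [w x * _]mulrC mulfK.
have reM (t : R[i]) (s : R) : Re (t * s%:C%C) = Re t * s /\ Im (t * s%:C%C) = Im t * s.
  by case: t => t1 t2 /=; split; ring.
have key (r r' : X -> R) : measurable_fun setT r -> measurable_fun setT r' ->
    {ae mu, forall x, r x * om x = r' (phi x) * om x} -> cpair r r'.
  move=> mr mr' rr c mc Ic.
  have := transfer_bR mw mphi dom hfin measurableT (measurable_funM mc mr').
  rewrite preimage_setT => E.
  transitivity (\int[mu]_x (c (phi x) * r' (phi x) * om x)%:E)%E; last first.
    by rewrite E; apply: eq_integral => x _; rewrite mulrA.
  apply: ae_eq_integral => //.
  - apply/measurable_EFinP; apply: measurable_funM; first exact: (measurableT_comp mc mphi).
    exact: measurable_funM.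
  - by apply/measurable_EFinP; apply: measurable_funM => //; exact: (measurableT_comp (measurable_funM mc mr') mphi).
  - by apply: filterS rr => x h _; rewrite h mulrA.
split=> //; apply: key => //; try by case: mD.
- by apply: filterS Dk => x /(congr1 Re); rewrite !(reM _ _).1.
- by apply: filterS Dk => x /(congr1 Im); rewrite !(reM _ _).2.
Qed.

Lemma ckap_unique u k k' : ckap u k -> ckap u k' ->
  {ae mu, forall x, k x * (b x)%:C%C = k' x * (b x)%:C%C}.
Proof.
move=> [bk pr pim] [bk' pr' pim'].
have [[kr ki] _] := bk; have [[kr' ki'] _] := bk'.
have [Ir Ii] := bfinR bk; have [Ir' Ii'] := bfinR bk'.
have er := cond_real_unique mw mphi dom kr kr' Ir Ir'.
have ei := cond_real_unique mw mphi dom ki ki' Ii Ii'.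
have {}er := er (fun D mD ID => congr1 fine (etrans (esym (cpair_set mphi pr mD ID)) (cpair_set mphi pr' mD ID))).
have {}ei := ei (fun D mD ID => congr1 fine (etrans (esym (cpair_set mphi pim mD ID)) (cpair_set mphi pim' mD ID))).
apply: filterS2 er ei => x h1 h2; apply/eqP; rewrite eq_complex.
have reM (t : R[i]) (s : R) : Re (t * s%:C%C) = Re t * s /\ Im (t * s%:C%C) = Im t * s.
  by case: t => t1 t2 /=; split; ring.
by rewrite !(reM _ _).1 !(reM _ _).2 h1 h2 !eqxx.
Qed.

Lemma ckap_cexp u k : cexp mu phi w (divw w (repr u)) k -> ckap u k.
Proof.
move=> ck; have sf := sq_repr u; have [mk pr pim _] := ck.
by split=> //; split=> //; exact: (cexp_lty mw mphi dom hfin ck (divw_lty sf)).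
Qed.

(** A single choice for both sides: it represents the value of [condexpC] in assertion (ii) and
    defines the projection [cproj]. *)
Definition kap u : X -> R[i] :=
  xget (fun=> 0) [set k | (forall x, condexpC mu phi w (divw w (repr u)) x = k (phi x)) /\
                          cexp mu phi w (divw w (repr u)) k].

Lemma kapP u : (forall x, condexpC mu phi w (divw w (repr u)) x = kap u (phi x)) /\
  cexp mu phi w (divw w (repr u)) (kap u).
Proof.
have sf := sq_repr u; have mf := cmeasurable_divw sf.1.
rewrite /kap; case: xgetP => [k _ []//|no].
have [k kE ck] := condexpCP mw mphi dom hfin mf (divw_lty sf).
by exfalso; apply: (no k).
Qed.

Lemma ckap_kap u : ckap u (kap u).
Proof. by apply: ckap_cexp; case: (kapP u). Qed.

Lemma bfin_kap u : bfin (kap u). Proof. by case: (ckap_kap u). Qed.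

Definition cproj u : L2space mu := L2of (wphi (kap u)).

Lemma cprojE u k : ckap u k -> cproj u = L2of (wphi k).
Proof.
move=> ck; have bk : bfin k by case: ck.
by apply: L2of_wphi_ae => //; [exact: ckap_unique (ckap_kap u) ck|exact: bfin_kap].
Qed.

Lemma cproj_wphi k : bfin k -> cproj (L2of (wphi k)) = L2of (wphi k).
Proof. by move=> bk; apply: cprojE; exact: ckap_wphi. Qed.

Lemma rdot_cproj u c : bfin c -> rdot ip (u - cproj u) (L2of (wphi c)) = 0.
Proof.
move=> bc; rewrite rdotBl (rdot_wphi (ckap_kap u) bc).
by rewrite (rdot_wphi (ckap_wphi (bfin_kap u)) bc) subrr.
Qed.

Lemma bfinZD (a : R[i]) c k : bfin c -> bfin k -> bfin (fun x => a * c x + k x).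
Proof.
move=> bc bk; have [mc _] := bc; have [mk _] := bk.
have ma : cmeasurable (fun _ : X => a) by split; exact: measurable_cst.
have mac := cmeasurable_mul ma mc.
have m : cmeasurable (fun x => a * c x + k x).
  split.
    rewrite (_ : (fun x => _) = (fun x => Re (a * c x) + Re (k x))).
      by apply: measurable_funD; [case: mac|case: mk].
    by apply/funext => x; rewrite raddfD.
  rewrite (_ : (fun x => _) = (fun x => Im (a * c x) + Im (k x))).
    by apply: measurable_funD; [case: mac|case: mk].
  by apply/funext => x; rewrite raddfD.
apply/sq_wphi => //; rewrite (_ : wphi _ = (fun x => a * wphi c x + wphi k x)).
  by apply: sqZD; exact: bfin_sq.
by apply/funext => x; rewrite /wphi mulrDr mulrCA.
Qed.

Lemma L2of_wphiZD (a : R[i]) c k : bfin c -> bfin k ->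
  L2of (wphi (fun x => a * c x + k x)) = a *: L2of (wphi c) + L2of (wphi k).
Proof.
move=> bc bk; rewrite -L2ofZD; [|exact: bfin_sq..]; congr L2of.
by apply/funext => x; rewrite /wphi mulrDr mulrCA.
Qed.

Lemma bfin0 : bfin (fun=> 0).
Proof.
split; first by split; exact: measurable_cst.
by under eq_integral do rewrite normc0 expr0n mul0r; rewrite integral0 ltry.
Qed.

Lemma L2of_wphi0 : L2of (wphi (fun=> 0)) = 0.
Proof. by rewrite -[RHS](L2of0 mu); congr L2of; apply/funext => x; rewrite /wphi mulr0. Qed.

Lemma ip_cproj u c : bfin c -> ip (u - cproj u) (L2of (wphi c)) = 0.
Proof.
move=> bc; have bic := bfinZD (Complex 0 (-1)) bc bfin0.
apply: rdot_i_eq0; first exact: rdot_cproj.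
have := rdot_cproj u bic; rewrite L2of_wphiZD//; last exact: bfin0.
by rewrite L2of_wphi0 addr0 -rdot_iZl.
Qed.

(** [kap] is chosen for each [u] separately. Orthogonality to the functions [w (k o phi)] lets
    linearity of [cproj] be proved without comparing these choices. *)
Lemma cproj_char u c : bfin c ->
  (forall k, bfin k -> ip (u - L2of (wphi c)) (L2of (wphi k)) = 0) -> cproj u = L2of (wphi c).
Proof.
move=> bc H; have bk := bfin_kap u; have bd := bfinZD (-1) bc bk.
have E : cproj u - L2of (wphi c) = L2of (wphi (fun x => -1 * c x + kap u x)).
  by rewrite L2of_wphiZD// scaleN1r addrC.
apply/eqP; rewrite -subr_eq0; apply/eqP; apply: (@sqn_eq0 _ _ ip).
rewrite /sqn {2}E.
rewrite (_ : cproj u - _ = (u - L2of (wphi c)) - (u - cproj u)); last first.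
  by rewrite [RHS]addrC opprB addrA subrK.
have h : rdot ip (u - L2of (wphi c)) _ = 0 := congr1 Re (H _ bd).
by rewrite rdotBl h rdot_cproj// subrr.
Qed.

Lemma cproj_linear (a : R[i]) u v : cproj (a *: u + v) = a *: cproj u + cproj v.
Proof.
have bu := bfin_kap u; have bv := bfin_kap v.
have E : L2of (wphi (fun x => a * kap u x + kap v x)) = a *: cproj u + cproj v.
  exact: L2of_wphiZD.
rewrite -E; apply: cproj_char; first exact: bfinZD.
move=> k bk; rewrite E.
have -> : a *: u + v - (a *: cproj u + cproj v) = a *: (u - cproj u) + (v - cproj v).
  by rewrite scalerBr addrACA opprD.
move: (ip_cproj u bk) (ip_cproj v bk).
move: (u - cproj u) (v - cproj v) (L2of _) => s t r h1 h2.
by rewrite L2dotDl L2dotZl h1 h2 mulr0 addr0.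
Qed.

Lemma cproj_idem u : cproj (cproj u) = cproj u.
Proof. by apply: cproj_wphi; exact: bfin_kap. Qed.

Lemma cproj_selfadj u v : ip (cproj u) v = ip u (cproj v).
Proof.
have h1 := ip_cproj u (bfin_kap v); have h2 := ip_cproj v (bfin_kap u).
rewrite -/(cproj v) (L2dotBl u (cproj u)) in h1.
rewrite -/(cproj u) (L2dotBl v (cproj v)) in h2.
move/eqP: h1; rewrite subr_eq0 => /eqP ->.
rewrite (L2dotC (cproj u) v) (L2dotC (cproj u) (cproj v)).
by move/eqP: h2; rewrite subr_eq0 => /eqP ->.
Qed.

Lemma rmul_wphi (r : X -> R) k : rmul (fun x => r (phi x)) (wphi k) = wphi (rmul r k).
Proof. by apply/funext => x; rewrite /rmul /wphi mulrCA. Qed.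

(** A function of [b o phi] is absorbed into [k]: multiplying [w (k o phi)] by [rho(b o phi)]
    replaces [k] by [rho(b) k]. *)
Lemma cproj_mul (rho : R -> R) f : measurable_fun setT rho -> sq f ->
  cproj (L2of f) = L2of f -> sq (rmul (rho \o (fun x => b (phi x))) f) ->
  cproj (L2of (rmul (rho \o (fun x => b (phi x))) f)) = L2of (rmul (rho \o (fun x => b (phi x))) f).
Proof.
move=> mrho sf Pf sr; set k := kap (L2of f); have bk : bfin k := bfin_kap _.
have mrb : measurable_fun setT (rho \o b) by exact: measurableT_comp.
have mk : cmeasurable k by case: bk.
have mrk := cmeasurable_rmul mrb mk.
have fk : {ae mu, forall x, f x = wphi k x}.
  by apply/(L2of_eq sf (bfin_sq bk)); rewrite -Pf.
have rk : {ae mu, forall x, rmul (rho \o (fun x => b (phi x))) f x = wphi (rmul (rho \o b) k) x}.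
  by apply: filterS fk => x; rewrite -rmul_wphi /rmul/= => ->.
have srk : sq (wphi (rmul (rho \o b) k)) := sq_ae (cmeasurable_wphi mrk) rk sr.
have -> : L2of (rmul (rho \o (fun x => b (phi x))) f) = L2of (wphi (rmul (rho \o b) k)).
  exact/L2of_eq.
by apply: cproj_wphi; apply/sq_wphi.
Qed.

End projection_operator.

Section weighted_composition_operator.
Context d (X : measurableType d) (R : realType).
Variables (mu : {sigma_finite_measure set X -> \bar R}) (phi : X -> X) (w : X -> R[i]).
Hypotheses (mw : cmeasurable w) (mphi : measurable_fun setT phi).
Hypothesis dom : weighted_pushforward mu phi w `<< mu.
Hypothesis hfin : {ae mu, forall x, (wcomp_deriv mu phi w x < +oo)%E}.
Local Notation b := (wcomp_derivR mu phi w).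
Local Notation om := (weight w).
Local Notation ip := (L2dot mu).
Local Notation sq := (square_integrable mu).
Local Notation L2of := (L2of mu).
Local Notation Re := (@complex.Re R).
Local Notation Im := (@complex.Im R).
Local Notation bfin := (bfin mu phi w).
Local Notation wphi := (wphi phi w).
Local Notation ckap := (ckap (mu := mu) phi w).
Local Notation kap := (kap (mu := mu) phi w).
Local Notation C := (wcomp mu phi w).
Implicit Types (a : X -> R) (c f g k : X -> R[i]) (u v : L2space mu).

Let b0 : forall x, (0 <= b x)%R := wcomp_derivR_ge0 mw mphi dom.
Let mb : measurable_fun setT b := measurable_wcomp_derivR mw mphi dom.

Lemma bfin_ae f g : cmeasurable g -> {ae mu, forall x, f x = g x} -> bfin f -> bfin g.
Proof.
move=> mg fg [mf If]; split=> //; apply: le_lt_trans If.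
rewrite le_eqVlt; apply/orP; left; apply/eqP; apply: ae_eq_integral => //.
- by apply/measurable_EFinP; apply: measurable_funM => //; exact: measurable_sqr_normc.
- by apply/measurable_EFinP; apply: measurable_funM => //; exact: measurable_sqr_normc.
- by apply: filterS fg => x ->.
Qed.

Lemma wcompE f v : sq f -> C (L2of f, v) <-> bfin f /\ v = L2of (wphi f).
Proof.
move=> sf; have mf : cmeasurable f by case: sf.
split=> [[f' [g [/= fE -> gE]]]|[bf ->]].
  have gw : (g : X -> R[i]) = wphi f' by apply/funext.
  have sf' := L2funP f'; have mf' : cmeasurable f' by case: sf'.
  have ff : {ae mu, forall x, f' x = f x}.
    by apply/(L2of_eq sf' sf); rewrite L2of_fun.
  have bf' : bfin f' by apply/(sq_wphi mw mphi dom hfin) => //; rewrite -gw; exact: L2funP.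
  have bf := bfin_ae mf ff bf'; split=> //.
  rewrite -L2of_fun gw; apply: (L2of_wphi_ae mw mphi dom hfin) => //.
  by apply: filterS ff => x ->.
have [F FE] := sq_fun sf; have [G GE] := sq_fun (bfin_sq mw mphi dom hfin bf).
exists F, G; split; rewrite /= -?L2of_fun ?FE ?GE//.
Qed.

Lemma wcompZ (a : R[i]) u v : C (u, v) -> C (a *: u, a *: v).
Proof.
move=> [f [g [/= -> -> gE]]]; exists (a *: f), (a *: g); split=> /=.
- exact: L2classZ.
- exact: L2classZ.
- by move=> x; rewrite [LHS]/(a * g x) [X in _ = _ * X]/(a * f (phi x)) gE mulrCA.
Qed.

(* Bounded functions supported on a set of finite measure on which [b] is bounded. *)
Definition test c := cmeasurable c /\ exists (K : R) (Z : set X),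
  [/\ measurable Z, (mu Z < +oo)%E, forall x, normc (c x) ^+ 2 <= K,
    forall x, ~ Z x -> c x = 0 & forall x, Z x -> b x <= K].

(** The bound [(1 + b)^2] covers the weights [1], [b] and [b^2] at once. *)
Lemma test_lty c (v : X -> R) : test c -> measurable_fun setT v -> (forall x, 0 <= v x) ->
  (forall x, v x <= (1 + b x) ^+ 2) -> (\int[mu]_x (normc (c x) ^+ 2 * v x)%:E < +oo)%E.
Proof.
move=> [mc [K [Z [mZ Zfin cK cZ bK]]]] mv v0 vb.
apply: (@le_integral_lty _ _ _ _ _ (fun x => K * (1 + K) ^+ 2 * \1_Z x)).
- by apply: measurable_funM => //; exact: measurable_sqr_normc.
- by move=> x; rewrite mulr_ge0// sqr_ge0.
- by apply: measurable_funM => //; exact: measurable_indic.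
- move=> x; rewrite indicE; have [xZ|xZ] := boolP (x \in Z); last first.
    by rewrite cZ ?normc0 ?expr0n ?mul0r ?mulr0// => /mem_set; apply/negP.
  rewrite inE in xZ; rewrite mulr1 ler_pM ?sqr_ge0//.
  apply: le_trans (vb x) _; rewrite ler_pXn2r ?nnegrE ?addr_ge0//.
    by rewrite lerD2l bK.
  by rewrite (le_trans (b0 x))// bK.
(* A negative [K] would bound a square at every point, so [X] has no points in that case. *)
have [K0|K0] := leP 0 K.
  under eq_integral do rewrite EFinM.
  rewrite ge0_integralZl//.
  - rewrite integral_indic// setIT; apply: lte_mul_pinfty => //.
    by rewrite lee_fin mulr_ge0// sqr_ge0.
  - exact: measurable_indicE.
  - by rewrite lee_fin mulr_ge0// sqr_ge0.
rewrite (_ : (fun x => _) = cst 0%E) ?integral0 ?ltry//.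
apply/funext => x; have := le_trans (sqr_ge0 (normc (c x))) (cK x).
by rewrite leNgt K0.
Qed.

Lemma test_sq c : test c -> sq c.
Proof.
move=> tc; split; first by case: tc.
have := test_lty tc (@measurable_cst _ _ X R setT 1).
under eq_integral do rewrite mulr1; apply=> // x.
by apply: (@le_trans _ _ 1) => //; have := b0 x; nra.
Qed.

Lemma test_bfin c : test c -> bfin c.
Proof.
move=> tc; split; first by case: tc.
by apply: test_lty => // x; have := b0 x; nra.
Qed.

Lemma test_bsq c : test c -> sq (rmul b c).
Proof.
move=> tc; split; first by apply: cmeasurable_rmul => //; case: tc.
have I : (\int[mu]_x (normc (c x) ^+ 2 * b x ^+ 2)%:E < +oo)%E.
  apply: test_lty => //; first exact: measurable_funX.
    by move=> x; exact: sqr_ge0.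
  by move=> x; have := b0 x; nra.
by under eq_integral do rewrite normc_rmul mulrC.
Qed.

Definition cross c k x := Re (c x) * Re (k x) + Im (c x) * Im (k x).

(** The test function is [y - z] itself, cut off to [Y n], where [b], [|y|^2] and [|z|^2] are at
    most [n]. The two identities then subtract to [\int |c n|^2 dmu = 0]. *)
Lemma ae_eq_of_test (y z : X -> R[i]) : cmeasurable y -> cmeasurable z ->
  (forall c, test c -> fine (\int[mu]_x (cross c y x)%:E)%E = fine (\int[mu]_x (cross c z x)%:E)%E) ->
  {ae mu, forall x, y x = z x}.
Proof.
move=> my mz H; have [yr yi] := my; have [zr zi] := mz.
pose s x := b x + (normc (y x) ^+ 2 + normc (z x) ^+ 2).
have ms : measurable_fun setT s.
  by apply: measurable_funD => //; apply: measurable_funD; exact: measurable_sqr_normc.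
have [Y [mY Yfin _ YT Yle]] := finite_sublevel_cover mu ms.
pose c n := rmul (\1_(Y n)) (fun x => y x - z x).
have myz : cmeasurable (fun x => y x - z x).
  split.
    rewrite (_ : (fun x => _) = (fun x => Re (y x) - Re (z x))); first exact: measurable_funB.
    by apply/funext => x; rewrite raddfB.
  rewrite (_ : (fun x => _) = (fun x => Im (y x) - Im (z x))); first exact: measurable_funB.
  by apply/funext => x; rewrite raddfB.
have mc n : cmeasurable (c n) by apply: cmeasurable_rmul => //; exact: measurable_indic.
have cE n x : Re (c n x) = \1_(Y n) x * (Re (y x) - Re (z x)) /\ Im (c n x) = \1_(Y n) x * (Im (y x) - Im (z x)).
  by rewrite /c /rmul; case: (y x) (z x) => ? ? [? ?] /=; split; ring.
have sY n x : Y n x -> [/\ b x <= n%:R, normc (y x) ^+ 2 <= n%:R & normc (z x) ^+ 2 <= n%:R].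
  move=> /Yle; rewrite /s; have := b0 x; have := sqr_ge0 (normc (y x)); have := sqr_ge0 (normc (z x)).
  by move=> *; split; lra.
(* From [|y - z|^2 <= 2 (|y|^2 + |z|^2)]. *)
have cn n x : normc (c n x) ^+ 2 <= 4 * n%:R * \1_(Y n) x.
  rewrite /c normc_rmul indicE; case: (boolP (x \in _)) => [|_]; last by rewrite expr0n mul0r mulr0.
  rewrite inE => /sY[_]; rewrite expr1n mul1r mulr1 !Defs.sqr_normc.
  case: (y x) (z x) => y1 y2 [z1 z2] /= h1 h2.
  have := sqr_ge0 (y1 + z1); have := sqr_ge0 (y2 + z2); rewrite !sqrrD !sqrrN => *; lra.
have tc n : test (c n).
  split=> //; exists (4 * n%:R), (Y n); split=> //.
  - move=> x; apply: le_trans (cn n x) _; rewrite ler_piMr ?mulr_ge0//.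
  - by move=> x nY; rewrite /c /rmul indicE memNset// mul0r.
  - by move=> x /sY[bx _ _]; rewrite (le_trans bx)// ler_peMl//; lra.
have icr n (t : X -> R[i]) : cmeasurable t -> (forall x, Y n x -> normc (t x) ^+ 2 <= n%:R) ->
    mu.-integrable setT (fun x => (cross (c n) t x)%:E).
  move=> mt tn; have [tr ti] := mt; have [cr ci] := mc n.
  (* The product is at most [|c n|^2 + |t|^2 <= 4 n + n]. *)
  apply: (@integrable_ge0_dom _ _ _ mu _ (fun x => 5 * n%:R * \1_(Y n) x)).
  - by apply: measurable_funD; exact: measurable_funM.
  - by apply: measurable_funM => //; exact: measurable_indic.
  - move=> x; have := cn n x; rewrite indicE; case: (boolP (x \in Y n)) => [xY|xY].
      rewrite inE in xY; have := tn _ xY; rewrite !mulr1 !Defs.sqr_normc /cross ler_norml.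
      case: (c n x) (t x) => c1 c2 [t1 t2] /= h1 h2.
      have := sqr_ge0 (c1 + t1); have := sqr_ge0 (c2 + t2).
      have := sqr_ge0 (c1 - t1); have := sqr_ge0 (c2 - t2).
      rewrite !sqrrD !sqrrN => *; apply/andP; split; lra.
    by rewrite /cross (cE n x).1 (cE n x).2 indicE (negbTE xY) !mul0r addr0 normr0 mulr0.
  - under eq_integral do rewrite EFinM.
    rewrite ge0_integralZl//; last exact: measurable_indicE.
    rewrite integral_indic// setIT; apply: lte_mul_pinfty => //; exact: Yfin.
have iy n := icr n y my (fun x Yx => let: And3 _ h _ := sY n x Yx in h).
have iz n := icr n z mz (fun x Yx => let: And3 _ _ h := sY n x Yx in h).
have E n : (\int[mu]_x (normc (c n x) ^+ 2)%:E = 0)%E.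
  transitivity (\int[mu]_x ((cross (c n) y x)%:E - (cross (c n) z x)%:E))%E.
    apply: eq_integral => x _; rewrite -EFinB; congr EFin.
    rewrite Defs.sqr_normc /cross (cE n x).1 (cE n x).2 indicE.
    by case: (_ \in _) => /=; ring.
  rewrite integralB//.
  rewrite -(fineK (integrable_fin_num measurableT (iy n))) -(fineK (integrable_fin_num measurableT (iz n))).
  by rewrite H// subee.
have aeD n : {ae mu, forall x, Y n x -> y x = z x}.
  have m1 : measurable_fun setT (fun x => (normc (c n x) ^+ 2)%:E).
    by apply/measurable_EFinP; exact: measurable_sqr_normc.
  have p1 x : (0 <= (normc (c n x) ^+ 2)%:E)%E by rewrite lee_fin sqr_ge0.
  have := ge0_integral_eq0_ae measurableT m1 p1 (E n); apply: filterS => x /(_ I) + Yx.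
  rewrite /c normc_rmul indicE mem_set//= expr1n mul1r => -[] /eqP.
  by rewrite sqrf_eq0 => /eqP/eq0_normc/eqP; rewrite subr_eq0 => /eqP.
by apply: filterS (ae_foralln aeD) => x h; have [n] := YT x; exact: h.
Qed.

Lemma bformE c k : bform mu phi w c k = fine (\int[mu]_x (cross c (rmul b k) x)%:E)%E.
Proof.
congr fine; apply: eq_integral => x _; congr EFin; rewrite /cross /rmul.
by case: (k x) => ? ? /=; ring.
Qed.

(** By [rdot_wphi] the pairing of [u] with [C c] is the pairing of [c] with [b k]. Testing with the
    functions of [test], for which all integrals are finite, identifies [v] with [b k] before [b k]
    is known to be square integrable. *)
Lemma adjoint_wcompE u k v : ckap u k ->
  adjoint ip C (u, v) <-> sq (rmul b k) /\ v = L2of (rmul b k).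
Proof.
move=> ck; have bk : bfin k by case: ck.
have mbk : cmeasurable (rmul b k) by apply: cmeasurable_rmul => //; case: bk.
split=> [/(adjoint_rdotP _ _ _ wcompZ) H|[sbk ->]].
  have E : {ae mu, forall x, repr v x = rmul b k x}.
    apply: ae_eq_of_test => //; first by case: (sq_repr v).
    move=> c tc; have bc := test_bfin tc; have sc := test_sq tc.
    have := H (L2of c) (L2of (wphi c)); rewrite rdotC (rdot_wphi mw mphi dom hfin ck bc).
    rewrite -{1}(L2of_repr v) rdot_L2of//; last exact: sq_repr.
    rewrite bformE => -> //; apply/wcompE => //.
  have sbk := sq_ae mbk E (sq_repr v); split=> //.
  by rewrite -(L2of_repr v); apply/L2of_eq => //; exact: sq_repr.
apply/(adjoint_rdotP _ _ _ wcompZ) => u' v'.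
rewrite -{1}(L2of_repr u') => /wcompE[|bf ->]; first exact: sq_repr.
rewrite rdotC (rdot_wphi mw mphi dom hfin ck bf) bformE -{2}(L2of_repr u') rdot_L2of//.
exact: sq_repr.
Qed.

(** Serves to interpolate weights: [b <= 1 + b^2] and [b^2 <= b + b^3] recover the intermediate
    integrability that the domain of a product of operators demands. *)
Lemma sum_lty k (q1 q2 : X -> R) : cmeasurable k ->
  measurable_fun setT q1 -> measurable_fun setT q2 ->
  (forall x, 0 <= q1 x) -> (forall x, 0 <= q2 x) ->
  (forall q : X -> R, measurable_fun setT q -> (forall x, 0 <= q x <= q1 x + q2 x) ->
  (\int[mu]_x (normc (k x) ^+ 2 * q1 x)%:E < +oo)%E ->
  (\int[mu]_x (normc (k x) ^+ 2 * q2 x)%:E < +oo)%E ->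
  (\int[mu]_x (normc (k x) ^+ 2 * q x)%:E < +oo)%E).
Proof.
move=> mk m1 m2 p1 p2 q mq q0 I1 I2; have mn := measurable_sqr_normc mk.
have n0 x : 0 <= normc (k x) ^+ 2 by exact: sqr_ge0.
apply: (@le_integral_lty _ _ _ _ _ (fun x => normc (k x) ^+ 2 * q1 x + normc (k x) ^+ 2 * q2 x)).
- exact: measurable_funM.
- by move=> x; rewrite mulr_ge0//; case/andP: (q0 x).
- by apply: measurable_funD; exact: measurable_funM.
- by move=> x; rewrite -mulrDr ler_wpM2l//; case/andP: (q0 x).
- by apply: integralD_lty => //; try exact: measurable_funM; move=> x; rewrite mulr_ge0.
Qed.

Lemma adjoint_wcomp_wcomp : opcomp (adjoint ip C) C = mult_op b idfun id.
Proof.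
apply/seteqP; split => -[u v]; rewrite /opcomp /mult_op/=.
  move=> [y]; rewrite -{1}(L2of_repr u) => /wcompE[|bf ->]; first exact: sq_repr.
  by move=> /(adjoint_wcompE _ (ckap_wphi mw mphi dom hfin bf)).
move=> [s ->]; have sf := sq_repr u; have mf : cmeasurable (repr u) by case: sf.
have bf : bfin (repr u).
  split=> //; apply: (sum_lty mf (@measurable_cst _ _ X R setT 1) (measurable_funX 2 mb)) => //.
  - by move=> x; exact: sqr_ge0.
  - by move=> x; rewrite b0/=; have := b0 x; have := sqr_ge0 (b x - 1); nra.
  - by under eq_integral do rewrite mulr1; case: sf.
  - by under eq_integral do rewrite mulrC -normc_rmul; case: s.
exists (L2of (wphi (repr u))).
  by rewrite -{1}(L2of_repr u); apply/wcompE.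
by apply/(adjoint_wcompE _ (ckap_wphi mw mphi dom hfin bf)).
Qed.

(** For [(x, y)] in the second adjoint, the pairs [(w (c o phi), b c)] of [C^*] with test functions
    [c] give [b x = b kap y], and the pair [(y - P y, 0)] gives [y = P y]. So
    [y = w (kap y o phi) = w (x o phi)], as [b o phi > 0] where [w] does not vanish. Closedness of
    [C] follows from this equality. *)
Lemma adjoint_adjoint_wcomp : adjoint ip (adjoint ip C) = C.
Proof.
apply/seteqP; split => -[x y]; last first.
  move=> Cxy; apply/adjoint_rdotP; first by move=> *; exact: adjointZ.
  move=> u v /(adjoint_rdotP _ _ _ wcompZ) H.
  by rewrite rdotC -(H _ _ Cxy) rdotC.
move=> /adjoint_rdotP H; have {}H := H (fun (a : R[i]) u v => @adjointZ _ _ ip C a u v).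
have cy := ckap_kap mw mphi dom hfin y; have bk : bfin (kap y) by case: cy.
have mk : cmeasurable (kap y) by case: bk.
have bx : {ae mu, forall t, rmul b (repr x) t = rmul b (kap y) t}.
  apply: ae_eq_of_test => //; [|exact: cmeasurable_rmul|].
    by apply: cmeasurable_rmul => //; case: (sq_repr x).
  move=> c tc; have bc := test_bfin tc; have sbc := test_bsq tc.
  have := H (L2of (wphi c)) (L2of (rmul b c)).
  rewrite (rdotC _ (L2of (wphi c)) y) (rdot_wphi mw mphi dom hfin cy bc) bformE => <-.
    rewrite -{2}(L2of_repr x) rdot_L2of//; last exact: sq_repr.
    congr fine; apply: eq_integral => t _; congr EFin; rewrite /cross /rmul.
    by case: (c t) (repr x t) => ? ? [? ?] /=; ring.
  by apply/(adjoint_wcompE _ (ckap_wphi mw mphi dom hfin bc)).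
have Py : cproj phi w y = y.
  have orth c : bfin c -> rdot ip (y - cproj phi w y) (L2of (wphi c)) = 0.
    exact: (rdot_cproj mw mphi dom hfin).
  have A0 : adjoint ip C (y - cproj phi w y, 0).
    apply/(adjoint_rdotP _ _ _ wcompZ) => u v.
    rewrite -{1}(L2of_repr u) => /wcompE[|bf ->]; first exact: sq_repr.
    by rewrite rdotC orth// rdot0r.
  have := H _ _ A0; rewrite rdot0l => yE.
  have E : sqn ip (y - cproj phi w y) = 0.
    by rewrite /sqn rdotBr -yE orth// subrr.
  by apply/eqP; rewrite eq_sym -subr_eq0 (sqn_eq0 E).
have bkx : {ae mu, forall t, kap y t * (b t)%:C%C = repr x t * (b t)%:C%C}.
  by apply: filterS bx => t; rewrite /rmul => h; rewrite mulrC -h mulrC.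
have mx : cmeasurable (repr x) by case: (sq_repr x).
have Wk := wphi_ae mw mphi dom hfin bkx.
have bfx : bfin (repr x).
  apply/(sq_wphi mw mphi dom hfin) => //.
  apply: (sq_ae _ Wk); first exact: cmeasurable_wphi.
  exact: bfin_sq.
rewrite -{1}(L2of_repr x); apply/wcompE; first exact: sq_repr.
by split=> //; rewrite -[LHS]Py; exact: L2of_wphi_ae.
Qed.

Lemma wcomp_adjoint_wcomp : opcomp C (adjoint ip C) = mult_op (b \o phi) (cproj phi w) id.
Proof.
have mbp : measurable_fun setT (b \o phi) by exact: measurableT_comp.
apply/seteqP; split => -[u v]; rewrite /opcomp /mult_op/=;
  have ck := ckap_kap mw mphi dom hfin u; have bk : bfin (kap u) by case: ck.
- have mk : cmeasurable (kap u) by case: bk.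
  have E : {ae mu, forall x, wphi (rmul b (kap u)) x = rmul (b \o phi) (repr (cproj phi w u)) x}.
    apply: filterS (repr_L2of (bfin_sq mw mphi dom hfin bk)) => x h.
    by rewrite -rmul_wphi /rmul/= h.
  have mr : cmeasurable (rmul (b \o phi) (repr (cproj phi w u))).
    by apply: cmeasurable_rmul => //; case: (sq_repr (cproj phi w u)).
  move=> [y /(adjoint_wcompE _ ck)[sbk ->]] /wcompE -/(_ sbk)[bbk ->].
  have sw := bfin_sq mw mphi dom hfin bbk; have sr := sq_ae mr E sw.
  by split=> //; apply/L2of_eq.
- have mk : cmeasurable (kap u) by case: bk.
  have E : {ae mu, forall x, rmul (b \o phi) (repr (cproj phi w u)) x = wphi (rmul b (kap u)) x}.
    apply: filterS (repr_L2of (bfin_sq mw mphi dom hfin bk)) => x h.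
    by rewrite -rmul_wphi /rmul/= h.
  have mbk : cmeasurable (rmul b (kap u)) by exact: cmeasurable_rmul.
  move=> [sr ->]; have sw := sq_ae (cmeasurable_wphi mw mphi mbk) E sr.
  have bbk : bfin (rmul b (kap u)) by apply/(sq_wphi mw mphi dom hfin).
  have sbk : sq (rmul b (kap u)).
    split=> //; under eq_integral do rewrite normc_rmul mulrC.
    apply: (sum_lty mk mb (measurable_funX 3 mb)) => //.
    + by move=> x; exact: exprn_ge0.
    + by move=> x; exact: measurable_funX.
    + by move=> x; rewrite sqr_ge0/=; have := b0 x; have := sqr_ge0 (b x - 1); nra.
    + by case: bk.
    + case: bbk => _; congr (_ < _)%E; apply: eq_integral => x _.
      by rewrite normc_rmul; congr EFin; ring.
  exists (L2of (rmul b (kap u))); first by apply/(adjoint_wcompE _ ck).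
  by apply/wcompE => //; split=> //; apply/L2of_eq.
Qed.

Lemma linear_wcomp : linear_operator C.
Proof.
have s0 := square_integrable0 mu.
split.
- rewrite -adjoint_adjoint_wcomp; exact: adjoint0.
- move=> c u v u' v'; rewrite -adjoint_adjoint_wcomp; exact: adjoint_linear.
- move=> v; rewrite -(L2of0 mu) => /wcompE[//|_ ->].
  by rewrite L2of_wphi0 L2of0.
Qed.

Lemma closed_wcomp : closed_operator ip C.
Proof.
rewrite -adjoint_adjoint_wcomp; apply: adjoint_closed => c u v; exact: adjointZ.
Qed.
End weighted_composition_operator.

Lemma hnorm_le (R : realType) (V : lmodType R[i]) (ip : {dot V for Num.conj}) (u v : V) :
  (hnorm ip u <= hnorm ip v) = (sqn ip u <= sqn ip v).
Proof. by rewrite -!hnorm_sqr ler_pXn2r// nnegrE sqrtr_ge0. Qed.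

Lemma p_hyponormal_rewrite (R : realType) (V : lmodType R[i]) (ip : {dot V for Num.conj})
    (p : R) (A T1 T2 : set (V * V)) :
  oppow ip (opabs ip A) p = T1 -> oppow ip (opabs ip (adjoint ip A)) p = T2 ->
  p_hyponormal ip p A <->
  [/\ linear_operator A, closed_operator ip A, densely_defined ip A, opdom T1 `<=` opdom T2
    & forall f g g', T1 (f, g) -> T2 (f, g') -> hnorm ip g' <= hnorm ip g].
Proof. by move=> <- <-. Qed.

Lemma hnorm_le_L2of d (X : measurableType d) (R : realType) (mu : {measure set X -> \bar R})
    (f g : X -> R[i]) : square_integrable mu f -> square_integrable mu g ->
  hnorm (L2dot mu) (L2of mu f) <= hnorm (L2dot mu) (L2of mu g) <->
  (\int[mu]_x (normc (f x) ^+ 2)%:E <= \int[mu]_x (normc (g x) ^+ 2)%:E)%E.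
Proof.
by move=> sf sg; rewrite -(sqn_L2of sf) -(sqn_L2of sg) lee_fin hnorm_le.
Qed.

(** * Hyponormality as an integral inequality *)

Section hyponormality.
Context d (X : measurableType d) (R : realType).
Variables (mu : {sigma_finite_measure set X -> \bar R}) (phi : X -> X) (w : X -> R[i]).
Hypotheses (mw : cmeasurable w) (mphi : measurable_fun setT phi).
Hypothesis dom : weighted_pushforward mu phi w `<< mu.
Hypothesis hfin : {ae mu, forall x, (wcomp_deriv mu phi w x < +oo)%E}.
Local Notation b := (wcomp_derivR mu phi w).
Local Notation om := (weight w).
Local Notation ip := (L2dot mu).
Local Notation sq := (square_integrable mu).
Local Notation L2of := (L2of mu).
Local Notation kap := (kap (mu := mu) phi w).
Local Notation cproj := (cproj (mu := mu) phi w).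
Local Notation C := (wcomp mu phi w).
Variable p : R.
Hypothesis p0 : 0 < p.
Local Notation q := (fun x => b x `^ p).

Let b0 : forall x, (0 <= b x)%R := wcomp_derivR_ge0 mw mphi dom.
Let mb : measurable_fun setT b := measurable_wcomp_derivR mw mphi dom.

Let mpow (s : R) (a : X -> R) : measurable_fun setT a -> measurable_fun setT (fun x => a x `^ s).
Proof. by move=> ma; exact: (measurableT_comp (measurable_powR s)). Qed.

Lemma powR_half_sqr (t : R) : ((t `^ 2^-1) `^ p) ^+ 2 = t `^ p.
Proof.
rewrite -powRrM -(powR_mulrn 2) ?powR_ge0// -powRrM; congr (_ `^ _).
by field.
Qed.

(** The outer power can be computed only for an operator of the form [mult_op _ P id], so the square
    root is moved from the function into the multiplier in between. *)
Lemma oppow_oppow_mult_op (a : X -> R) P : measurable_fun setT a -> (forall x, 0 <= a x) ->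
  (forall (c : R[i]) u v, P (c *: u + v) = c *: P u + P v) ->
  (forall u, P (P u) = P u) -> (forall u v, ip (P u) v = ip u (P v)) ->
  (forall (rho : R -> R) f, measurable_fun setT rho ->
    sq f -> P (L2of f) = L2of f -> sq (rmul (rho \o a) f) ->
    P (L2of (rmul (rho \o a) f)) = L2of (rmul (rho \o a) f)) ->
  oppow ip (oppow ip (mult_op a P id) 2^-1) p =
  mult_op (fun x => a x `^ 2^-1) P (fun t => t `^ p).
Proof.
move=> ma a0 Pl Pi Ps Pm; rewrite (oppow_mult_op ma a0 Pl Pi Ps Pm) ?invr_gt0//.
rewrite (_ : mult_op a P _ = mult_op (fun x => a x `^ 2^-1) P id)//.
apply: oppow_mult_op => //; first exact: mpow.
  by move=> x; exact: powR_ge0.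
move=> rho f mrho sf Pf s.
exact: (Pm (fun t => rho (t `^ 2^-1)) f (measurableT_comp mrho (measurable_powR _))).
Qed.

Let A1 (u : L2space mu) := rmul ((fun t => t `^ p) \o (fun x => b x `^ 2^-1)) (repr u).
Let A2 (u : L2space mu) := rmul ((fun t => t `^ p) \o (fun x => (b (phi x)) `^ 2^-1)) (repr (cproj u)).

Let cA1 u : cmeasurable (A1 u).
Proof. by apply: cmeasurable_rmul; [do 2!apply: mpow|case: (sq_repr u)]. Qed.

Let mbp : measurable_fun setT (fun x => b (phi x)).
Proof. exact: (measurableT_comp mb mphi). Qed.

Let cA2 u : cmeasurable (A2 u).
Proof. by apply: cmeasurable_rmul; [do 2!apply: mpow|case: (sq_repr (cproj u))]. Qed.

Let IA1 u : (\int[mu]_x (normc (A1 u x) ^+ 2)%:E = \int[mu]_x (q x * normc (repr u x) ^+ 2)%:E)%E.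
Proof. by apply: eq_integral => x _; rewrite normc_rmul/= powR_half_sqr. Qed.

Let IA2 u : (\int[mu]_x (normc (A2 u x) ^+ 2)%:E =
  \int[mu]_x (q x * (normc (kap u x) ^+ 2 * b x))%:E)%E.
Proof.
have bk := bfin_kap mw mphi dom hfin u; have mk : cmeasurable (kap u) by case: bk.
have mkp := cmeasurable_comp mphi mk.
have mg : measurable_fun setT (fun x => q x * normc (kap u x) ^+ 2).
  by apply: measurable_funM; [exact: mpow|exact: measurable_sqr_normc].
have := transfer_bR mw mphi dom hfin measurableT mg; rewrite preimage_setT => E.
transitivity (\int[mu]_x (q (phi x) * normc (kap u (phi x)) ^+ 2 * om x)%:E)%E; last first.
  by rewrite E; apply: eq_integral => x _; rewrite -mulrA.
apply: ae_eq_integral => //.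
- exact/measurable_EFinP/(measurable_sqr_normc (cA2 u)).
- apply/measurable_EFinP; apply: measurable_funM; last exact: measurable_weight.
  by apply: measurable_funM; [exact: mpow|exact: measurable_sqr_normc].
- apply: filterS (repr_L2of (bfin_sq mw mphi dom hfin bk)) => x h _; congr EFin.
  by rewrite normc_rmul/= powR_half_sqr [in LHS]h normc_wphi mulrA.
Qed.

(** The inequality over all [u] contains the inclusion of domains: its right side is finite exactly
    for [u] in the domain of [|C|^p], and when infinite it asserts nothing. *)
Lemma p_hyponormalP : densely_defined ip C ->
  p_hyponormal ip p C <->
  forall u, (\int[mu]_x (q x * (normc (kap u x) ^+ 2 * b x))%:E <=
             \int[mu]_x (q x * normc (repr u x) ^+ 2)%:E)%E.
Proof.
move=> dd.
have T1 : oppow ip (opabs ip C) p = mult_op (fun x => b x `^ 2^-1) idfun (fun t => t `^ p).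
  by rewrite /opabs (adjoint_wcomp_wcomp mw mphi dom hfin) oppow_oppow_mult_op.
have T2 : oppow ip (opabs ip (adjoint ip C)) p =
    mult_op (fun x => (b \o phi) x `^ 2^-1) cproj (fun t => t `^ p).
  rewrite /opabs (adjoint_adjoint_wcomp mw mphi dom hfin) (wcomp_adjoint_wcomp mw mphi dom hfin).
  apply: (oppow_oppow_mult_op (a := b \o phi)).
  - exact: mbp.
  - by move=> x; exact: b0.
  - exact: (cproj_linear mw mphi dom hfin).
  - exact: (cproj_idem mw mphi dom hfin).
  - exact: (cproj_selfadj mw mphi dom hfin).
  - exact: (cproj_mul mw mphi dom hfin).
apply: (iff_trans (p_hyponormal_rewrite T1 T2)); split=> [[_ _ _ Hd Hn] u|H].
- rewrite -IA1 -IA2.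
  have [I1|] := ltP (\int[mu]_x (normc (A1 u x) ^+ 2)%:E)%E +oo%E; last first.
    by apply: le_trans; exact: leey.
  have s1 : sq (A1 u) by [].
  have [v [s2 _]] := Hd u (ex_intro _ (L2of (A1 u)) (conj s1 erefl)).
  apply: (hnorm_le_L2of s2 s1).1.
  exact: Hn u (L2of (A1 u)) (L2of (A2 u)) (conj s1 erefl) (conj s2 erefl).
- have S u : sq (A1 u) -> sq (A2 u).
    move=> [_ I1]; split; first exact: cA2.
    by rewrite IA2; apply: le_lt_trans (H u) _; rewrite -IA1; exact: I1.
  split.
  + exact: (linear_wcomp mw mphi dom hfin).
  + exact: (closed_wcomp mw mphi dom hfin).
  + exact: dd.
  + by move=> u [v [s1 _]]; exists (L2of (A2 u)); split; [exact: S|].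
  + move=> u g g' [s1 E1] [s2 E2].
    have {}E1 : g = L2of (A1 u) := E1; have {}E2 : g' = L2of (A2 u) := E2.
    rewrite E1 E2.
    apply: (hnorm_le_L2of s2 s1).2; move: (H u).
    by rewrite -IA1 -IA2.
Qed.
End hyponormality.

(** * The integrated criterion *)

Section weight_criterion.
Context d (X : measurableType d) (R : realType).
Variables (mu : {sigma_finite_measure set X -> \bar R}) (phi : X -> X) (w : X -> R[i]).
Hypotheses (mw : cmeasurable w) (mphi : measurable_fun setT phi).
Hypothesis dom : weighted_pushforward mu phi w `<< mu.
Hypothesis hfin : {ae mu, forall x, (wcomp_deriv mu phi w x < +oo)%E}.
Local Notation h := (wcomp_deriv mu phi w).
Local Notation b := (wcomp_derivR mu phi w).
Local Notation om := (weight w).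
Local Notation sq := (square_integrable mu).
Local Notation L2of := (L2of mu).
Local Notation Re := (@complex.Re R).
Local Notation Im := (@complex.Im R).
Local Notation kap := (kap (mu := mu) phi w).
Local Notation cond := (cond mu phi w).
Variable p : R.
Hypothesis p0 : (0 < p)%R.
Local Notation q := (fun x => b x `^ p).
Local Open Scope ereal_scope.

Let b0 : forall x, (0 <= b x)%R := wcomp_derivR_ge0 mw mphi dom.
Let mb : measurable_fun setT b := measurable_wcomp_derivR mw mphi dom.
Let o0 : forall x, (0 <= om x)%R := weight_ge0 w.
Let mo : measurable_fun setT om := measurable_weight mw.
Let mq : measurable_fun setT (q : X -> R) := measurableT_comp (measurable_powR p) mb.
Let q0 x : (0 <= q x)%R. Proof. exact: powR_ge0. Qed.
Let q_gt0 x : (0 < b x)%R -> (0 < q x)%R. Proof. exact: powR_gt0. Qed.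
Let mpre D : measurable D -> measurable (phi @^-1` D).
Proof. exact: measurable_preimageT. Qed.

Definition cproj_bounded := forall u : L2space mu,
  \int[mu]_x (q x * (normc (kap u x) ^+ 2 * b x))%:E <=
  \int[mu]_x (q x * normc (repr u x) ^+ 2)%:E.

(** The common consequence of (i), (ii) and (iii) from which the integrated criterion is derived:
    only finite nonnegative [f] in [L^2(mu_w)] are tested. *)
Definition cond_bounded := forall (f : X -> R) e, measurable_fun setT f -> (forall x, (0 <= f x)%R) ->
  \int[mu]_x (f x ^+ 2 * om x)%:E < +oo -> cond (EFin \o f) e ->
  \int[mu]_x (q x * (fine (e x) ^+ 2 * b x))%:E <= \int[mu]_x (q x * (f x ^+ 2 * om x))%:E.

Lemma weighted_divw_le f : sq f ->
  \int[mu]_x (q x * (normc (divw w f x) ^+ 2 * om x))%:E <=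
  \int[mu]_x (q x * normc (f x) ^+ 2)%:E.
Proof.
move=> [mf _]; apply: ge0_le_integral => //.
- by move=> x _; rewrite lee_fin mulr_ge0// mulr_ge0// sqr_ge0.
- apply/measurable_EFinP; apply: measurable_funM => //; apply: measurable_funM => //.
  exact/measurable_sqr_normc/cmeasurable_divw.
- by apply/measurable_EFinP; apply: measurable_funM => //; exact: measurable_sqr_normc.
- by move=> x _; rewrite lee_fin ler_wpM2l// normc_divw_le.
Qed.

Lemma cproj_bounded_weight : weight_pair mu phi w q q -> cproj_bounded.
Proof.
move=> qs u; have [_ [_ _ _ J]] := kapP mw mphi dom hfin u.
by apply: le_trans (J _ _ qs) _; exact: weighted_divw_le (sq_repr u).
Qed.

(** The hypothesis is applied to [u = f w]. Then [u_w = f] where [w] does not vanish, so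
    [Re (kap u)] and [e] agree where [b > 0], while [|u|^2 = f^2 |w|^2]. *)
Lemma cond_bounded_cproj : cproj_bounded -> cond_bounded.
Proof.
move=> H f e mf f0 If ce; have [me e0 eE] := ce.
have nf x : (normc (rmul f w x) ^+ 2 = f x ^+ 2 * om x)%R by rewrite normc_rmul.
have mF : cmeasurable (rmul f w) by exact: cmeasurable_rmul.
have sF : sq (rmul f w) by split=> //; under eq_integral do rewrite nf.
pose u := L2of (rmul f w); have ck := ckap_kap mw mphi dom hfin u.
have [bk pr _] := ck; have [mk Ik] := bk; have [kr ki] := mk.
have [Ikr _] := normc_lty mb b0 mk Ik.
have [eb J] := jensen_fine mw mphi dom hfin mf f0 If ce.
have Ie := jensen1 mw mphi dom hfin J If.
have mfe : measurable_fun setT (fun x => fine (e x)) by exact: measurableT_comp.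
have mD := cmeasurable_divw mw (sq_repr u).1.
have Df : {ae mu, forall x, (Re (divw w (repr u) x) * om x = f x * om x)%R}.
  apply: filterS (repr_L2of sF) => x; rewrite -/u /divw; have [w0 _|w0 ->] := eqVneq (w x) 0%R.
    have -> : om x = 0%R by apply/eqP; rewrite weight_neq0 w0.
    by rewrite !mulr0.
  by rewrite /rmul mulfK.
have U : {ae mu, forall x, (fine (e x) * b x = Re (kap u x) * b x)%R}.
  apply: (cond_real_unique mw mphi dom mfe kr Ie Ikr) => D mD' ID; congr fine.
  transitivity (\int[mu]_(x in D) (e x * (b x)%:E)).
    apply: ge0_ae_eq_integral => //.
    - by apply: measurable_funTS; apply/measurable_EFinP; exact: measurable_funM.
    - by apply: measurable_funTS; apply: emeasurable_funM => //; exact/measurable_EFinP.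
    - by move=> x _; rewrite lee_fin mulr_ge0// fine_ge0.
    - by move=> x _; rewrite mule_ge0// lee_fin.
    - by apply: filterS eb => x ->.
  rewrite -eE// -(cpair_set mphi pr mD' ID); apply: ae_eq_integral; first exact: mpre.
  - by apply: measurable_funTS; apply/measurable_EFinP; exact: measurable_funM.
  - by apply: measurable_funTS; apply/measurable_EFinP; apply: measurable_funM => //; case: mD.
  - by apply: filterS Df => x hx _; rewrite hx.
apply: (@le_trans _ _ (\int[mu]_x (q x * (normc (kap u x) ^+ 2 * b x))%:E)).
  apply: ae_ge0_le_integralT.
  - apply/measurable_EFinP; apply: measurable_funM => //; apply: measurable_funM => //.
    exact: measurable_funX.
  - by move=> x; rewrite lee_fin mulr_ge0// mulr_ge0// sqr_ge0.
  - apply/measurable_EFinP; apply: measurable_funM => //; apply: measurable_funM => //.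
    exact: measurable_sqr_normc.
  - by move=> x; rewrite lee_fin mulr_ge0// mulr_ge0// sqr_ge0.
  - apply: filterS U => x ux; rewrite lee_fin ler_wpM2l// expr2 -mulrA ux mulrA [X in (X * _)%R]mulrC -mulrA ux.
    by rewrite mulrA -expr2 ler_wpM2r// Defs.sqr_normc lerDl sqr_ge0.
apply: le_trans (H u) _; rewrite le_eqVlt; apply/orP; left; apply/eqP; apply: ae_eq_integral => //.
- by apply/measurable_EFinP; apply: measurable_funM => //; exact: measurable_sqr_normc (sq_repr u).1.
- apply/measurable_EFinP; apply: measurable_funM => //; apply: measurable_funM => //.
  exact: measurable_funX.
- by apply: filterS (repr_L2of sF) => x -> _; rewrite nf.
Qed.

Let int_cond (f : X -> R) e : measurable_fun setT f -> (forall x, (0 <= f x)%R) ->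
  cond (EFin \o f) e -> {ae mu, forall x, e x * (b x)%:E = (fine (e x) * b x)%:E} ->
  forall k : X -> R, measurable_fun setT k -> (forall x, (0 <= k x)%R) ->
  \int[mu]_x (k (phi x) * (f x * om x))%:E = \int[mu]_x (k x * (fine (e x) * b x))%:E.
Proof.
move=> mf f0 ce eb k mk k0; have [me e0 _] := ce.
have mfE : measurable_fun setT (EFin \o f) by exact/measurable_EFinP.
have := transfer_cond mw mphi dom mfE _ ce (k := fun x => (k x)%:E).
have -> : \int[mu]_x ((k (phi x))%:E * ((EFin \o f) x * (om x)%:E)) =
  \int[mu]_x (k (phi x) * (f x * om x))%:E by [].
move=> ->; [|by move=> x; rewrite lee_fin|exact/measurable_EFinP|by []].
apply: ae_ge0_eq_integralT.
- apply: emeasurable_funM; first exact/measurable_EFinP.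
  by apply: emeasurable_funM => //; exact/measurable_EFinP.
- by move=> x; rewrite !mule_ge0 ?lee_fin.
- apply/measurable_EFinP; apply: measurable_funM => //; apply: measurable_funM => //.
  exact: measurableT_comp.
- by move=> x; rewrite lee_fin mulr_ge0// mulr_ge0// fine_ge0.
- by apply: filterS eb => x ->.
Qed.

Let indic_sqr (A : set X) x : (\1_A x ^+ 2 = \1_A x :> R)%R.
Proof. by rewrite indicE; case: (_ \in _); rewrite ?expr1n ?expr0n. Qed.

Let finite_trunc (f : X -> R) (Y : set X) (K L : R) : measurable_fun setT f ->
  (0 <= K)%R -> (0 <= L)%R ->
  measurable Y -> mu Y < +oo -> (forall x, ~ Y x -> f x = 0%R) ->
  (forall x, Y x -> (f x ^+ 2 <= K)%R /\ (om x <= L)%R) ->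
  \int[mu]_x (f x ^+ 2 * om x)%:E < +oo.
Proof.
move=> mf K0 L0 mY Yfin fY fK.
apply: (@le_integral_lty _ _ _ _ _ (fun x => K * L * \1_Y x)%R).
- by apply: measurable_funM => //; exact: measurable_funX.
- by move=> x; rewrite mulr_ge0// sqr_ge0.
- by apply: measurable_funM => //; exact: measurable_indic.
- move=> x; rewrite indicE; have [xY|xY] := boolP (x \in Y); last first.
    by rewrite fY ?expr0n ?mul0r ?mulr0// => /mem_set; apply/negP.
  by rewrite inE in xY; have [fx ox] := fK _ xY; rewrite mulr1 ler_pM// sqr_ge0.
under eq_integral do rewrite EFinM.
rewrite ge0_integralZl//; try exact: measurable_indicE; try by rewrite lee_fin mulr_ge0.
by rewrite integral_indic// setIT; apply: lte_mul_pinfty => //; rewrite lee_fin mulr_ge0.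
Qed.

(** For [f] the indicator of a piece of the zero set of [b] the right side is [0], since [0^p = 0].
    Hence [e b = 0] almost everywhere, and the [mu_w]-measure of the piece is [\int e b dmu = 0]. *)
Lemma cond_bounded_deriv_gt0 : cond_bounded -> {ae mu, forall x, w x != 0%R -> (0 < b x)%R}.
Proof.
move=> H; have [Y [mY Yfin _ YT Yle]] := finite_sublevel_cover mu mo.
have mZ : measurable [set x | b x = 0%R].
  by have := mb measurableT (measurable_set1 0%R); rewrite setTI.
have key n : {ae mu, forall x, b x = 0%R -> Y n x -> om x = 0%R}.
  pose Z := [set x | b x = 0%R] `&` Y n; have mZn : measurable Z by exact: measurableI.
  have mf : measurable_fun setT (\1_Z : X -> R) by exact: measurable_indic.
  have f0 x : (0 <= (\1_Z x : R))%R by rewrite indicE.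
  have If : \int[mu]_x (\1_Z x ^+ 2 * om x)%:E < +oo.
    apply: (@finite_trunc _ (Y n) 1 n%:R) => //; try exact: Yfin.
    - by move=> x nY; rewrite indicE memNset// => -[].
    - by move=> x /Yle; rewrite indic_sqr indicE; case: (_ \in _).
  have mfE : measurable_fun setT (EFin \o (\1_Z : X -> R)) by exact/measurable_EFinP.
  have f0E x : 0 <= (EFin \o (\1_Z : X -> R)) x by rewrite lee_fin.
  have [e ce] := cond_exists mw mphi dom hfin mfE f0E; have [me e0 _] := ce.
  have [eb J] := jensen_fine mw mphi dom hfin mf f0 If ce.
  have mfe : measurable_fun setT (fun x => fine (e x)) by exact: measurableT_comp.
  have I0 : \int[mu]_x (q x * (fine (e x) ^+ 2 * b x))%:E = 0.
    apply/eqP; rewrite eq_le; apply/andP; split; last first.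
      by apply: integral_ge0 => x _; rewrite lee_fin mulr_ge0// mulr_ge0// sqr_ge0.
    apply: (le_trans (H _ _ mf f0 If ce)); rewrite integral0_eq// => x _.
    rewrite indic_sqr indicE; have [|_] := boolP (x \in Z); last by rewrite mul0r mulr0.
    by rewrite inE => -[/= -> _]; rewrite powR0 ?mul0r// gt_eqF.
  have m1 : measurable_fun setT (fun x => (q x * (fine (e x) ^+ 2 * b x))%:E).
    apply/measurable_EFinP; apply: measurable_funM => //; apply: measurable_funM => //.
    exact: measurable_funX.
  have p1 x : 0 <= (q x * (fine (e x) ^+ 2 * b x))%:E.
    by rewrite lee_fin mulr_ge0// mulr_ge0// sqr_ge0.
  have ae0 := ge0_integral_eq0_ae measurableT m1 p1 I0.
  have E := int_cond mf f0 ce eb (@measurable_cst _ _ X R setT 1%R) (fun=> ler01).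
  have : \int[mu]_x (\1_Z x * om x)%:E = 0.
    transitivity (\int[mu]_x (cst 1%R (phi x) * (\1_Z x * om x))%:E).
      by apply: eq_integral => x _; rewrite mul1r.
    rewrite E; apply: ae_ge0_integral_eq0 => //.
    - by apply/measurable_EFinP; apply: measurable_funM => //; exact: measurable_funM.
    - by move=> x; rewrite lee_fin mulr_ge0// mulr_ge0// fine_ge0.
    - apply: filterS ae0 => x /(_ I) [] /eqP Ex _; congr EFin; rewrite /= mul1r.
      have [bx|bx] := eqVneq (b x) 0%R; first by rewrite bx mulr0.
      have qx : q x != 0%R by rewrite gt_eqF// q_gt0// lt_neqAle eq_sym bx b0.
      move: Ex; rewrite mulf_eq0 (negbTE qx) /= mulf_eq0 (negbTE bx) orbF sqrf_eq0 => /eqP ->.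
      by rewrite mul0r.
  have m2 : measurable_fun setT (fun x => (\1_Z x * om x)%:E).
    by apply/measurable_EFinP; exact: measurable_funM.
  have p2 x : 0 <= (\1_Z x * om x)%:E by rewrite lee_fin mulr_ge0.
  move=> /(ge0_integral_eq0_ae measurableT m2 p2); apply: filterS => x /(_ I) + bx Yx.
  by rewrite indicE mem_set//= mul1r => -[].
apply: filterS (ae_foralln key) => x kx w0; rewrite lt_neqAle b0 andbT eq_sym; apply/eqP => bx.
have [n Yn] := YT x; have /eqP := kx n bx Yn.
by rewrite weight_neq0 (negbTE w0).
Qed.

(** The condition [q f^2 = f] makes the right side linear in [f], so that after localization by the
    indicator of [D] at [phi] it equals the integral of [e b] over [D]. As [D] is arbitrary, a
    pointwise inequality results, in which [e] is cancelled where it is positive. *)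
Lemma cond_bounded_step (f : X -> R) : cond_bounded ->
  measurable_fun setT f -> (forall x, (0 <= f x)%R) ->
  \int[mu]_x (f x ^+ 2 * om x)%:E < +oo -> (forall x, (q x * f x ^+ 2 = f x)%R) ->
  forall k : X -> R, measurable_fun setT k -> (forall x, (0 <= k x)%R) ->
  \int[mu]_x (k (phi x) * q (phi x) * (f x * om x))%:E <= \int[mu]_x (k x * b x)%:E.
Proof.
move=> H mf f0 If qf k mk k0.
have mfE : measurable_fun setT (EFin \o f) by exact/measurable_EFinP.
have f0E x : 0 <= (EFin \o f) x by rewrite lee_fin.
have [e ce] := cond_exists mw mphi dom hfin mfE f0E; have [me e0 _] := ce.
have [eb J] := jensen_fine mw mphi dom hfin mf f0 If ce.
have mfe : measurable_fun setT (fun x => fine (e x)) by exact: measurableT_comp.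
have fe0 x : (0 <= fine (e x))%R by exact: fine_ge0.
have m1 : measurable_fun setT (fun x => (q x * (fine (e x) ^+ 2 * b x))%:E).
  apply/measurable_EFinP; apply: measurable_funM => //; apply: measurable_funM => //.
  exact: measurable_funX.
have m2 : measurable_fun setT (fun x => (fine (e x) * b x)%:E).
  by apply/measurable_EFinP; exact: measurable_funM.
have ineq : {ae mu, forall x, (q x * (fine (e x) ^+ 2 * b x))%:E <= (fine (e x) * b x)%:E}.
  apply: ae_le_of_integral => //.
  - by move=> x; rewrite lee_fin mulr_ge0// mulr_ge0// sqr_ge0.
  - by move=> x; rewrite lee_fin mulr_ge0.
  move=> D mD; have mi : measurable_fun setT (\1_D : X -> R) by exact: measurable_indic.
  have i0 x : (0 <= (\1_D x : R))%R by rewrite indicE.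
  pose fD x := (\1_D (phi x) * f x)%R.
  have mfD : measurable_fun setT fD.
    by apply: measurable_funM => //; exact: (measurableT_comp mi mphi).
  have fD0 x : (0 <= fD x)%R by exact: mulr_ge0.
  have IfD : \int[mu]_x (fD x ^+ 2 * om x)%:E < +oo.
    apply: le_integral_lty If.
    - by apply: measurable_funM => //; exact: measurable_funX.
    - by move=> x; rewrite mulr_ge0// sqr_ge0.
    - by apply: measurable_funM => //; exact: measurable_funX.
    - move=> x; rewrite ler_wpM2r// exprMn indic_sqr ler_piMl ?sqr_ge0//.
  have := H fD _ mfD fD0 IfD (cond_localize mphi mD ce).
  have -> : \int[mu]_x (q x * (fD x ^+ 2 * om x))%:E = \int[mu]_(x in D) (fine (e x) * b x)%:E.
    rewrite [RHS]integral_indicM//.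
    have -> : \int[mu]_x ((\1_D x)%:E * (fine (e x) * b x)%:E) =
      \int[mu]_x (\1_D x * (fine (e x) * b x))%:E by [].
    rewrite -(int_cond mf f0 ce eb mi i0); apply: eq_integral => x _; congr EFin.
    by rewrite -[f x in RHS]qf /fD exprMn indic_sqr; ring.
  congr (_ <= _); rewrite [RHS]integral_indicM//; apply: eq_integral => x _.
  rewrite -EFinM; congr EFin; rewrite indicE; case: (_ \in D).
    by rewrite mul1e mul1r.
  by rewrite mul0e /= expr0n !mul0r mulr0.
have -> : \int[mu]_x (k (phi x) * q (phi x) * (f x * om x))%:E =
    \int[mu]_x (k x * q x * (fine (e x) * b x))%:E.
  apply: (int_cond mf f0 ce eb (k := fun x => k x * q x)%R); first exact: measurable_funM.
  by move=> x; rewrite mulr_ge0.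
apply: ae_ge0_le_integralT.
- by apply/measurable_EFinP; apply: measurable_funM; exact: measurable_funM.
- by move=> x; rewrite lee_fin !mulr_ge0.
- by apply/measurable_EFinP; exact: measurable_funM.
- by move=> x; rewrite lee_fin mulr_ge0.
- apply: filterS ineq => x; rewrite !lee_fin => ie; rewrite -mulrA ler_wpM2l//.
  have [->|ex] := eqVneq (fine (e x)) 0%R; first by rewrite mul0r mulr0.
  have ep : (0 < fine (e x))%R by rewrite lt_neqAle eq_sym ex fe0.
  rewrite -(ler_pM2l ep); apply: le_trans ie; rewrite le_eqVlt; apply/orP; left; apply/eqP; ring.
Qed.

Lemma weight_cond_bounded : cond_bounded -> weight_pair mu phi w q q.
Proof.
move=> H; split=> //.
  by apply: filterS (cond_bounded_deriv_gt0 H) => x wx /wx; exact: q_gt0.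
move=> k mk k0.
have miq : measurable_fun setT (fun x => (q x)^-1)%R := measurableT_comp (@measurable_invr R) mq.
have iq0 x : (0 <= (q x)^-1)%R by rewrite invr_ge0.
(* On [Y n] both [om] and [q^-1] are at most [n], which puts [f n] in [L^2(mu_w)]. *)
have ms : measurable_fun setT (fun x => om x + (q x)^-1)%R by exact: measurable_funD.
have [Y [mY Yfin ndY YT Yle]] := finite_sublevel_cover mu ms.
have mkp : measurable_fun setT (fun x => k (phi x)) := measurableT_comp mk mphi.
have mqp : measurable_fun setT (fun x => q (phi x)) := measurableT_comp mq mphi.
pose f n x := ((q x)^-1 * \1_(Y n) x)%R.
have mf n : measurable_fun setT (f n) by apply: measurable_funM => //; exact: measurable_indic.
have f0 n x : (0 <= f n x)%R by rewrite mulr_ge0// indicE.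
have step n : \int[mu]_x (k (phi x) * q (phi x) * (f n x * om x))%:E <= \int[mu]_x (k x * b x)%:E.
  apply: cond_bounded_step => //.
  - apply: (@finite_trunc _ (Y n) (n%:R ^+ 2) n%:R) => //; try exact: sqr_ge0; try exact: Yfin.
    + by move=> x nY; rewrite /f indicE memNset// mulr0.
    + move=> x Yx; have := Yle _ _ Yx; have := o0 x; have := iq0 x => i1 i2 i3; split; last lra.
      rewrite /f indicE mem_set// mulr1 ler_pXn2r ?nnegrE//; lra.
  - move=> x; rewrite /f exprMn indic_sqr mulrA; congr (_ * _)%R.
    (* Where [q = 0] the inverse is [0], and the identity [q f^2 = f] persists. *)
    have [->|qx] := eqVneq (q x) 0%R; first by rewrite mul0r invr0.
    by rewrite expr2 mulrA mulfV// mul1r.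
apply: (@ge0_integral_le_of_cvg _ _ _ mu (fun n x => (k (phi x) * q (phi x) * (f n x * om x))%:E)) => //.
- move=> n; apply/measurable_EFinP; apply: measurable_funM; first exact: measurable_funM.
  exact: measurable_funM.
- by move=> n x; rewrite lee_fin; apply: mulr_ge0; apply: mulr_ge0.
- move=> x m n mn; rewrite lee_fin ler_wpM2l ?mulr_ge0// ler_wpM2r// /f ler_wpM2l// !indicE.
  case: (boolP (x \in Y m)) => [xm|_]; last by rewrite ler0n.
  by rewrite mem_set//; have /subsetPset := ndY _ _ mn; apply; rewrite inE in xm.
- move=> x; have [m Ym] := YT x; apply: cvg_near_cst; near=> n.
  have Yn : Y n x.
    have mn : (m <= n)%N by near: n; exact: nbhs_infty_ge.
    by have /subsetPset := ndY _ _ mn; exact.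
  by rewrite /f indicE mem_set//; congr EFin; rewrite mulr1; ring.
Unshelve. all: by end_near.
Qed.
End weight_criterion.

Section ereal_inverse.
Local Open Scope ereal_scope.
Context d (X : measurableType d) (R : realType).

(** The extended inverse is [+oo] at [0], where the real inverse is [0]; the second summand makes up
    for this. *)
Lemma measurable_ge0_inve (u : X -> \bar R) : measurable_fun setT u -> (forall x, 0 <= u x) ->
  measurable_fun setT (fun x => (u x)^-1).
Proof.
move=> mu0 u0.
rewrite (_ : (fun x => _) =
    (fun x => ((fine (u x))^-1)%:E + +oo * (\1_[set y | u y = 0] x)%:E)).
  apply: emeasurable_funD.
    apply/measurable_EFinP; apply: (measurableT_comp (@measurable_invr R)).
    exact: measurableT_comp.
  apply: emeasurable_funM; first exact: measurable_cst.
  apply: measurable_indicE; have := mu0 measurableT _ (emeasurable_set1 0).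
  by rewrite setTI.
apply/funext => x; rewrite indicE; have := u0 x.
case ux : (u x) => [r| |]// _.
- have [r0|r0] := eqVneq r 0%R.
    by rewrite mem_set/= ?ux ?r0// inver eqxx invr0 mule1 add0e.
  rewrite memNset/= ?ux; last by move=> [] /eqP; rewrite (negbTE r0).
  by rewrite mule0 adde0 inver (negbTE r0).
- rewrite memNset/= ?ux// mule0 adde0 invr0.
  by rewrite invey.
Qed.
End ereal_inverse.

(** * The four assertions and the integrated criterion *)

Section theorem_equivalences.
Context d (X : measurableType d) (R : realType).
Variables (mu : {sigma_finite_measure set X -> \bar R}) (phi : X -> X) (w : X -> R[i]).
Hypotheses (mw : cmeasurable w) (mphi : measurable_fun setT phi).
Hypothesis dom : weighted_pushforward mu phi w `<< mu.
Hypothesis hfin : {ae mu, forall x, (wcomp_deriv mu phi w x < +oo)%E}.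
Local Notation h := (wcomp_deriv mu phi w).
Local Notation b := (wcomp_derivR mu phi w).
Local Notation om := (weight w).
Local Notation kap := (kap (mu := mu) phi w).
Local Notation mu_w := (weighted_measure mu w).
Variable p : R.
Hypothesis p0 : (0 < p)%R.
Local Notation q := (fun x => b x `^ p).
Local Notation WP := (weight_pair mu phi w q q).
Local Open Scope ereal_scope.

Let b0 : forall x, (0 <= b x)%R := wcomp_derivR_ge0 mw mphi dom.
Let mb : measurable_fun setT b := measurable_wcomp_derivR mw mphi dom.
Let o0 : forall x, (0 <= om x)%R := weight_ge0 w.
Let mo : measurable_fun setT om := measurable_weight mw.
Let mq : measurable_fun setT (q : X -> R) := measurableT_comp (measurable_powR p) mb.
Let q0 x : (0 <= q x)%R. Proof. exact: powR_ge0. Qed.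
Let mqE : measurable_fun setT (fun x => (q x)%:E). Proof. exact/measurable_EFinP. Qed.
Let moE : measurable_fun setT (fun x => (om x)%:E). Proof. exact/measurable_EFinP. Qed.
Let mbE : measurable_fun setT (fun x => (b x)%:E). Proof. exact/measurable_EFinP. Qed.
Let hP := wcomp_derivP mw mphi dom.
Let mh : measurable_fun setT h. Proof. by case: hP. Qed.
Let h0 x : 0 <= h x. Proof. by case: hP. Qed.
Let mhp : measurable_fun setT (fun x => h x `^ p).
Proof. exact: (measurableT_comp (measurable_poweR p) mh). Qed.
Let hE : {ae mu, forall x, h x = (b x)%:E} := ae_wcomp_derivE mw mphi dom hfin.
Let hpE : {ae mu, forall x, h x `^ p = (q x)%:E}.
Proof. by apply: filterS hE => x ->; rewrite poweR_EFin. Qed.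
Let qE0 x : 0 <= (q x)%:E. Proof. by rewrite lee_fin. Qed.
Let bE0 x : 0 <= (b x)%:E. Proof. by rewrite lee_fin. Qed.
Let oE0 x : 0 <= (om x)%:E. Proof. by rewrite lee_fin. Qed.

Lemma integral_derivM (G : X -> \bar R) : measurable_fun setT G -> (forall x, 0 <= G x) ->
  \int[mu]_x (h x `^ p * G x) = \int[mu]_x ((q x)%:E * G x).
Proof.
move=> mG G0; apply: ae_ge0_eq_integralT; try exact: emeasurable_funM.
- by move=> x; rewrite mule_ge0// poweR_ge0.
- by move=> x; rewrite mule_ge0.
- by apply: filterS hpE => x ->.
Qed.

Lemma integral_weighted_derivM (G : X -> \bar R) : measurable_fun setT G -> (forall x, 0 <= G x) ->
  \int[mu_w]_x (h x `^ p * G x) = \int[mu]_x ((q x)%:E * (G x * (om x)%:E)).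
Proof.
move=> mG G0; rewrite (integral_weighted_measureT mu mw); last 2 first.
- exact: emeasurable_funM.
- by move=> x; rewrite mule_ge0// poweR_ge0.
rewrite -integral_derivM; [|exact: emeasurable_funM|by move=> x; rewrite mule_ge0].
by apply: eq_integral => x _; rewrite muleA.
Qed.

Lemma integral_weighted_deriv_phiM (G : X -> \bar R) : measurable_fun setT G -> (forall x, 0 <= G x) ->
  \int[mu_w]_x (h (phi x) `^ p * G (phi x)) = \int[mu]_x ((q x)%:E * (G x * (b x)%:E)).
Proof.
move=> mG G0.
have mhG : measurable_fun setT (fun x => h x `^ p * G x) by exact: emeasurable_funM.
have hG0 x : 0 <= h x `^ p * G x by rewrite mule_ge0// poweR_ge0.
rewrite (integral_weighted_measureT mu mw (g := fun x => h (phi x) `^ p * G (phi x))); last 2 first.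
- exact: (measurableT_comp mhG mphi).
- by move=> x; exact: hG0.
rewrite (transfer_b mw mphi dom hfin mhG hG0).
rewrite -integral_derivM; [|exact: emeasurable_funM|by move=> x; rewrite mule_ge0].
by apply: eq_integral => x _; rewrite muleA.
Qed.

Let mnorm (k : X -> R[i]) : cmeasurable k ->
  measurable_fun setT (fun x => (normc (k x) ^+ 2)%:E).
Proof. by move=> mk; apply/measurable_EFinP; exact: measurable_sqr_normc. Qed.

Let norm0 (k : X -> R[i]) x : 0 <= (normc (k x) ^+ 2)%:E.
Proof. by rewrite lee_fin sqr_ge0. Qed.

Let msqE (g : X -> \bar R) : measurable_fun setT g -> measurable_fun setT (fun x => g x ^+ 2).
Proof.
move=> mg; rewrite (_ : (fun x => _) = (fun x => g x * g x)); last by apply/funext => x; rewrite expe2.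
exact: emeasurable_funM.
Qed.

Lemma condexpC_ineq_weight : WP -> forall f : L2fun mu,
  \int[mu_w]_x (h (phi x) `^ p * (normc (condexpC mu phi w (divw w f) x) ^+ 2)%:E)
  <= \int[mu]_x (h x `^ p * (normc (f x) ^+ 2)%:E).
Proof.
move=> qs f; have sf := L2funP f; have mf := cmeasurable_divw mw sf.1.
have [k kE ck] := condexpCP mw mphi dom hfin mf (divw_lty mw sf).
have [mk _ _ J] := ck.
rewrite integral_derivM//; last exact: mnorm sf.1.
rewrite (funext kE : _ = k \o phi).
rewrite (integral_weighted_deriv_phiM (G := fun x => (normc (k x) ^+ 2)%:E))//; last exact: mnorm.
exact: le_trans (J _ _ qs) (weighted_divw_le mw mphi dom p sf).
Qed.

Lemma cproj_bounded_condexpC :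
  (forall f : L2fun mu,
  \int[mu_w]_x (h (phi x) `^ p * (normc (condexpC mu phi w (divw w f) x) ^+ 2)%:E)
  <= \int[mu]_x (h x `^ p * (normc (f x) ^+ 2)%:E)) -> cproj_bounded mu phi w p.
Proof.
move=> H u; have := H (repr u); have [mk _] := bfin_kap mw mphi dom hfin u.
have [kE _] := kapP mw mphi dom hfin u.
rewrite integral_derivM//; last exact: mnorm (sq_repr u).1.
rewrite (funext kE : _ = kap u \o phi).
rewrite (integral_weighted_deriv_phiM (G := fun x => (normc (kap u x) ^+ 2)%:E))//.
exact: mnorm.
Qed.

Lemma condexp_ineq (f : X -> \bar R) e : measurable_fun setT f -> (forall x, 0 <= f x) ->
  measurable_fun setT e -> (forall x, 0 <= e x) ->
  (forall x, condexp mu phi w f x = e (phi x)) ->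
  (\int[mu_w]_x (h (phi x) `^ p * condexp mu phi w f x ^+ 2)
     <= \int[mu_w]_x (h x `^ p * f x ^+ 2)) =
  (\int[mu]_x ((q x)%:E * (e x ^+ 2 * (b x)%:E))
     <= \int[mu]_x ((q x)%:E * (f x ^+ 2 * (om x)%:E))).
Proof.
move=> mf f0 me e0 eE.
rewrite integral_weighted_derivM; [|exact: msqE|by move=> x; exact: expe_ge0].
rewrite (funext eE : _ = e \o phi).
by rewrite (integral_weighted_deriv_phiM (G := fun x => e x ^+ 2));
  [|exact: msqE|move=> x; exact: expe_ge0].
Qed.

Lemma condexp_ineq_weight : WP -> forall f : X -> \bar R,
  measurable_fun setT f -> (forall x, 0 <= f x) ->
  \int[mu_w]_x (h (phi x) `^ p * condexp mu phi w f x ^+ 2)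
  <= \int[mu_w]_x (h x `^ p * f x ^+ 2).
Proof.
move=> qs f mf f0; have [e ce eE] := condexpP mw mphi dom hfin mf f0; have [me e0 _] := ce.
by rewrite (condexp_ineq mf f0 me e0 eE); exact: (cond_jensen mw mphi dom qs).
Qed.

Lemma cond_bounded_condexp :
  (forall f : X -> \bar R, measurable_fun setT f -> (forall x, 0 <= f x) ->
  \int[mu_w]_x (h (phi x) `^ p * condexp mu phi w f x ^+ 2)
  <= \int[mu_w]_x (h x `^ p * f x ^+ 2)) -> cond_bounded mu phi w p.
Proof.
move=> H f e mf f0 If ce.
have mfE : measurable_fun setT (EFin \o f) by exact/measurable_EFinP.
have f0E x : 0 <= (EFin \o f) x by rewrite lee_fin.
have := H _ mfE f0E; have [e' ce' eE'] := condexpP mw mphi dom hfin mfE f0E.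
have [me' e0' _] := ce'; have [me e0 _] := ce.
rewrite (condexp_ineq mfE f0E me' e0' eE').
have -> : \int[mu]_x ((q x)%:E * ((EFin \o f) x ^+ 2 * (om x)%:E)) =
    \int[mu]_x (q x * (f x ^+ 2 * om x))%:E.
  by apply: eq_integral => x _; rewrite expe2 -!EFinM.
apply: le_trans; rewrite le_eqVlt; apply/orP; left; apply/eqP.
have [eb _] := jensen_fine mw mphi dom hfin mf f0 If ce.
have [eb' _] := jensen_fine mw mphi dom hfin mf f0 If ce'.
apply: ae_ge0_eq_integralT.
- apply/measurable_EFinP; apply: measurable_funM => //; apply: measurable_funM => //.
  by apply: measurable_funX; exact: measurableT_comp.
- by move=> x; rewrite lee_fin mulr_ge0// mulr_ge0// sqr_ge0.
- by apply: emeasurable_funM => //; apply: emeasurable_funM => //; exact: msqE.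
- by move=> x; rewrite mule_ge0// mule_ge0// expe_ge0.
- apply: filterS3 eb eb' (cond_unique mw mphi dom ce ce') => x h1 h2 h3.
  have [bx|bx] := eqVneq (b x) 0%R; first by rewrite bx mule0 mulr0 mulr0 mule0.
  have fin (t : \bar R) : 0 <= t -> t * (b x)%:E = (fine t * b x)%:E -> t = (fine t)%:E.
    case: t => [r| |]// _; rewrite gt0_mulye// lte_fin lt_neqAle eq_sym bx b0//.
  have E : fine (e x) = fine (e' x).
    by move: h3; rewrite h1 h2 => -[] /(mulIf bx).
  by rewrite (fin _ (e0' x) h2) -E expe2 -!EFinM.
Qed.

Let F y := h (phi y) `^ p / h y `^ p.

Let mF : measurable_fun setT F.
Proof.
apply: emeasurable_funM; first exact: (measurableT_comp mhp mphi).
by apply: measurable_ge0_inve => // x; exact: poweR_ge0.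
Qed.

Let F0 x : 0 <= F x.
Proof. by rewrite mule_ge0 ?poweR_ge0// inve_ge0 poweR_ge0. Qed.

(** The quotient of (iv) inverts [0] to [+oo] and the one of [weight_pair] inverts it to [0]; they
    are compared only where [b > 0]. *)
Let FE : {ae mu, forall x, w x != 0%R -> (0 < b x)%R -> F x = (q (phi x) / q x)%:E}.
Proof.
apply: filterS2 hpE (transfer_ae mw mphi dom hpE) => x h1 h2 w0 bx.
by rewrite /F h1 (h2 w0) inver gt_eqF ?powR_gt0// -EFinM.
Qed.

Let FI (k : X -> R) : measurable_fun setT k -> (forall x, (0 <= k x)%R) ->
  {ae mu, forall x, w x != 0%R -> (0 < b x)%R} ->
  \int[mu]_x (k (phi x) * (q (phi x) / q x) * om x)%:E =
  \int[mu]_x ((k (phi x))%:E * (F x * (om x)%:E)).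
Proof.
move=> mk k0 wb; have mkp : measurable_fun setT (fun x => k (phi x)) := measurableT_comp mk mphi.
apply: ae_ge0_eq_integralT.
- apply/measurable_EFinP; apply: measurable_funM => //; apply: measurable_funM => //.
  apply: measurable_funM; first exact: (measurableT_comp mq mphi).
  exact: (measurableT_comp (@measurable_invr R) mq).
- by move=> x; rewrite lee_fin mulr_ge0// mulr_ge0// divr_ge0.
- by apply: emeasurable_funM; [exact/measurable_EFinP|exact: emeasurable_funM].
- by move=> x; rewrite mule_ge0 ?lee_fin// mule_ge0.
- apply: filterS2 wb FE => x wb Fx; have [w0|w0] := eqVneq (w x) 0%R.
    have ox : om x = 0%R by apply/eqP; rewrite weight_neq0 w0.
    by rewrite ox mulr0 !mule0.
  by rewrite (Fx w0 (wb w0)) -mulrA.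
Qed.

(** The bound on the conditional expectation concerns [g o phi] almost everywhere for [mu_w], so the
    integrals against [b mu] are pulled back along [phi] before it is applied. *)
Lemma weight_condexp_le1 :
  {ae mu_w, forall x, 0 < h x} /\ {ae mu_w, forall x, condexp mu phi w F x <= 1} -> WP.
Proof.
move=> [/(ae_weighted_measure mu mw) hp /(ae_weighted_measure mu mw) le1].
have wb : {ae mu, forall x, w x != 0%R -> (0 < b x)%R}.
  by apply: filterS2 hp hE => x + hx w0 => /(_ w0); rewrite hx lte_fin.
split=> //; first by apply: filterS wb => x wx /wx bx; rewrite powR_gt0.
move=> k mk k0; have [g cg gE] := condexpP mw mphi dom hfin mF F0; have [mg g0 _] := cg.
have mkE : measurable_fun setT (fun x => (k x)%:E) by exact/measurable_EFinP.
have kE0 x : 0 <= (k x)%:E by rewrite lee_fin.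
rewrite FI// (transfer_cond mw mphi dom mF F0 cg mkE kE0).
have mkg : measurable_fun setT (fun x => (k x)%:E * g x) by exact: emeasurable_funM.
have kg0 x : 0 <= (k x)%:E * g x by rewrite mule_ge0.
have -> : \int[mu]_x ((k x)%:E * (g x * (b x)%:E)) = \int[mu]_x ((k (phi x))%:E * g (phi x) * (om x)%:E).
  by rewrite (transfer_b mw mphi dom hfin mkg kg0); apply: eq_integral => x _; rewrite muleA.
have -> : \int[mu]_x (k x * b x)%:E = \int[mu]_x ((k (phi x))%:E * (om x)%:E).
  by rewrite (transfer_b mw mphi dom hfin mkE kE0).
apply: ae_ge0_le_integralT.
- by apply: emeasurable_funM => //; exact: (measurableT_comp mkg mphi).
- by move=> x; rewrite mule_ge0//; exact: kg0.
- by apply: emeasurable_funM => //; exact: (measurableT_comp mkE mphi).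
- by move=> x; rewrite mule_ge0//; exact: kE0.
- apply: filterS le1 => x; rewrite gE; have [w0 _|w0 /(_ isT) le] := eqVneq (w x) 0%R.
    have -> : om x = 0%R by apply/eqP; rewrite weight_neq0 w0.
    by rewrite !mule0.
  by rewrite lee_wpmul2r// -[leRHS]mule1 lee_wpmul2l.
Qed.

(** Indicators in place of [k] give [g b <= b] almost everywhere. After composition with [phi] the
    factor [b o phi] is positive almost everywhere for [mu_w] and cancels. *)
Lemma condexp_le1_weight : WP ->
  {ae mu_w, forall x, 0 < h x} /\ {ae mu_w, forall x, condexp mu phi w F x <= 1}.
Proof.
move=> [_ _ _ sp H].
have wb : {ae mu, forall x, w x != 0%R -> (0 < b x)%R}.
  apply: filterS sp => x sx /sx qx; rewrite lt_neqAle b0 andbT eq_sym; apply/eqP => bx.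
  by move: qx; rewrite bx powR0 ?ltxx// gt_eqF.
split; apply/(ae_weighted_measure mu mw).
  by apply: filterS2 wb hE => x wx -> w0; rewrite lte_fin wx.
have [g cg gE] := condexpP mw mphi dom hfin mF F0; have [mg g0 gI] := cg.
have gb : {ae mu, forall x, g x * (b x)%:E <= (b x)%:E}.
  apply: ae_le_of_integral => //.
  - exact: emeasurable_funM.
  - by move=> x; rewrite mule_ge0.
  move=> D mD; have mi : measurable_fun setT (\1_D : X -> R) by exact: measurable_indic.
  have i0 x : (0 <= (\1_D x : R))%R by rewrite indicE.
  have := H _ mi i0; rewrite FI//.
  rewrite (transfer_cond mw mphi dom mF F0 cg (k := fun x => (\1_D x)%:E)); last 2 first.
  - exact: measurable_indicE.
  - by move=> x; rewrite lee_fin.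
  rewrite -integral_indicM// => /le_trans; apply.
  by rewrite le_eqVlt; apply/orP; left; apply/eqP; rewrite [RHS]integral_indicM.
apply: filterS2 (transfer_ae mw mphi dom gb) (ae_derivR_phi_gt0 mw mphi dom hfin) => x h1 h2 w0.
rewrite gE; have := h1 w0; have bp := h2 w0.
by rewrite -[leRHS]mul1e lee_pmul2r.
Qed.
End theorem_equivalences.

Local Open Scope ereal_scope.

Theorem theorem21 (d : measure_display) (X : measurableType d) (R : realType)
    (mu : {sigma_finite_measure set X -> \bar R})
    (w : X -> R[i]) (phi : X -> X) (p : R)
    (mu_w := weighted_measure mu w)
    (h := wcomp_deriv mu phi w)
    (E := condexp mu phi w)
    (EC := condexpC mu phi w) :
  cmeasurable w ->
  measurable_fun setT phi ->
  weighted_pushforward mu phi w `<< mu ->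
  densely_defined (L2dot mu) (wcomp mu phi w) ->
  (0 < p)%R ->
  [<-> (* (i) *)
       p_hyponormal (L2dot mu) p (wcomp mu phi w);
       (* (ii) *)
       forall f : L2fun mu,
         \int[mu_w]_x (h (phi x) `^ p * (normc (EC (divw w f) x) ^+ 2)%:E)
         <= \int[mu]_x (h x `^ p * (normc (f x) ^+ 2)%:E);
       (* (iii) *)
       forall f : X -> \bar R, measurable_fun setT f -> (forall x, 0 <= f x) ->
         \int[mu_w]_x (h (phi x) `^ p * E f x ^+ 2)
         <= \int[mu_w]_x (h x `^ p * f x ^+ 2);
       (* (iv) *)
       {ae mu_w, forall x, 0 < h x} /\
       {ae mu_w, forall x, E (fun y => h (phi y) `^ p / h y `^ p) x <= 1}].
Proof.
move=> mw mphi dom dd p0.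
have hfin := densely_defined_deriv_lty mw mphi dom dd.
have WP_of_bounded := weight_cond_bounded mw mphi dom hfin p0.
have WP_of_cproj H := WP_of_bounded (cond_bounded_cproj mw mphi dom hfin H).
have hyp := p_hyponormalP mw mphi dom hfin p0 dd.
(* Each implication of the cycle passes through [weight_pair] for the weight [b^p]. *)
tfae.
- move=> /hyp H; exact: condexpC_ineq_weight (WP_of_cproj H).
- move=> /(cproj_bounded_condexpC mw mphi dom hfin) H.
  exact: condexp_ineq_weight (WP_of_cproj H).
- move=> /(cond_bounded_condexp mw mphi dom hfin) H.
  exact: condexp_le1_weight (WP_of_bounded H).
- move=> /(weight_condexp_le1 mw mphi dom hfin) H.
  exact/hyp/cproj_bounded_weight.
Qed.
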